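(* Let $A$ be a semilocal Noether algebra with Jacobson radical $J$, and let $d\ge 0$ be an integer. The following conditions are equivalent: (1) the algebra $A$ is $d$-Gorenstein; (2) $\operatorname{Gproj\,dim}_A(A/J)\le d$; (3) $\operatorname{Gproj\,dim}_{A^{\mathrm{op}}}(A/J)\le d$.
   Context: A Noether algebra is an algebra $A$ over a commutative noetherian ring $R$ (with the image of $R$ central in $A$) that is finitely generated as an $R$-module; it is a semilocal Noether algebra if $R$ can be chosen semilocal, i.e. with finitely many maximal ideals. Such an $A$ is noetherian on both sides. Modules are left modules; modules over the opposite ring $A^{\mathrm{op}}$ are right $A$-modules. A ring $A$ is Iwanaga-Gorenstein if it is noetherian on both sides and $\operatorname{inj\,dim}_A A$ and $\operatorname{inj\,dim}_{A^{\mathrm{op}}}A$ are both finite (they are then equal); $A$ is $d$-Gorenstein if it is Iwanaga-Gorenstein and $\operatorname{inj\,dim}_A A\le d$. An $A$-module $G$ is Gorenstein projective if it is a cokernel of a differential in an exact (two-sided unbounded) complex $P$ of projective $A$-modules such that $\operatorname{Hom}_A(P,Q)$ is exact for every projective $A$-module $Q$. $\operatorname{Gproj\,dim}_A M$ is the least $n\ge 0$ for which there is an exact sequence $0\to G_n\to\cdots\to G_0\to M\to 0$ with all $G_i$ Gorenstein projective, and $\infty$ if there is none. *)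

(* Defs.v *)
(* Mathematical Components, with classical logic from mathcomp.classical.
   Left A-modules are [lmodType A]; right A-modules are [lmodType A^c], where
   A^c is the opposite ring.  [pzRingType] is used throughout, so that the zero
   ring is allowed.  Submodules and ideals are boolean predicates; under the
   axioms of boolp these are the same as arbitrary subsets. *)
From HB Require Import structures.
From mathcomp Require Import all_boot all_algebra.
From mathcomp Require Import boolp classical_sets cardinality.

Set Implicit Arguments.
Unset Strict Implicit.
Unset Printing Implicit Defensive.

Import GRing.Theory.
Local Open Scope ring_scope.

Definition surjective (T U : Type) (f : T -> U) : Prop :=
  forall y, exists x, f x = y.

Definition exact_at (T U : Type) (V : zmodType) (f : T -> U) (g : U -> V) :
  Prop := forall y, g y = 0 <-> exists x, f x = y.

Section Submodules.
Variables (A : pzRingType) (V : lmodType A).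

Definition maximal_submod (m : {pred V}) : Prop :=
  [/\ submod_closed m,
      exists x, x \notin m
    & forall n : {pred V}, submod_closed n -> {subset m <= n} ->
        n =i m \/ n =i predT].

Definition noetherian : Prop :=
  forall I : nat -> {pred V},
    (forall k, submod_closed (I k)) ->
    (forall k, {subset I k <= I k.+1}) ->
    exists N, forall k, (N <= k)%N -> I k =i I N.

End Submodules.

Section QuotientModule.
Variables (A : pzRingType) (V : lmodType A) (U : {pred V}).
Hypothesis subU : submod_closed U.

(* U, keyed by subU to carry the closure instance required by Quotient.quot *)
Definition submod_pred of submod_closed U : {pred V} := U.
HB.instance Definition _ :=
  GRing.isZmodClosed.Build V (submod_pred subU) (subU : zmod_closed U).

Local Notation quot := (Quotient.quot (submod_pred subU)).
Local Notation pi := \pi_quot%qT.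

Definition quotmod : Type := quot.
HB.instance Definition _ := GRing.Zmodule.on quotmod.

Definition quotmod_scale (a : A) (x : quotmod) : quotmod :=
  pi (a *: repr x).

Let pi_add : {morph (pi : V -> quotmod) : u v / u + v} := @Quotient.pi_add _ _.

Lemma quotmod_pi_scale a (v : V) :
  quotmod_scale a (pi v) = pi (a *: v).
Proof.
apply/eqP; rewrite /quotmod_scale -Quotient.idealrBE -scalerBr.
have [U0 lin] := subU; rewrite -[_ *: _]addr0; apply: lin => //.
by rewrite -[_ \in U]/(_ \in submod_pred subU) Quotient.idealrBE reprK.
Qed.

Lemma quotmod_piP (x : quotmod) : exists v, x = pi v.
Proof. by exists (repr (x : quot)); rewrite reprK. Qed.

Fact quotmod_scaleA a b x :
  quotmod_scale a (quotmod_scale b x) = quotmod_scale (a * b) x.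
Proof.
by have [v ->] := quotmod_piP x; rewrite !quotmod_pi_scale scalerA.
Qed.

Fact quotmod_scale1 : left_id 1 quotmod_scale.
Proof.
by move=> x; have [v ->] := quotmod_piP x; rewrite quotmod_pi_scale scale1r.
Qed.

Fact quotmod_scaleDr : right_distributive quotmod_scale +%R.
Proof.
move=> a x y; have [u ->] := quotmod_piP x; have [v ->] := quotmod_piP y.
by rewrite !quotmod_pi_scale -!pi_add !quotmod_pi_scale scalerDr pi_add.
Qed.

Fact quotmod_scaleDl x : {morph quotmod_scale^~ x : a b / a + b}.
Proof.
move=> a b; have [v ->] := quotmod_piP x.
by rewrite !quotmod_pi_scale scalerDl pi_add.
Qed.

HB.instance Definition _ := GRing.Zmodule_isLmodule.Build A quotmod
  quotmod_scaleA quotmod_scale1 quotmod_scaleDr quotmod_scaleDl.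

End QuotientModule.

Section Jacobson.
Variable A : pzRingType.

Definition jacobson : {pred A} :=
  fun x => `[< forall m : {pred A^o}, maximal_submod m -> x \in m >].

Lemma jacobsonP x :
  reflect (forall m : {pred A^o}, maximal_submod m -> x \in m)
          (x \in jacobson).
Proof. exact: asboolP. Qed.

Lemma jacobson_submodl : submod_closed (jacobson : {pred A^o}).
Proof.
split=> [|a x y /jacobsonP Jx /jacobsonP Jy].
  by apply/jacobsonP=> m [[]].
apply/jacobsonP=> m mm; have [[_ lin] _ _] := mm.
by apply: lin; [apply: Jx | apply: Jy].
Qed.

Lemma jacobsonMr (a x : A) : x \in jacobson -> x * a \in jacobson.
Proof.
move=> /jacobsonP Jx; apply/jacobsonP=> m mm.
have [[m0 lin] [z0 nz0] maxm] := mm.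
have [ma|nma] := boolP (a \in m).
  by have := lin x a 0 ma m0; rewrite /GRing.scale /= addr0.
pose m' : {pred A^o} := fun y : A => (y * a : A) \in m.
have m'E y : (y \in m') = ((y * a : A) \in m) by [].
suff /Jx : maximal_submod m' by [].
split.
- split=> [|b u v]; rewrite !m'E; first by rewrite mul0r.
  move=> mu mv; rewrite mulrDl.
  by rewrite -[_ *: u * a]mulrA; apply: lin.
- by exists 1; rewrite m'E mul1r.
move=> n [n0 nlin] m'n.
have [nm'|/existsNP[y /not_implyP[ny /negP nm'y]]] :=
  pselect (forall y, y \in n -> y \in m').
  by left=> y; apply/idP/idP; [apply: nm' | apply: m'n].
right=> t; rewrite inE; apply/idP.
pose q : {pred A^o} := fun z : A =>
  `[< exists b : A, (z - b * (y * a) : A) \in m >].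
have qP z : reflect (exists b : A, (z - b * (y * a) : A) \in m) (z \in q).
  exact: asboolP.
have [] := maxm q.
- split=> [|c u v /qP[b mb] /qP[b' mb']].
    by apply/qP; exists 0; rewrite mul0r subr0.
  apply/qP; exists (c * b + b').
  have -> : (c *: u + v - (c * b + b') * (y * a) : A)
          = c *: (u - b * (y * a) : A^o) + (v - b' * (y * a) : A).
    by rewrite mulrDl opprD addrACA /GRing.scale /= mulrBr mulrA.
  exact: lin.
- by move=> z mz; apply/qP; exists 0; rewrite mul0r subr0.
- move=> qm; have : (y * a : A) \in m.
    by rewrite -qm; apply/qP; exists 1; rewrite mul1r subrr.
  by move/negP: nm'y.
move=> qT; have /qP[b mb] : (a : A) \in q by rewrite qT.
have n1b : (1 - b * y : A) \in n.
  by apply: m'n; rewrite m'E mulrBl mul1r -mulrA.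
have n1 : (1 : A) \in n.
  by have := nlin b y _ ny n1b; rewrite /GRing.scale /= addrC subrK.
by have := nlin t 1 0 n1 n0; rewrite /GRing.scale /= mulr1 addr0.
Qed.

Lemma jacobson_submodr : submod_closed (jacobson : {pred (A^c)^o}).
Proof.
have [J0 Jlin] := jacobson_submodl.
split=> // a x y Jx Jy; have := Jlin 1 _ _ (jacobsonMr a Jx) Jy.
by rewrite scale1r.
Qed.

(* A / J as a left and as a right A-module *)
Definition residuel : lmodType A := quotmod jacobson_submodl.
Definition residuer : lmodType A^c := quotmod jacobson_submodr.

End Jacobson.

Section SemilocalNoetherAlgebra.

Definition semilocal (R : comPzRingType) : Prop :=
  finite_set [set m : {pred R^o} | maximal_submod m].

(* the structure map f makes A an R-algebra, with r acting by f r * _ *)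
Definition semilocal_noether_algebra (A : pzRingType) : Prop :=
  exists (R : comPzRingType) (f : {rmorphism R -> A}),
    [/\ noetherian R^o,
        semilocal R,
        forall r x, f r * x = x * f r
      & exists s : seq A, forall x, exists c : nat -> R,
          x = \sum_(i < size s) f (c i) * s`_i].

End SemilocalNoetherAlgebra.

Section HomologicalDimensions.
Variable A : pzRingType.
Implicit Types M N P Q G I : lmodType A.

Definition projective P : Prop :=
  forall M N (g : {linear M -> N}) (f : {linear P -> N}), surjective g ->
    exists h : {linear P -> M}, forall x, g (h x) = f x.

Definition injective_module I : Prop :=
  forall M N (g : {linear M -> N}) (f : {linear M -> I}), injective g ->
    exists h : {linear N -> I}, forall x, h (g x) = f x.

(* P is indexed cohomologically: d i : P i -> P (i + 1) *)
Definition totally_acyclic (P : int -> lmodType A)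
    (d : forall i, {linear P i -> P (i + 1)}) : Prop :=
  [/\ forall i, projective (P i),
      forall i, exact_at (d i) (d (i + 1))
    & forall Q, projective Q ->
        forall i (f : {linear P (i + 1) -> Q}),
          (forall x, f (d i x) = 0) <->
          exists g : {linear P (i + 1 + 1) -> Q},
            forall y, g (d (i + 1) y) = f y].

Definition Gorenstein_projective G : Prop :=
  exists (P : int -> lmodType A) (d : forall i, {linear P i -> P (i + 1)}),
    totally_acyclic d /\
    exists (i : int) (p : {linear P (i + 1) -> G}),
      exact_at (d i) p /\ surjective p.

(* 0 -> G_n -> ... -> G_0 -> M -> 0, continued by zero modules *)
Definition Gproj_resolution M (n : nat) : Prop :=
  exists (G : nat -> lmodType A) (d : forall i, {linear G i.+1 -> G i})
         (e : {linear G 0%N -> M}),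
    [/\ forall i, (i <= n)%N -> Gorenstein_projective (G i),
        forall i, (n < i)%N -> forall x : G i, x = 0,
        surjective e,
        exact_at (d 0%N) e
      & forall i, exact_at (d i.+1) (d i)].

Definition Gprojdim_le M (d : nat) : Prop :=
  exists2 n, (n <= d)%N & Gproj_resolution M n.

(* 0 -> M -> I^0 -> ... -> I^n -> 0, continued by zero modules *)
Definition inj_resolution M (n : nat) : Prop :=
  exists (I : nat -> lmodType A) (d : forall i, {linear I i -> I i.+1})
         (e : {linear M -> I 0%N}),
    [/\ forall i, (i <= n)%N -> injective_module (I i),
        forall i, (n < i)%N -> forall x : I i, x = 0,
        injective e,
        exact_at e (d 0%N)
      & forall i, exact_at (d i) (d i.+1)].

Definition injdim_le M (d : nat) : Prop :=
  exists2 n, (n <= d)%N & inj_resolution M n.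

End HomologicalDimensions.

Definition Iwanaga_Gorenstein (A : pzRingType) : Prop :=
  [/\ noetherian A^o,
      noetherian (A^c)^o,
      exists n, injdim_le A^o n
    & exists n, injdim_le (A^c)^o n].

Definition Gorenstein (d : nat) (A : pzRingType) : Prop :=
  Iwanaga_Gorenstein A /\ injdim_le A^o d.

(* Main.v *)
Require Import Defs.
From HB Require Import structures.
From mathcomp Require Import all_boot all_order all_algebra.
From mathcomp Require Import boolp classical_sets functions cardinality.

(* [Ext] is handled through a fixed injective coresolution of the coefficient
   module: [Ext^(k+1)(M, N) = 0] means that every map from [M] to the [(k+1)]-st
   cosyzygy of [N] lifts to the [k]-th injective term.

   (1) => (2).  Let [G] be a [d]-th syzygy of a finitely generated [M].  Since
   inj dim A <= d, [Ext^i(G, A) = 0] for [i > 0].  Dualize a free resolution of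
   [G] and splice it with a free resolution of [G^* = Hom(G, A)]: this is an exact
   complex of free right modules, and as the right injective dimension is finite,
   so is its dual, a totally acyclic complex having [G] as a cokernel.

   (2) => inj dim A <= d.  [Ext^i(A/J, A) = 0] for [i > d], hence the same holds for
   simple modules, which are summands of [A/J].  Devissage: for [x] in the radical of
   [R] acting injectively on [M], the vanishing for [M/xM] makes [x] surjective on
   the finitely generated [R]-module [Ext^i(M, A)], which is zero by Nakayama.  Now
   apply Baer's criterion to the [d]-th cosyzygy of [A].

   (2) => inj dim of the right module A is <= d.  Let [S] be a simple right module,
   [Q] a free resolution of it and [m > d].  Then [E = Ext^m(S, A)] is the homology of
   the dual complex at [Q_m^*], and it is killed by the radical of [R].  Hence [E]
   embeds in a quotient [X] of [Q_m^*] on which the radical is nilpotent.  Such an [X]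
   has finite length, so by (2) it has Gorenstein dimension at most [d] up to a
   complement, and embeds in some [L] of projective dimension at most [d].  The map
   [Q_m^* -> X -> L] is a cycle of [S (x) L] in degree [m]; as [Tor_m(S, L) = 0] it
   is a boundary, i.e. it vanishes on the cocycles, so [E -> L] is zero and [E = 0].

   Together with the first step for the opposite algebra this gives (2) => (3), and
   (3) => (1) is symmetric. *)

Set Implicit Arguments.
Unset Strict Implicit.
Unset Printing Implicit Defensive.

Import Order.TTheory GRing.Theory Num.Theory.
Local Open Scope classical_set_scope.
Local Open Scope ring_scope.

(** * Short exact sequences *)

Definition mkLinear (A : pzRingType) (U V : lmodType A) (f : U -> V)
  (lf : linear f) : {linear U -> V} :=
  HB.pack f (GRing.isLinear.Build A U V *:%R f lf).

Section Modules.
Variable A : pzRingType.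
Implicit Types K L M N P U V X Y : lmodType A.

Definition ses K L M (i : {linear K -> L}) (p : {linear L -> M}) : Prop :=
  [/\ injective i, exact_at i p & surjective p].

Definition submodule V (U : V -> Prop) : Prop :=
  U 0 /\ forall a x y, U x -> U y -> U (a *: x + y).

Lemma ses_inj K L M (i : {linear K -> L}) (p : {linear L -> M}) :
  ses i p -> injective i.
Proof. by case. Qed.

Lemma ses_exact K L M (i : {linear K -> L}) (p : {linear L -> M}) :
  ses i p -> exact_at i p.
Proof. by case. Qed.

Lemma ses_surj K L M (i : {linear K -> L}) (p : {linear L -> M}) :
  ses i p -> surjective p.
Proof. by case. Qed.

Section Sub.
Variables (V : lmodType A) (U : V -> Prop).

Definition submod_pd : {pred V} := fun x => `[<U x>].

Lemma submod_pdP x : x \in submod_pd <-> U x.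
Proof. by split=> /asboolP. Qed.

Lemma submod_pd_closed : submodule U -> submod_closed submod_pd.
Proof.
case=> U0 Ulin; split=> [|a x y /submod_pdP Ux /submod_pdP Uy]; apply/submod_pdP => //.
exact: Ulin.
Qed.

End Sub.

Lemma submodule_pred V (U : {pred V}) :
  submod_closed U -> submodule (fun x => x \in U).
Proof. by case. Qed.

Section SubType.
Variables (V : lmodType A) (U : V -> Prop).
Hypothesis subU : submodule U.

(** The closure proof is a parameter of the type, so that the module structure built from it can be
    inferred from the type alone. *)
Record submod (sU : submodule U) := Submod {
  submod_val : V;
  _ : submod_val \in submod_pd U
}.
Local Notation sub := (submod subU).
HB.instance Definition _ := [isSub for @submod_val subU].
HB.instance Definition _ := [Choice of sub by <:].

Fact submod_subsemimod : subsemimod_closed (submod_pd U).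
Proof.
have [U0 Ulin] := subU.
split=> [|a x /submod_pdP Ux]; last first.
  by apply/submod_pdP; rewrite -[_ *: _]addr0; apply: Ulin.
split=> [|x y /submod_pdP Ux /submod_pdP Uy]; apply/submod_pdP => //.
by rewrite -[x]scale1r; apply: Ulin.
Qed.
HB.instance Definition _ :=
  GRing.SubChoice_isSubLmodule.Build A V (submod_pd U) sub submod_subsemimod.

End SubType.

Lemma submod_sub V (U : V -> Prop) : submodule U ->
  exists (K : lmodType A) (i : {linear K -> V}),
    injective i /\ forall x, U x <-> exists k, i k = x.
Proof.
move=> sU; exists (submod sU), (val : submod sU -> V).
split=> [|x]; first exact: val_inj.
split=> [Ux|[[y Uy] <-]]; last exact/submod_pdP.
by exists (Submod sU ((submod_pdP _ _).2 Ux)).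
Qed.

Lemma quotmod_pi V (U : {pred V}) (cU : submod_closed U) :
  exists p : {linear V -> quotmod cU}, surjective p /\ forall x, p x = 0 <-> x \in U.
Proof.
pose p (x : V) : quotmod cU := (\pi_(Quotient.quot (submod_pred cU)) x)%qT.
have lp : linear p.
  move=> a x y; rewrite /p [a *: (_ : quotmod cU)]quotmod_pi_scale.
  exact: (@Quotient.pi_add _ (submod_pred cU)).
exists (mkLinear lp); split=> [y|x].
  by have [v ->] := quotmod_piP y; exists v.
have p0 : p 0 = 0 by exact: linear0 (mkLinear lp).
have E : (x \in submod_pred cU) = (p x == p 0).
  by rewrite -[RHS](@Quotient.idealrBE _ (submod_pred cU)) subr0.
rewrite -[x \in _]/(x \in submod_pred cU) E p0.
by split=> [px0|/eqP//]; apply/eqP.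
Qed.

Lemma quotmod_quot V (U : V -> Prop) : submodule U ->
  exists (M : lmodType A) (p : {linear V -> M}),
    surjective p /\ forall x, p x = 0 <-> U x.
Proof.
move=> sU; have [p [sp pE]] := quotmod_pi (submod_pd_closed sU).
by exists (quotmod (submod_pd_closed sU)), p; split=> // x; rewrite pE submod_pdP.
Qed.

Lemma submod_ses V (U : V -> Prop) : submodule U ->
  exists (K M : lmodType A) (i : {linear K -> V}) (p : {linear V -> M}),
    ses i p /\ forall x, p x = 0 <-> U x.
Proof.
move=> sU; have [K [i [ii Ki]]] := submod_sub sU.
have [M [p [sp kp]]] := quotmod_quot sU.
exists K, M, i, p; split=> //; split=> // x.
by rewrite kp Ki.
Qed.

Lemma submodule_ker V X (f : {linear V -> X}) : submodule (fun x => f x = 0).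
Proof. by split=> [|a x y fx fy]; rewrite ?linear0 // linearP fx fy scaler0 addr0. Qed.

Lemma submodule_im V X (f : {linear V -> X}) : submodule (fun y => exists x, f x = y).
Proof.
split=> [|a _ _ [x <-] [y <-]]; first by exists 0; rewrite linear0.
by exists (a *: x + y); rewrite linearP.
Qed.

Lemma ker_ses L M (p : {linear L -> M}) : surjective p ->
  exists K (i : {linear K -> L}), ses i p.
Proof.
by move=> sp; have [K [i [ii Ki]]] := submod_sub (submodule_ker p); exists K, i.
Qed.

Lemma coker_ses K L (i : {linear K -> L}) : injective i ->
  exists M (p : {linear L -> M}), ses i p.
Proof.
move=> ii; have [M [p [sp kp]]] := quotmod_quot (submodule_im i).
by exists M, p.
Qed.

Lemma linear_inj0 K L (i : {linear K -> L}) :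
  (forall x, i x = 0 -> x = 0) -> injective i.
Proof. by move=> i0 x y exy; apply/subr0_eq/i0; rewrite linearB exy subrr. Qed.

(** Compose [f] with a set-theoretic section of [p]: two choices of preimage differ by an element of
    the kernel, so the result is linear. *)
Lemma surj_factor L M X (p : {linear L -> M}) (f : {linear L -> X}) :
  surjective p -> (forall x, p x = 0 -> f x = 0) ->
  exists g : {linear M -> X}, forall x, g (p x) = f x.
Proof.
move=> sp kf; have [s sK] := choice sp.
have lg : linear (fun y => f (s y)).
  move=> a x y; rewrite -linearP; apply/subr0_eq; rewrite -linearB; apply: kf.
  by rewrite linearB linearP !sK subrr.
exists (mkLinear lg) => x /=; apply/subr0_eq; rewrite -linearB; apply: kf.
by rewrite linearB sK subrr.
Qed.

Lemma inj_lift K L X (i : {linear K -> L}) (f : {linear X -> L}) :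
  injective i -> (forall x, exists k, i k = f x) ->
  exists g : {linear X -> K}, forall x, i (g x) = f x.
Proof.
move=> ii /choice[g gK]; have lg : linear g.
  by move=> a x y; apply: ii; rewrite linearP !gK linearP.
by exists (mkLinear lg).
Qed.

Lemma ses_factor K L M X (i : {linear K -> L}) (p : {linear L -> M})
    (f : {linear L -> X}) : ses i p -> (forall k, f (i k) = 0) ->
  exists g : {linear M -> X}, forall x, g (p x) = f x.
Proof.
by case=> _ ex sp fi; apply: surj_factor => // x /ex[k <-].
Qed.

Lemma ses_lift K L M X (i : {linear K -> L}) (p : {linear L -> M})
    (f : {linear X -> L}) : ses i p -> (forall x, p (f x) = 0) ->
  exists g : {linear X -> K}, forall x, i (g x) = f x.
Proof. by case=> ii ex _ pf; apply: inj_lift => // x; apply/ex. Qed.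

Lemma ses_comp0 K L M (i : {linear K -> L}) (p : {linear L -> M}) :
  ses i p -> forall k, p (i k) = 0.
Proof. by case=> _ ex _ k; apply/ex; exists k. Qed.

End Modules.

(** * Pushouts and diagram lemmas *)

Section Diagrams.
Variable A : pzRingType.
Implicit Types C G K L M N P Q X Y : lmodType A.

Lemma linear_pair K L M (f : {linear K -> L}) (g : {linear K -> M}) :
  exists h : {linear K -> (L * M)%type}, forall x, h x = (f x, g x).
Proof.
have lh : linear (fun x => (f x, g x)).
  by move=> a x y; rewrite !linearP.
by exists (mkLinear lh).
Qed.

Lemma linear_copair K L M (f : {linear L -> K}) (g : {linear M -> K}) :
  exists h : {linear (L * M)%type -> K}, forall x, h x = f x.1 + g x.2.
Proof.
have lh : linear (fun x : L * M => f x.1 + g x.2).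
  by move=> a [x1 x2] [y1 y2] /=; rewrite !linearP scalerDr addrACA.
by exists (mkLinear lh).
Qed.

Definition lfst L M : {linear (L * M)%type -> L} := fst.
Definition lsnd L M : {linear (L * M)%type -> M} := snd.

(** [Y] is the quotient of [L * X] by the image of [k |-> (i k, f k)]. Both short exact sequences
    through [Y] are returned, with cokernels unchanged. *)
Lemma pushout K L M X C (i : {linear K -> L}) (p : {linear L -> M})
    (f : {linear K -> X}) (q : {linear X -> C}) : ses i p -> ses f q ->
  exists (Y : lmodType A) (j : {linear X -> Y}) (g : {linear L -> Y})
    (p' : {linear Y -> M}) (q' : {linear Y -> C}),
    [/\ ses j p', ses g q', forall k, g (i k) = j (f k),
        forall l, p' (g l) = p l & forall x, q' (j x) = q x].
Proof.
move=> sp sq; have [ii ep pp] := sp; have [fi eq pq] := sq.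
have [h hE] := linear_pair i f.
have [Y [w [sw kw]]] := quotmod_quot (submodule_im h).
have [inl inlE] : exists f : {linear L -> (L * X)%type}, forall l, f l = (l, 0).
  exact: (linear_pair idfun \0).
(* The sign makes the square commute, since it is [(i k, f k)] that becomes zero in [Y]. *)
have [inr inrE] : exists f : {linear X -> (L * X)%type}, forall x, f x = (0, - x).
  exact: (linear_pair \0 (\- idfun)).
have kwP l x : w (l, x) = 0 <-> exists2 k, l = i k & x = f k.
  rewrite kw; split=> [[k]|[k -> ->]]; last by exists k.
  by rewrite hE => -[<- <-]; exists k.
have [p' p'E] : exists p' : {linear Y -> M}, forall z, p' (w z) = p z.1.
  apply: (surj_factor (f := (p \o lfst _ _))) => //= -[l x] /kwP[k -> _].
  exact: ses_comp0 sp _.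
have [q' q'E] : exists q' : {linear Y -> C}, forall z, q' (w z) = - q z.2.
  have [|q' q'E] := surj_factor (f := (q \o lsnd _ _)) sw.
    by move=> [l x] /kwP[k _ ->]; apply: ses_comp0 sq _.
  by exists (\- q') => z /=; rewrite q'E.
exists Y, (w \o inr), (w \o inl), p', q'; split=> [||k|l|x].
- split=> [|y|m].
  + apply: linear_inj0 => x; rewrite /= inrE => /kwP[k i0 x0].
    have k0 : k = 0 by apply: ii; rewrite -i0 linear0.
    by rewrite -[x]opprK x0 k0 linear0 oppr0.
  + have [[l x] <-] := sw y; rewrite p'E /=; split=> [/ep[k <-]|[x' wx]].
      exists (f k - x); apply/subr0_eq; rewrite inrE -linearB.
      apply/(kwP (_ - _) (_ - _)); exists (- k); rewrite ?linearN ?sub0r //.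
      by rewrite opprB addrAC subrr sub0r.
    have : w ((l, x) - inr x') = 0 by rewrite linearB /= wx subrr.
    rewrite inrE => /(kwP (_ - _) (_ - _))[k /=].
    by rewrite subr0 => -> _; exact: ses_comp0 sp _.
  + by have [l <-] := pp m; exists (w (l, 0)); rewrite p'E.
- split=> [|y|c].
  + apply: linear_inj0 => l; rewrite /= inlE => /kwP[k -> f0].
    by rewrite (_ : k = 0) ?linear0 //; apply: fi; rewrite -f0 linear0.
  + have [[l x] <-] := sw y; rewrite q'E /=; split=> [/eqP|[l' wx]].
      rewrite oppr_eq0 => /eqP/eq[k <-].
      exists (l - i k); apply/subr0_eq; rewrite inlE -linearB.
      apply/(kwP (_ - _) (_ - _)); exists (- k); rewrite ?linearN ?sub0r //.
      by rewrite addrAC subrr sub0r.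
    have : w ((l, x) - inl l') = 0 by rewrite linearB /= wx subrr.
    rewrite inlE => /(kwP (_ - _) (_ - _))[k _ /=].
    by rewrite subr0 => ->; rewrite (ses_comp0 sq) oppr0.
  + by have [x <-] := pq c; exists (w (0, - x)); rewrite q'E /= linearN opprK.
- rewrite /= inlE inrE; apply/subr0_eq; rewrite -linearB.
  by apply/(kwP (_ - _) (_ - _)); exists k; rewrite ?subr0 // sub0r opprK.
- by rewrite /= inlE p'E.
- by rewrite /= inrE q'E /= linearN opprK.
Qed.

(** For submodules [K] of [X] of [Y], take [L = Y/K]: it contains [M = X/K] with quotient
    [Y/X = G]. *)
Lemma third_iso K X M Y G (a : {linear K -> X}) (b : {linear X -> M})
    (u : {linear X -> Y}) (v : {linear Y -> G}) : ses a b -> ses u v ->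
  exists (L : lmodType A) (w : {linear Y -> L}) (s : {linear M -> L})
    (t : {linear L -> G}),
    [/\ ses (u \o a : {linear K -> Y}) w, ses s t,
        forall x, s (b x) = w (u x) & forall y, t (w y) = v y].
Proof.
move=> sb sv; have [ai ab sub] := sb; have [ui uv suv] := sv.
have [L [w sw]] : exists L (w : {linear Y -> L}), ses (u \o a : {linear K -> Y}) w.
  by apply: coker_ses; apply: inj_comp.
have [_ ew sur] := sw.
have [s sE] : exists s : {linear M -> L}, forall x, s (b x) = w (u x).
  by apply: (ses_factor (f := w \o u) sb) => k; rewrite /= (ses_comp0 sw).
have [t tE] : exists t : {linear L -> G}, forall y, t (w y) = v y.
  by apply: (ses_factor sw) => k; rewrite /= (ses_comp0 sv).
exists L, w, s, t; split=> //; split=> [|l|g].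
- apply: linear_inj0 => m; have [x <-] := sub m; rewrite sE => /ew[k /= /ui <-].
  exact: ses_comp0 sb _.
- have [y <-] := sur l; rewrite tE; split=> [/uv[x <-]|[m]].
    by exists (b x); rewrite sE.
  have [x <-] := sub m; rewrite sE => wxy.
  have /ew[k /= uk] : w (y - u x) = 0 by rewrite linearB wxy subrr.
  have -> : y = u (a k + x) by rewrite linearD uk subrK.
  exact: ses_comp0 sv _.
- by have [y <-] := suv g; exists (w y); rewrite tE.
Qed.

Section ThreeByThree.
Variables X1 X2 X3 Y1 Y2 Y3 Z1 Z2 Z3 : lmodType A.
Variables (a1 : {linear X1 -> X2}) (a2 : {linear X2 -> X3}).
Variables (b1 : {linear Y1 -> Y2}) (b2 : {linear Y2 -> Y3}).
Variables (u1 : {linear X1 -> Y1}) (u2 : {linear X2 -> Y2}) (u3 : {linear X3 -> Y3}).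
Variables (v1 : {linear Y1 -> Z1}) (v2 : {linear Y2 -> Z2}) (v3 : {linear Y3 -> Z3}).

(** Nine lemma: the row of cokernels is exact when the other two are. *)
Lemma ses_coker (sa : ses a1 a2) (sb : ses b1 b2)
    (su1 : ses u1 v1) (su2 : ses u2 v2) (su3 : ses u3 v3) :
  (forall x, u2 (a1 x) = b1 (u1 x)) -> (forall x, u3 (a2 x) = b2 (u2 x)) ->
  exists (c1 : {linear Z1 -> Z2}) (c2 : {linear Z2 -> Z3}), ses c1 c2.
Proof.
move=> ua1 ua2.
have [_ ea sa2] := sa; have [ib eb sb2] := sb.
have [iu1 ev1 sv1] := su1; have [iu2 ev2 sv2] := su2; have [iu3 ev3 sv3] := su3.
have [c1 c1E] : exists c1 : {linear Z1 -> Z2}, forall y, c1 (v1 y) = v2 (b1 y).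
  by apply: (ses_factor (f := v2 \o b1) su1) => k; rewrite /= -ua1 (ses_comp0 su2).
have [c2 c2E] : exists c2 : {linear Z2 -> Z3}, forall y, c2 (v2 y) = v3 (b2 y).
  by apply: (ses_factor (f := v3 \o b2) su2) => k; rewrite /= -ua2 (ses_comp0 su3).
exists c1, c2; split=> [|z|z].
- apply: linear_inj0 => z; have [y <-] := sv1 z; rewrite c1E => /ev2[x ux].
  have /ea[x1 ax1] : a2 x = 0.
    by apply: iu3; rewrite ua2 ux (ses_comp0 sb) linear0.
  by apply/ev1; exists x1; apply: ib; rewrite -ua1 ax1.
- have [y <-] := sv2 z; rewrite c2E; split=> [/ev3[x3]|[z1]].
    have [x <-] := sa2 x3; rewrite ua2 => /eqP.
    rewrite -subr_eq0 -linearB => /eqP/eb[y1 bE]; exists (v1 (- y1)).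
    by rewrite c1E linearN bE opprB linearB (ses_comp0 su2) subr0.
  have [y1 <-] := sv1 z1; rewrite c1E => /eqP.
  rewrite -subr_eq0 -linearB => /eqP/ev2[x ux].
  have -> : y = b1 y1 - u2 x by rewrite ux opprB addrC subrK.
  by rewrite (linearB b2) (ses_comp0 sb) sub0r -ua2 linearN (ses_comp0 su3) oppr0.
- by have [y3 <-] := sv3 z; have [y <-] := sb2 y3; exists (v2 y); rewrite c2E.
Qed.

(** Nine lemma for the row of kernels. *)
Lemma ses_ker (sb : ses b1 b2) (Zb1 : {linear Z1 -> Z2}) (Zb2 : {linear Z2 -> Z3})
    (sz : ses Zb1 Zb2)
    (su1 : ses u1 v1) (su2 : ses u2 v2) (su3 : ses u3 v3) :
  (forall y, v2 (b1 y) = Zb1 (v1 y)) -> (forall y, v3 (b2 y) = Zb2 (v2 y)) ->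
  exists (c1 : {linear X1 -> X2}) (c2 : {linear X2 -> X3}), ses c1 c2.
Proof.
move=> vb1 vb2.
have [iz ez _] := sz; have [ib eb sb2] := sb.
have [iu1 ev1 sv1] := su1; have [iu2 ev2 sv2] := su2; have [iu3 ev3 sv3] := su3.
have [c1 c1E] : exists c1 : {linear X1 -> X2}, forall x, u2 (c1 x) = b1 (u1 x).
  apply: (ses_lift (f := b1 \o u1) su2) => x.
  by rewrite /= vb1 (ses_comp0 su1) linear0.
have [c2 c2E] : exists c2 : {linear X2 -> X3}, forall x, u3 (c2 x) = b2 (u2 x).
  apply: (ses_lift (f := b2 \o u2) su3) => x.
  by rewrite /= vb2 (ses_comp0 su2) linear0.
exists c1, c2; split=> [x y exy|x|x].
- by apply/iu1/ib; rewrite -!c1E exy.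
- split=> [c0|[y <-]].
    have /eb[y by1] : b2 (u2 x) = 0 by rewrite -c2E c0 linear0.
    have /ev1[x1 ux1] : v1 y = 0.
      by apply: iz; rewrite -vb1 by1 (ses_comp0 su2) linear0.
    by exists x1; apply: iu2; rewrite c1E ux1.
  by apply: iu3; rewrite c2E c1E (ses_comp0 sb) linear0.
- have [y by2] := sb2 (u3 x).
  have /ez[z1] : Zb2 (v2 y) = 0 by rewrite -vb2 by2 (ses_comp0 su3).
  have [y1 <-] := sv1 z1; rewrite -vb1 => /eqP.
  rewrite eq_sym -subr_eq0 -linearB => /eqP/ev2[x2 ux2].
  by exists x2; apply: iu3; rewrite c2E ux2 linearB by2 (ses_comp0 sb) subr0.
Qed.

End ThreeByThree.

End Diagrams.

(** * Gorenstein projective dimension *)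

Section GorensteinClasses.
Variable A : pzRingType.
Implicit Types C G K L M N P Q X Y : lmodType A.

(** By pushing out along [f], this says that every extension of [M] by [N] splits, i.e. Ext^1(M, N)
    = 0, without choosing a resolution. *)
Definition Ext1_zero M N : Prop :=
  forall K L (i : {linear K -> L}) (p : {linear L -> M}), ses i p ->
  forall f : {linear K -> N}, exists h : {linear L -> N}, forall k, h (i k) = f k.

Definition zero_module M : Prop := forall x : M, x = 0.

Lemma projective_zero P : zero_module P -> projective P.
Proof.
move=> P0 M N g f _; exists \0 => x /=.
by rewrite (P0 x) !linear0.
Qed.

Lemma projective_prod P Q : projective P -> projective Q -> projective (P * Q)%type.
Proof.
move=> pP pQ M N g f sg.
have [inl inlE] : exists h : {linear P -> (P * Q)%type}, forall x, h x = (x, 0).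
  exact: (linear_pair idfun \0).
have [inr inrE] : exists h : {linear Q -> (P * Q)%type}, forall x, h x = (0, x).
  exact: (linear_pair \0 idfun).
have [h1 h1E] := pP _ _ g (f \o inl) sg.
have [h2 h2E] := pQ _ _ g (f \o inr) sg.
have [h hE] := linear_copair h1 h2.
exists h => -[x y]; rewrite hE (linearD g) h1E h2E /= inlE inrE -(linearD f).
by congr (f (_, _)); rewrite /= ?addr0 ?add0r.
Qed.

(** One projective presentation of [M] suffices. Lifting [p] to [u : P -> L] makes [P * K' -> L]
    surjective, and the pair formed by [f] and an extension [g] of its pullback to [K] vanishes on
    the kernel of that map. *)
Lemma Ext1_zeroI K P M N (i : {linear K -> P}) (p : {linear P -> M}) :
  projective P -> ses i p ->
  (forall f : {linear K -> N}, exists g : {linear P -> N}, forall k, g (i k) = f k) ->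
  Ext1_zero M N.
Proof.
move=> pP sp ext K' L i' p' sp' f.
have [_ _ sur] := sp; have [ii' ep' sur'] := sp'.
have [u uE] := pP _ _ p' p sur'.
have [w wE] : exists w : {linear K -> K'}, forall k, i' (w k) = u (i k).
  by apply: (ses_lift (f := u \o i) sp') => k; rewrite /= uE (ses_comp0 sp).
have [g gE] := ext (f \o w).
have [c cE] := linear_copair u i'.
have [d dE] := linear_copair g f.
have [|[x k]|h hE] := @surj_factor _ _ _ _ c d.
- move=> l; have [x px] := sur (p' l).
  have /ep'[k ik] : p' (l - u x) = 0 by rewrite linearB uE px subrr.
  by exists (x, k); rewrite cE /= ik addrC subrK.
- rewrite cE dE /= => uik.
  have /(ses_exact sp)[y yx] : p x = 0.
    by rewrite -uE -[u x](addrK (i' k)) uik sub0r linearN (ses_comp0 sp') oppr0.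
  rewrite -yx gE /= -(linearD f) (_ : w y + k = 0) ?linear0 //.
  by apply: ii'; rewrite linearD wE yx uik linear0.
- exists h => k; rewrite -[i' k]add0r -{1}(linear0 u) -(cE (0, k)) hE dE /=.
  by rewrite linear0 add0r.
Qed.

(** Extend in two stages: first to the preimage [V] of [K] in [Y], whose quotient by [X] is [K],
    then to [Y], whose quotient by [V] is [M]. *)
Lemma Ext1_zero_ext K L M N (i : {linear K -> L}) (p : {linear L -> M}) :
  ses i p -> Ext1_zero K N -> Ext1_zero M N -> Ext1_zero L N.
Proof.
move=> sp eK eM X Y a b sab f.
have [_ eab sb] := sab; have [_ ep sur] := sp.
have [V [c [ic cE]]] := submod_sub (submodule_ker (p \o b)).
have [a' a'E] : exists a' : {linear X -> V}, forall x, c (a' x) = a x.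
  by apply: inj_lift => // x; apply/cE; rewrite /= (ses_comp0 sab) linear0.
have [b' b'E] : exists b' : {linear V -> K}, forall v, i (b' v) = b (c v).
  by apply: (ses_lift (f := b \o c) sp) => v; apply: (cE (c v)).2; exists v.
have sab' : ses a' b'.
  split=> [x y exy|v|k].
  - by apply: (ses_inj sab); rewrite -!a'E exy.
  - split=> [v0|[x <-]].
      have /eab[x ax] : b (c v) = 0 by rewrite -b'E v0 linear0.
      by exists x; apply: ic; rewrite a'E.
    by apply: (ses_inj sp); rewrite b'E a'E (ses_comp0 sab) linear0.
  - have [y yE] := sb (i k); have /cE[v vE] : (p \o b) y = 0.
      by rewrite /= yE (ses_comp0 sp).
    by exists v; apply: (ses_inj sp); rewrite b'E vE.
have scb : ses c (p \o b).
  split=> // m.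
  by have [l <-] := sur m; have [y <-] := sb l; exists y.
have [f' f'E] := eK _ _ _ _ sab' f.
have [h hE] := eM _ _ _ _ scb f'.
by exists h => x; rewrite -a'E hE f'E.
Qed.

Definition proj_coresolving (C : lmodType A -> Prop) : Prop :=
  forall X, C X -> (forall Q, projective Q -> Ext1_zero X Q) /\
  exists P G (i : {linear X -> P}) (p : {linear P -> G}),
    [/\ projective P, ses i p & C G].

(* the modules with [Ext^1(-, Q) = 0] for projective [Q] all of whose iterated
   cosyzygies exist and have the same property *)
Definition semi_Gproj G : Prop := exists2 C, proj_coresolving C & C G.

Lemma semi_Gproj_Ext1 G Q : semi_Gproj G -> projective Q -> Ext1_zero G Q.
Proof. by case=> C cC /cC[+ _]; apply. Qed.

Lemma semi_Gproj_embed X : semi_Gproj X ->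
  exists P G (i : {linear X -> P}) (p : {linear P -> G}),
    [/\ projective P, ses i p & semi_Gproj G].
Proof.
case=> C cC /cC[_ [P [G [i [p [pP sp CG]]]]]].
by exists P, G, i, p; split=> //; exists C.
Qed.

Lemma semi_Gproj_zero M : zero_module M -> semi_Gproj M.
Proof.
exists zero_module => // X X0; split=> [Q pQ K L i p sp f|].
  have [ii ep _] := sp.
  have ip l : exists k, i k = l by apply/ep/X0.
  have [h hE] := inj_lift (f := idfun) ii ip.
  by exists (f \o h) => k /=; congr (f _); apply: ii; rewrite hE.
exists X, X, idfun, \0; split=> //; first exact: projective_zero.
split=> //= x; last by exists x; rewrite (X0 x).
by split=> // _; exists x.
Qed.

(** The class of all such extensions is itself coresolving. As in the horseshoe lemma, the embedding
    of [G] in [P] extends to [X] because Ext^1(G', P) = 0, so [X] embeds in [P * P'], and the nine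
    lemma makes the cokernel an extension of the same kind. *)
Lemma semi_Gproj_ext G X G' (i : {linear G -> X}) (p : {linear X -> G'}) :
  ses i p -> semi_Gproj G -> semi_Gproj G' -> semi_Gproj X.
Proof.
move=> sp sG sG'.
exists (fun X => exists G G' (i : {linear G -> X}) (p : {linear X -> G'}),
   [/\ ses i p, semi_Gproj G & semi_Gproj G']); last by exists G, G', i, p.
move=> {G X G' i p sp sG sG'} X [G [G' [i [p [sp sG sG']]]]].
split=> [Q pQ|].
  by apply: (Ext1_zero_ext sp); apply: semi_Gproj_Ext1.
have [P [C [a [b [pP sab sC]]]]] := semi_Gproj_embed sG.
have [P' [C' [a' [b' [pP' sab' sC']]]]] := semi_Gproj_embed sG'.
have [e eE] := semi_Gproj_Ext1 sG' pP sp a.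
have [u uE] := linear_pair e (a' \o p).
have iu : injective u.
  apply: linear_inj0 => x; rewrite uE => -[ex0 /= px0].
  have /(ses_exact sp)[g gx] : p x = 0 by apply: (ses_inj sab'); rewrite px0 linear0.
  move: ex0; rewrite -gx eE => a0; rewrite (_ : g = 0) ?linear0 //.
  by apply: (ses_inj sab); rewrite a0 linear0.
have [Z [v sv]] := coker_ses iu.
have [inl inlE] : exists h : {linear P -> (P * P')%type}, forall x, h x = (x, 0).
  exact: (linear_pair idfun \0).
have ss : ses inl (lsnd P P').
  split=> [x y|[x y]|y]; first by rewrite !inlE => -[].
    by rewrite /=; split=> [->|[z]]; [exists x | rewrite inlE => -[]].
  by exists (0, y).
have [|x|c1 [c2 sc]] := ses_coker sp ss sab sv sab'.
- by move=> x; rewrite uE inlE eE /= (ses_comp0 sp) linear0.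
- by rewrite uE.
exists (P * P')%type, Z, u, v; split=> //; first exact: projective_prod.
by exists C, C', c1, c2.
Qed.

Lemma Gproj_syzygy G : Gorenstein_projective G ->
  exists K P (i : {linear K -> P}) (p : {linear P -> G}),
    [/\ projective P, ses i p & Gorenstein_projective K].
Proof.
case=> P [d [tac [i [p [ep sp]]]]]; have [pP ex _] := tac.
(* Writing [i] as [j + 1] lets the differential [d j] into [P i] be used without a cast. *)
have [j ej] : exists j, j + 1 = i by exists (i - 1); rewrite subrK.
subst i; have [K [k sk]] := ker_ses sp.
have [p' p'E] : exists p' : {linear P (j + 1) -> K}, forall x, k (p' x) = d (j + 1) x.
  by apply: (ses_lift sk) => x; apply/ep; exists x.
exists K, (P (j + 1 + 1)), k, p; split=> //.
exists P, d; split=> //; exists j, p'; split=> x.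
  rewrite -(ex j x) -p'E; split=> [->|k0]; first by rewrite linear0.
  by apply: (ses_inj sk); rewrite k0 linear0.
have /ep[y yE] := ses_comp0 sk x.
by exists y; apply: (ses_inj sk); rewrite p'E.
Qed.

Lemma Gproj_cosyzygy G : Gorenstein_projective G ->
  exists P C (i : {linear G -> P}) (p : {linear P -> C}),
    [/\ projective P, ses i p & Gorenstein_projective C].
Proof.
case=> P [d [tac [i [p [ep sp]]]]]; have [pP ex _] := tac.
have [k kE] : exists k : {linear G -> P (i + 1 + 1)}, forall x, k (p x) = d (i + 1) x.
  by apply: surj_factor => // x /ep/ex.
have ik : injective k.
  by apply: linear_inj0 => g; have [x <-] := sp g; rewrite kE => /ex/ep.
have [C [q sq]] := coker_ses ik; have [_ eq sur] := sq.
exists (P (i + 1 + 1)), C, k, q; split=> //.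
exists P, d; split=> //; exists (i + 1), q; split=> // x.
rewrite eq; split=> -[y <-]; last by exists (p y); rewrite kE.
by have [z <-] := sp y; exists z; rewrite kE.
Qed.

(** A map from the syzygy [K] to [Q] is a map on [P (j + 1)] killed by the preceding differential;
    exactness of Hom(P, Q) extends it to the next term. *)
Lemma Gproj_Ext1 G Q : Gorenstein_projective G -> projective Q -> Ext1_zero G Q.
Proof.
move=> [P [d [tac [i [p [ep sp]]]]]] pQ; have [pP ex hom] := tac.
have [j ej] : exists j, j + 1 = i by exists (i - 1); rewrite subrK.
subst i; have [K [k sk]] := ker_ses sp.
have [w wE] : exists w : {linear P (j + 1) -> K}, forall x, k (w x) = d (j + 1) x.
  by apply: (ses_lift sk) => x; apply/ep; exists x.
apply: (Ext1_zeroI (pP _) sk) => f.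
have /(hom _ pQ)[g gE] : forall x, (f \o w) (d j x) = 0.
  move=> x; rewrite /= (_ : w _ = 0) ?linear0 //; apply: (ses_inj sk).
  by rewrite wE linear0; apply/ex; exists x.
exists g => y; have /ep[x kx] := ses_comp0 sk y.
have -> : y = w x by apply: (ses_inj sk); rewrite wE.
by rewrite wE gE.
Qed.

Lemma Gproj_semi G : Gorenstein_projective G -> semi_Gproj G.
Proof.
exists (@Gorenstein_projective A) => // X GX; split=> [Q|]; first exact: Gproj_Ext1.
exact: Gproj_cosyzygy.
Qed.

Lemma Gproj_iso G M (f : {linear G -> M}) : Gorenstein_projective G ->
  injective f -> surjective f -> Gorenstein_projective M.
Proof.
move=> [P [d [tac [i [p [ep sp]]]]]] fi fs.
exists P, d; split=> //; exists i, (f \o p); split=> [x|y].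
  rewrite -(ep x) /=; split=> [f0|->]; last by rewrite linear0.
  by apply: fi; rewrite f0 linear0.
by have [g <-] := fs y; have [x <-] := sp g; exists x.
Qed.

(** Induction along a Gorenstein projective resolution. The base case is asked for every [n] because
    a resolution may be shorter than the bound [d]. *)
Lemma Gprojdim_ind (S : nat -> lmodType A -> Prop) :
  (forall n G, Gorenstein_projective G -> S n G) ->
  (forall n K G M (i : {linear K -> G}) (p : {linear G -> M}), ses i p ->
    Gorenstein_projective G -> S n K -> S n.+1 M) ->
  forall M d, Gprojdim_le M d -> S d M.
Proof.
move=> SG Sstep M d [n nd [G [dl [e [Gp G0 se ee ed]]]]].
elim: n d M nd G dl e Gp G0 se ee ed => [|n IH] d M nd G dl e Gp G0 se ee ed.
  apply: SG; apply: (Gproj_iso (f := e)) => //; first exact: Gp.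
  by apply: linear_inj0 => x /ee[y <-]; rewrite (G0 1%N isT y) linear0.
case: d nd => // d nd; have [K [k sk]] := ker_ses se.
have [e' e'E] : exists e' : {linear G 1%N -> K}, forall x, k (e' x) = dl 0%N x.
  by apply: (ses_lift sk) => x; apply/ee; exists x.
apply: (Sstep _ _ _ _ _ _ sk); first exact: Gp.
apply: (IH d K nd (fun i => G i.+1) (fun i => dl i.+1) e') => [i|i|x|x|i].
- by move=> ni; apply: Gp.
- by move=> ni; apply: G0.
- have /ee[y yE] := ses_comp0 sk x.
  by exists y; apply: (ses_inj sk); rewrite e'E.
- rewrite -(ed 0%N x) -e'E; split=> [->|k0]; first by rewrite linear0.
  by apply: (ses_inj sk); rewrite k0 linear0.
- exact: ed.
Qed.

(** A variant of the Gorenstein dimension in which all terms but the last are projective and the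
    last is only semi-Gorenstein projective; in this form the horseshoe lemma applies directly. *)
Fixpoint Gdim_le n M : Prop :=
  if n isn't n'.+1 then semi_Gproj M else
  exists K P (i : {linear K -> P}) (p : {linear P -> M}),
    [/\ projective P, ses i p & Gdim_le n' K].

Lemma Gdim_zero n M : zero_module M -> Gdim_le n M.
Proof.
elim: n M => [|n IH] M M0; first exact: semi_Gproj_zero.
exists M, M, idfun, \0; split; [exact: projective_zero | | exact: IH].
split=> //= x; last by exists x; rewrite (M0 x).
by split=> // _; exists x.
Qed.

(** Horseshoe lemma: [P1 * P3] covers [L], and by the nine lemma the kernel is an extension of the
    two given syzygies. *)
Lemma Gdim_ext n K L M (i : {linear K -> L}) (p : {linear L -> M}) :
  ses i p -> Gdim_le n K -> Gdim_le n M -> Gdim_le n L.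
Proof.
elim: n K L M i p => [|n IH] K L M i p sp; first exact: (semi_Gproj_ext sp).
move=> [K1 [P1 [i1 [p1 [pP1 sp1 GK1]]]]] [K3 [P3 [i3 [p3 [pP3 sp3 GK3]]]]].
have [_ _ sur] := sp.
have [u uE] := pP3 _ _ p p3 sur.
have [v vE] := linear_copair (i \o p1) u.
have sv : surjective v.
  move=> l; have [_ _ /(_ (p l))[x xE]] := sp3.
  have /(ses_exact sp)[k kE] : p (l - u x) = 0 by rewrite linearB uE xE subrr.
  have [_ _ /(_ k)[y yE]] := sp1.
  by exists (y, x); rewrite vE /= yE kE subrK.
have [K2 [k sk]] := ker_ses sv.
have [inl inlE] : exists h : {linear P1 -> (P1 * P3)%type}, forall x, h x = (x, 0).
  exact: (linear_pair idfun \0).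
have ss : ses inl (lsnd P1 P3).
  split=> [x y|[x y]|y]; first by rewrite !inlE => -[].
    by rewrite /=; split=> [->|[z]]; [exists x | rewrite inlE => -[]].
  by exists (0, y).
have [|[x y]|c1 [c2 sc]] := ses_ker ss sp sp1 sk sp3.
- by move=> x; rewrite inlE vE /= linear0 addr0.
- by rewrite vE /= (linearD p) (ses_comp0 sp) uE add0r.
exists K2, (P1 * P3)%type, k, v; split=> //; first exact: projective_prod.
exact: IH sc GK1 GK3.
Qed.

Lemma Gdim_Gproj n G : Gorenstein_projective G -> Gdim_le n G.
Proof.
elim: n G => [|n IH] G; first exact: Gproj_semi.
move=> /Gproj_syzygy[K [P [i [p [pP sp GK]]]]].
by exists K, P, i, p; split=> //; apply: IH.
Qed.

(** Cover the first Gorenstein projective term [G] by a projective [P]: the kernel of [P -> G -> M]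
    is an extension of [K] by the syzygy [G'] of [G]. *)
Lemma Gprojdim_Gdim M d : Gprojdim_le M d -> Gdim_le d M.
Proof.
move: M d; apply: Gprojdim_ind => [n G|n K G M i p sp]; first exact: Gdim_Gproj.
move=> /Gproj_syzygy[G' [P [i' [p' [pP sp' GG']]]]] GK.
have [_ _ sur] := sp; have [_ ep' sur'] := sp'.
have spp : surjective (p \o p').
  by move=> m; have [g <-] := sur m; have [x <-] := sur' g; exists x.
have [K' [k sk]] := ker_ses spp.
exists K', P, k, (p \o p'); split=> //.
have [s sE] : exists s : {linear G' -> K'}, forall x, k (s x) = i' x.
  by apply: (ses_lift sk) => x; rewrite /= (ses_comp0 sp') linear0.
have [t tE] : exists t : {linear K' -> K}, forall x, i (t x) = p' (k x).
  by apply: (ses_lift (f := p' \o k) sp) => x; apply: (ses_comp0 sk).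
have st : ses s t.
  split=> [x y exy|x|y].
  - by apply: (ses_inj sp'); rewrite -!sE exy.
  - split=> [x0|[y <-]].
      have /ep'[y yE] : p' (k x) = 0 by rewrite -tE x0 linear0.
      by exists y; apply: (ses_inj sk); rewrite sE.
    by apply: (ses_inj sp); rewrite tE sE (ses_comp0 sp') linear0.
  - have [x xE] := sur' (i y).
    have /(ses_exact sk)[z zE] : (p \o p') x = 0 by rewrite /= xE (ses_comp0 sp).
    by exists z; apply: (ses_inj sp); rewrite tE zE.
exact: Gdim_ext st (Gdim_Gproj _ GG') GK.
Qed.

Fixpoint projdim_le n L : Prop :=
  if n isn't n'.+1 then projective L else
  exists K P (i : {linear K -> P}) (p : {linear P -> L}),
    [/\ projective P, ses i p & projdim_le n' K].

(* Auslander-Buchweitz: push out [K -> P] along the hull [K -> L'] of the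
   syzygy; the resulting extension of a semi-Gorenstein projective module by
   [P] splits, hence embeds in a projective module. *)
Lemma Gdim_hull n M : Gdim_le n M ->
  exists L G (s : {linear M -> L}) (t : {linear L -> G}),
    [/\ ses s t, projdim_le n L & semi_Gproj G].
Proof.
elim: n M => [|n IH] M.
  by move=> /semi_Gproj_embed[P [G [i [p [pP sp GG]]]]]; exists P, G, i, p.
move=> [K [P [i [p [pP sp /IH[L [G [s [t [st pL GG]]]]]]]]]].
have [X [j [g [p' [q' [sj sg _ _ _]]]]]] := pushout sp st.
have [r rE] := semi_Gproj_Ext1 GG pP sg idfun.
have [P' [C [a [b [pP' sab GC]]]]] := semi_Gproj_embed GG.
have [u uE] := linear_pair r (a \o q').
have su : ses u (b \o lsnd P P').
  have [_ eb sb] := sab; have [_ eq' sq'] := sg; split=> [|[x y]|c].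
  - apply: linear_inj0 => x; rewrite uE => -[rx0 /= qx0].
    have /eq'[z zE] : q' x = 0 by apply: (ses_inj sab); rewrite qx0 linear0.
    by rewrite -zE -[z](rE z) zE rx0 linear0.
  - rewrite /= eb; split=> [[g' <-]|[z]].
      have [z zE] := sq' g'.
      exists (z + g (x - r z)); rewrite uE /= (linearD r) rE addrC subrK.
      by rewrite (linearD q') (ses_comp0 sg) addr0 zE.
    by rewrite uE => -[_ <-]; exists (q' z).
  - by have [y <-] := sb c; exists (0, y).
have [L' [w [s' [t' [sw st' _ _]]]]] := third_iso sj su.
exists L', C, s', t'; split=> //.
exists L, (P * P')%type, (u \o j), w; split=> //; exact: projective_prod.
Qed.

End GorensteinClasses.

(** * Injective modules *)

Section Baer.
Variables (A : pzRingType) (I : lmodType A).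
Hypothesis extI : forall (K : lmodType A) (i : {linear K -> A^o}), injective i ->
  forall f : {linear K -> I}, exists h : {linear A^o -> I}, forall k, h (i k) = f k.

Section Extension.
Variables (M N : lmodType A) (g : {linear M -> N}) (f : {linear M -> I}).
Hypothesis g_inj : injective g.

Let linpair (a : A) (x y : N) (u v : I) :
  a *: ((x, u) : (N * I)%type) + (y, v) = (a *: x + y, a *: u + v).
Proof. by []. Qed.

Let graph0 : set (N * I) := fun z => exists m, (g m, f m) = z.

Let partial_ext (D : set (N * I)) : Prop :=
  [/\ submodule (D : (N * I)%type -> Prop), graph0 `<=` D & forall y, D (0, y) -> y = 0].

Let partial_ext_graph0 : partial_ext graph0.
Proof.
split=> //.
  have [h hE] := linear_pair g f.
  have -> : graph0 = fun z => exists x, h x = z.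
    by apply/funext=> z; apply/propext; split=> -[m <-]; exists m; rewrite hE.
  exact: submodule_im.
by move=> y [m [gm <-]]; rewrite (_ : m = 0) ?linear0 //; apply: g_inj; rewrite gm linear0.
Qed.

(** The elements [a] with [a *: n] in the domain of [D] form a left ideal; extend the resulting map
    to all of [A] by [extI] and send [n] to its value at 1. *)
Let partial_ext_step (D : set (N * I)) (n : N) : partial_ext D ->
  exists D' : set (N * I), [/\ partial_ext D', D `<=` D' & exists y, D' (n, y)].
Proof.
move=> [[D0 Dlin] gD Dfun].
have sK : @submodule A A^o (fun a => exists y, D ((a : A) *: n, y)).
  split=> [|a x y [u Du] [v Dv]]; first by exists 0; rewrite scale0r.
  exists (a *: u + v); have := Dlin a _ _ Du Dv.
  by rewrite linpair scalerDl scalerA.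
have [K [i [ii KE]]] := submod_sub sK.
have /choice[w wE] : forall k, exists y, D ((i k : A) *: n, y).
  by move=> k; apply/KE; exists k.
have Dinj x y z : D (x, y) -> D (x, z) -> y = z.
  move=> Dy Dz; apply/subr0_eq/Dfun; have := Dlin (-1) _ _ Dz Dy.
  by rewrite linpair !scaleN1r addNr addrC.
have lw : linear w.
  move=> a x y; apply: (Dinj ((i (a *: x + y) : A) *: n)) => //.
  have -> : (i (a *: x + y) : A) *: n = a *: ((i x : A) *: n) + (i y : A) *: n.
    by rewrite linearP scalerA -scalerDl.
  by rewrite -linpair; apply: Dlin.
have [h hE] := extI ii (mkLinear lw).
have hC (a : A) : h a = a *: h 1 by rewrite -linearZ; congr (h _); exact/esym/mulr1.
pose D' : set (N * I) := fun z => exists a x y,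
  D (x, y) /\ z = (x + a *: n, y + a *: h 1).
exists D'; split; last first.
- by exists (h 1), 1, 0, 0; rewrite !add0r !scale1r.
- by move=> [x y] Dxy; exists 0, x, y; rewrite !scale0r !addr0.
have D'D z : D z -> D' z.
  by case: z => x y Dxy; exists 0, x, y; rewrite !scale0r !addr0.
split=> [|z /gD/D'D//|y [a [x [y' [Dxy []]]]]].
- split=> [|b _ _ [a [x [y [Dxy ->]]]] [a' [x' [y' [Dxy' ->]]]]]; first exact: D'D.
  exists (b * a + a'), (b *: x + x'), (b *: y + y'); split.
    by rewrite -linpair; apply: Dlin.
  rewrite linpair; congr pair.
    by rewrite scalerDr scalerDl addrACA scalerA.
  by rewrite scalerDr scalerDl addrACA scalerA.
- move=> /eqP; rewrite eq_sym addrC addr_eq0 => /eqP an ->.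
  have Da : D ((- a) *: n, y').
    by rewrite scaleNr an opprK.
  have /KE[k ik] : exists y, D ((- a) *: n, y) by exists y'.
  have := hE k; rewrite ik hC /= => Ew; have := wE k.
  rewrite ik => /Dinj/(_ Da) wy; move: Ew; rewrite wy scaleNr => <-.
  by rewrite addNr.
Qed.

Lemma baer_extension : exists h : {linear N -> I}, forall m, h (g m) = f m.
Proof.
(* Zorn's lemma on graphs. Adjoining [graph0] makes the property hold for the union of the empty
   chain as well. *)
pose P (D : set (N * I)) := partial_ext (D `|` graph0).
have [F FP totF|D [PD Dmax]] := @Zorn_bigcup _ P.
  have [[G0 Glin] _ Gfun] := partial_ext_graph0.
  have cmp x y : (\bigcup_(X in F) X `|` graph0) x ->
      (\bigcup_(X in F) X `|` graph0) y ->
      (graph0 x /\ graph0 y) \/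
      exists X, [/\ F X, (X `|` graph0) x & (X `|` graph0) y].
    case=> [[X FX Xx]|Gx] [[Y FY Yy]|Gy].
    - by right; have [XY|YX] := totF _ _ FX FY;
        [exists Y | exists X]; split=> //; left=> //; [apply: XY | apply: YX].
    - by right; exists X; split=> //; [left | right].
    - by right; exists Y; split=> //; [right | left].
    - by left.
  split=> [|z Gz|y]; last 2 [by right].
  - split=> [|a x y Ux Uy]; first by right.
    have [[Gx Gy]|[X [FX Xx Xy]]] := cmp _ _ Ux Uy; first by right; apply: Glin.
    have [[_ Xlin] _ _] := FP _ FX.
    by have [Xz|Gz] := Xlin a _ _ Xx Xy; [left; exists X | right].
  - case=> [[X FX Xy]|/Gfun//]; have [_ _ Xfun] := FP _ FX.
    by apply: Xfun; left.
have tot n : exists y, (D `|` graph0) (n, y).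
  have [D' [pD' DD' [y D'y]]] := partial_ext_step n PD.
  exists y; left; apply: contrapT => nDy.
  apply: (Dmax D'); first by split=> [z Dz|D'D]; [apply: DD'; left | apply/nDy/D'D].
  rewrite /P (_ : D' `|` graph0 = D') //; apply/setUidPl.
  by case: pD'.
have [[D0 Dlin] gD Dfun] := PD.
have Dinj x y z : (D `|` graph0) (x, y) -> (D `|` graph0) (x, z) -> y = z.
  move=> Dy Dz; apply/subr0_eq/Dfun; have := Dlin (-1) _ _ Dz Dy.
  by rewrite linpair !scaleN1r addNr addrC.
have [h hE] := choice tot.
have lh : linear h.
  move=> a x y; apply: (Dinj (a *: x + y)) => //.
  by rewrite -linpair; apply: Dlin.
exists (mkLinear lh) => m /=; apply: (Dinj (g m)) => //.
by right; exists m.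
Qed.

End Extension.

Lemma baer : injective_module I.
Proof. by move=> M N g f gi; apply: baer_extension. Qed.

End Baer.

(** * Injective abelian groups *)

Section InjectiveGroups.
Implicit Types D E : lmodType int.

Lemma scale_int D (n : int) (x : D) : n *: x = x *~ n.
Proof. by rewrite -scaler_int intz. Qed.

(** By Baer's criterion only ideals of the integers matter. A nonzero one is generated by its least
    positive element [m], and the map is extended by dividing its value there by [m]. *)
Lemma divisible_injective D :
  (forall (n : int) (y : D), n != 0 -> exists x, n *: x = y) -> injective_module D.
Proof.
move=> divD; apply: baer => K i ii f.
have [nz|/forallNP z] := pselect (exists m : nat, (0 < m)%N && `[< exists k, i k = m%:Z >]).
  case: (ex_minnP nz) => m /andP[m0 /asboolP[k0 ik0]] mmin.
  have [|x xE] := divD m%:Z (f k0); first by rewrite -lt0n.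
  have lx : linear (fun a : int^o => (a : int) *: x).
    by move=> a b c; rewrite scalerDl scalerA.
  exists (mkLinear lx) => k /=.
  pose q := (i k %/ m%:Z)%Z; pose r := (i k %% m%:Z)%Z.
  have ikE : i k = q * m%:Z + r by exact: divz_eq.
  have r0 : 0 <= r by rewrite modz_ge0 // -lt0n.
  have rm : r < m%:Z by rewrite ltz_pmod.
  have rE : r = `|r|%N%:Z by rewrite gez0_abs.
  have rz : r = 0.
    apply/eqP; rewrite rE; apply/negPn/negP => rn0.
    have : (m <= `|r|)%N.
      apply: mmin; rewrite lt0n rn0 /=; apply/asboolP; exists (k - q *: k0).
      rewrite linearB linearZ ik0 ikE -rE /=.
      by rewrite -[q *: _]/(q * m%:Z) addrAC subrr add0r.
    by rewrite leqNgt -ltz_nat -rE rm.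
  have -> : k = q *: k0.
    by apply: ii; rewrite linearZ ik0 ikE rz addr0.
  by rewrite !linearZ /= ik0 -xE scalerA.
exists \0 => k /=; rewrite (_ : k = 0) ?linear0 //; apply: ii; rewrite linear0.
apply/eqP/negPn/negP => ik0; apply: (z `|i k|%N); rewrite absz_gt0 ik0 /=.
apply/asboolP; have [ge0|lt0] := lerP 0 (i k : int).
  by exists k; rewrite gez0_abs.
by exists (- k); rewrite linearN ltz0_abs.
Qed.

Lemma prod_injective (T : Type) E : injective_module E -> injective_module (T -> E).
Proof.
move=> iE M N g f gi.
have ft t : linear (fun m => f m t) by move=> a x y; rewrite linearP.
have /choice[h hE] t := iE _ _ g (mkLinear (ft t)) gi.
have lh : linear (fun n t => h t n).
  by move=> a x y; apply/funext=> t; rewrite linearP.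
by exists (mkLinear lh) => m; apply/funext=> t /=; rewrite hE.
Qed.

(** The group is the rationals modulo the integers; the element is the class of 1/n, or of 1/2 when
    [n = 0]. *)
Lemma injective_cogenerator_int : exists D : lmodType int,
  injective_module D /\ forall n : nat, n != 1%N -> exists2 x : D, x *+ n = 0 & x != 0.
Proof.
have sZ : @submodule int (zmodule rat) (fun x => (x : rat) \is a Num.int).
  split=> [|a x y xZ yZ]; first exact: rpred0.
  by apply: rpredD => //; rewrite scalezrE rpredMz.
have [D [p [sp kp]]] := quotmod_quot sZ.
exists D; split.
  apply: divisible_injective => n y n0; have [x <-] := sp y.
  exists (p ((x : rat) / n%:~R)); rewrite -linearZ; congr (p _).
  by rewrite scalezrE -mulrzr divfK // intr_eq0.
move=> n n1; pose m := if n == 0%N then 2%N else n.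
have m1 : (1 < m)%N by rewrite {}/m; case: n n1 => [|[|n]].
have mnZ : (m%:R^-1 *+ n : rat) \is a Num.int.
  rewrite /m; have [->|n0] := eqVneq n 0%N; first by rewrite mulr0n rpred0.
  by rewrite -[_ *+ n]mulr_natr mulVf ?rpred1 // pnatr_eq0.
exists (p (m%:R^-1 : rat)); first by rewrite -linearMn; apply/kp.
apply/eqP => /kp/intrP[k kE].
have /(congr1 (fun x => x * m%:R)) := kE; rewrite mulVf ?pnatr_eq0 ?gtn_eqF // 1?ltnW//.
rewrite -[m%:R]/((m%:Z)%:~R) -intrM => /eqP; rewrite -[1]/(1%:~R) eqr_int => /eqP k1.
have : (m %| 1)%N by apply/dvdnP; exists `|k|%N; have /(congr1 absz) := k1; rewrite abszM.
by rewrite dvdn1 gtn_eqF.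
Qed.

(** Evaluation embeds [E] in the power of [D] indexed by all homomorphisms [E -> D]: for [x <> 0],
    the cyclic group on [x] has a map to [D] not killing [x], and it extends to [E]. *)
Lemma injective_embedding_int (E : lmodType int) :
  exists (I : lmodType int) (i : {linear E -> I}), injective i /\ injective_module I.
Proof.
have [D [iD sepD]] := injective_cogenerator_int.
pose ev (x : E) (f : {linear E -> D}) := f x.
have lev : linear ev by move=> a x y; apply/funext=> f; rewrite /ev linearP.
exists ({linear E -> D} -> D), (mkLinear lev); split; last exact: prod_injective.
apply: linear_inj0 => x evx; apply: contrapT => x0.
have lm : linear (fun n : int^o => (n : int) *: x).
  by move=> a n m; rewrite scalerDl scalerA.
pose m := mkLinear lm.
have [M [p [sp kp]]] := quotmod_quot (submodule_ker m).
have [j jE] : exists j : {linear M -> E}, forall n, j (p n) = m n.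
  by apply: surj_factor => // n /kp.
have ij : injective j.
  by apply: linear_inj0 => y; have [n <-] := sp y; rewrite jE => /kp.
pose ann (n : nat) := (n != 0%N) && `[< x *+ n = 0 >].
(* [n] is the order of [x], with 0 standing for infinite order: divisibility by 0 then says that [k]
   is 0. *)
have [n [n1 nP]] : exists n : nat, n != 1%N /\ forall k : int, k *: x = 0 -> (n %| `|k|)%N.
  have [ex|nex] := pselect (exists n, ann n).
    case: (ex_minnP ex) => n /andP[n0 /asboolP nx] nmin; exists n; split.
      by apply/eqP=> n1; apply: x0; rewrite -nx n1.
    move=> k kx; have kx' : x *+ `|k| = 0.
      have [k0|k0] := lerP 0 k.
        by rewrite pmulrn gez0_abs // -scale_int.
      by rewrite pmulrn ltz0_abs // mulrNz -scale_int kx oppr0.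
    apply/negPn/negP => r0.
    have : (n <= `|k| %% n)%N.
      apply: nmin; rewrite /ann r0; apply/asboolP.
      by move: kx'; rewrite {1}(divn_eq `|k| n) mulrnDr mulnC mulrnA nx mul0rn add0r.
    by rewrite leqNgt ltn_mod lt0n n0.
  exists 0%N; split=> // k kx; rewrite dvd0n; apply/negPn/negP => k0.
  apply: nex; exists `|k|%N; rewrite /ann k0; apply/asboolP.
  have [k1|k1] := lerP 0 k.
    by rewrite pmulrn gez0_abs // -scale_int.
  by rewrite pmulrn ltz0_abs // mulrNz -scale_int kx oppr0.
have [d dn d0] := sepD n n1.
have ld : linear (fun k : int^o => (k : int) *: d).
  by move=> a k l; rewrite scalerDl scalerA.
have [|f fE] := @surj_factor _ _ _ _ p (mkLinear ld) sp.
  move=> k /kp /nP/dvdnP[q kq] /=.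
  have nd : (n%:Z : int) *: d = 0 by rewrite scale_int -pmulrn.
  have -> : (k : int) = (-1) ^+ (k < 0)%R * q%:Z * n%:Z.
    by rewrite -mulrA -PoszM -kq -intEsign.
  by rewrite -scalerA nd scaler0.
have [h hE] := iD _ _ j f ij.
have := congr1 (fun g => g h) evx; rewrite /= /ev.
have -> : x = j (p 1) by rewrite jE /= scale1r.
by rewrite hE fE /= scale1r => /eqP; rewrite (negPf d0).
Qed.

End InjectiveGroups.

(* [Hom_Z(A, E)], with [A] acting through right multiplication on the source *)
Section Coinduction.
Variables (A : pzRingType) (E : lmodType int).

Definition additive_fun (f : A -> E) : Prop := forall x y, f (x + y) = f x + f y.

Fact additive_fun_submodule : submodule additive_fun.
Proof.
split=> [x y|a f g fD gD x y]; first by rewrite addr0.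
by rewrite /GRing.add /= /GRing.scale /= fD gD scalerDr addrACA.
Qed.

Definition coind : Type := submod additive_fun_submodule.
HB.instance Definition _ := GRing.Zmodule.on coind.

Lemma coind_additive (f : coind) : additive_fun (val f).
Proof. by case: f => f /= /submod_pdP. Qed.

Definition coind_mk (f : A -> E) (fD : additive_fun f) : coind :=
  Submod additive_fun_submodule ((submod_pdP additive_fun f).2 fD).

Fact coind_scale_subproof (a : A) (f : coind) :
  additive_fun (fun x => val f (x * a)).
Proof. by move=> x y; rewrite mulrDl coind_additive. Qed.

Definition coind_scale a f := coind_mk (coind_scale_subproof a f).

Fact coind_scaleA a b f : coind_scale a (coind_scale b f) = coind_scale (a * b) f.
Proof. by apply/val_inj/funext=> x /=; rewrite mulrA. Qed.
Fact coind_scale1 : left_id 1 coind_scale.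
Proof. by move=> f; apply/val_inj/funext=> x /=; rewrite mulr1. Qed.
Fact coind_scaleDr : right_distributive coind_scale +%R.
Proof. by move=> a f g; apply/val_inj/funext=> x. Qed.
Fact coind_scaleDl f : {morph coind_scale^~ f : a b / a + b}.
Proof. by move=> a b; apply/val_inj/funext=> x /=; rewrite mulrDr coind_additive. Qed.

HB.instance Definition _ := GRing.Zmodule_isLmodule.Build A coind
  coind_scaleA coind_scale1 coind_scaleDr coind_scaleDl.

Lemma linear_int (M N : lmodType int) (f : M -> N) :
  (forall x y, f (x + y) = f x + f y) -> linear f.
Proof.
move=> fD; have f0 : f 0 = 0.
  by apply: (addrI (f 0)); rewrite -fD !addr0.
have fN x : f (- x) = - f x by apply: (addrI (f x)); rewrite -fD !subrr.
have fn x (n : nat) : f (x *+ n) = f x *+ n.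
  by elim: n => [|n IH]; rewrite ?mulr0n // !mulrS fD IH.
move=> a x y; rewrite fD; congr (_ + _).
by rewrite !scale_int; case: a => n; rewrite ?NegzE ?mulrNz -!pmulrn ?fN fn.
Qed.

(** By adjunction, an [A]-linear map to [coind] amounts to the additive map to [E] obtained by
    evaluating at 1, and that one extends. *)
Lemma coind_injective : injective_module E -> injective_module (coind : lmodType A).
Proof.
move=> iE M N g f gi.
have lg : linear (g : zmodule M -> zmodule N).
  by apply: linear_int => x y; rewrite linearD.
have lf : linear (fun m : zmodule M => val (f m) 1 : E).
  by apply: linear_int => x y; rewrite linearD.
have [h hE] := iE _ _ (mkLinear lg) (mkLinear lf) gi.
have hD n : additive_fun (fun x : A => h (x *: n)).
  by move=> x y; rewrite scalerDl linearD.
have lH : linear (fun n => coind_mk (hD n)).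
  move=> a x y; apply/val_inj/funext=> b /=.
  by rewrite scalerDr scalerA [h _](linearD h).
exists (mkLinear lH) => m; apply/val_inj/funext=> x /=.
rewrite -linearZ [LHS](hE (x *: m)) /= linearZ /=.
by rewrite mul1r.
Qed.

End Coinduction.

(** Embed the underlying group of [M] in an injective group [E] and send [m] to the function
    [x |-> e (x *: m)]. *)
Lemma enough_injectives (A : pzRingType) (M : lmodType A) :
  exists (I : lmodType A) (i : {linear M -> I}), injective i /\ injective_module I.
Proof.
have [E [e [ie iE]]] := injective_embedding_int (zmodule M).
have eD m : additive_fun (fun x : A => e (x *: m)).
  by move=> x y; rewrite scalerDl [LHS](linearD e).
have li : linear (fun m => coind_mk (eD m) : coind A E).
  move=> a x y; apply/val_inj/funext=> b /=.
  by rewrite scalerDr scalerA [LHS](linearD e).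
exists (coind A E), (mkLinear li); split; last exact: coind_injective.
move=> x y /(congr1 (fun f => val f 1)) /=.
by rewrite !scale1r => /ie.
Qed.

(** * Vanishing of Ext *)

Section Coresolutions.
Variable A : pzRingType.
Implicit Types C I K L M N P : lmodType A.

Lemma ses_extend K L M I (i : {linear K -> L}) (p : {linear L -> M}) :
  injective_module I -> ses i p ->
  forall u : {linear K -> I}, exists v : {linear L -> I}, forall k, v (i k) = u k.
Proof. by move=> iI [ii _ _] u; apply: iI. Qed.

Definition cosyzygy N (C : nat -> lmodType A) k := if k is k'.+1 then C k' else N.

(* short exact sequences [0 -> C_k -> J_k -> C_(k+1) -> 0] with [C_0 = N] and
   [J_k] injective, where [C_(k+1)] is [cores_coker k] *)
Record coresolution N := Coresolution {
  cores_inj : nat -> lmodType A;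
  cores_coker : nat -> lmodType A;
  cores_i : forall k, {linear cosyzygy N cores_coker k -> cores_inj k};
  cores_p : forall k, {linear cores_inj k -> cores_coker k};
  cores_injective : forall k, injective_module (cores_inj k);
  cores_ses : forall k, ses (cores_i k) (cores_p k)
}.

Lemma coresolution_exists N : inhabited (coresolution N).
Proof.
have step M : {I : lmodType A & {C : lmodType A & {i : {linear M -> I} &
    {p : {linear I -> C} | injective_module I /\ ses i p}}}}.
  have [I /cid[i [ii iI]]] := cid (enough_injectives M).
  have [C /cid[p sp]] := cid (coker_ses ii).
  by exists I, C, i, p.
pose st := fix st k := if k is k'.+1 then projT1 (projT2 (step (st k'))) else N.
have E k : st k = cosyzygy N (fun k => st k.+1) k by case: k.
(* [st k] and [cosyzygy] agree only after a case analysis on [k], hence the transport along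
   [E k]. *)
pose ik k : {linear cosyzygy N (fun k => st k.+1) k -> projT1 (step (st k))} :=
  ecast X {linear X -> projT1 (step (st k))} (E k)
    (projT1 (projT2 (projT2 (step (st k))))).
constructor.
apply: (@Coresolution N (fun k => projT1 (step (st k))) (fun k => st k.+1) ik
  (fun k => sval (projT2 (projT2 (projT2 (step (st k))))))) => k.
  by case: (svalP (projT2 (projT2 (projT2 (step (st k)))))).
have [_] := svalP (projT2 (projT2 (projT2 (step (st k))))).
by rewrite /ik; case: _ / (E k).
Qed.

Section Ext.
Variables (N : lmodType A) (R : coresolution N).
Local Notation C := (cosyzygy N (cores_coker R)).

(* [Ext^(k+1)(M, N) = 0] *)
Definition Ext_zero k M : Prop :=
  forall f : {linear M -> cores_coker R k},
  exists g : {linear M -> cores_inj R k}, forall x, cores_p R k (g x) = f x.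

Lemma Ext_zero_projective k P : projective P -> Ext_zero k P.
Proof. by move=> pP f; apply: pP; apply: ses_surj (cores_ses R k). Qed.

Lemma Ext_zero_ext k K L M (i : {linear K -> L}) (p : {linear L -> M}) :
  ses i p -> Ext_zero k K -> Ext_zero k M -> Ext_zero k L.
Proof.
move=> sp eK eM f; have [g gE] := eK (f \o i).
have [h hE] := ses_extend (@cores_injective _ R k) sp g.
have [u uE] : exists u : {linear M -> cores_coker R k},
    forall l, u (p l) = f l - cores_p R k (h l).
  apply: (ses_factor (f := f \- (cores_p R k \o h)) sp) => x.
  by rewrite /= hE gE subrr.
have [v vE] := eM u.
exists ((v \o p) \+ h) => x /=.
by rewrite linearD vE uE subrK.
Qed.

(* [Ext^k(L) -> Ext^k(K) -> Ext^(k+1)(M)] *)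
Lemma Ext_zero_extend k K L M (i : {linear K -> L}) (p : {linear L -> M}) :
  ses i p -> Ext_zero k M ->
  forall f : {linear K -> C k}, exists h : {linear L -> C k}, forall x, h (i x) = f x.
Proof.
move=> sp eM f; have sk := cores_ses R k.
have [g gE] := ses_extend (@cores_injective _ R k) sp (cores_i R k \o f).
have [u uE] : exists u : {linear M -> cores_coker R k},
    forall l, u (p l) = cores_p R k (g l).
  apply: (ses_factor (f := cores_p R k \o g) sp) => x.
  by rewrite /= gE /= (ses_comp0 sk).
have [v vE] := eM u.
have [h hE] : exists h : {linear L -> C k}, forall l, cores_i R k (h l) = g l - v (p l).
  apply: (ses_lift (f := g \- (v \o p)) sk) => l.
  by rewrite /= linearB vE uE subrr.
exists h => x; apply: (ses_inj sk).
by rewrite hE (ses_comp0 sp) linear0 subr0 gE.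
Qed.

(** The stretch Ext^k(L) -> Ext^k(K) -> Ext^(k+1)(M) -> Ext^(k+1)(L) of the long exact sequence,
    stated on representatives. *)
Lemma Ext_zero_coker k K L M (i : {linear K -> L}) (p : {linear L -> M}) :
  ses i p -> Ext_zero k L ->
  (forall f : {linear K -> C k}, exists h : {linear L -> C k}, forall x, h (i x) = f x) ->
  Ext_zero k M.
Proof.
move=> sp eL ext f; have sk := cores_ses R k.
have [g gE] := eL (f \o p).
have [u uE] : exists u : {linear K -> C k}, forall x, cores_i R k (u x) = g (i x).
  apply: (ses_lift (f := g \o i) sk) => x.
  by rewrite /= gE /= (ses_comp0 sp) linear0.
have [h hE] := ext u.
have [v vE] : exists v : {linear M -> cores_inj R k},
    forall l, v (p l) = g l - cores_i R k (h l).
  apply: (ses_factor (f := g \- (cores_i R k \o h)) sp) => x.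
  by rewrite /= hE uE subrr.
exists v => m; have [l <-] := ses_surj sp m.
by rewrite vE linearB (ses_comp0 sk) subr0 gE.
Qed.

Lemma Ext_zero_shift k K L M (i : {linear K -> L}) (p : {linear L -> M}) :
  ses i p -> Ext_zero k.+1 L -> Ext_zero k K -> Ext_zero k.+1 M.
Proof.
move=> sp eL eK; apply: (Ext_zero_coker sp eL) => f.
have [g gE] := eK f; have [h hE] := ses_extend (@cores_injective _ R k) sp g.
by exists (cores_p R k \o h) => x /=; rewrite hE gE.
Qed.

Lemma Ext_zero_syzygy k K P M (i : {linear K -> P}) (p : {linear P -> M}) :
  projective P -> ses i p -> Ext_zero k.+1 M -> Ext_zero k K.
Proof.
move=> pP sp eM f; have [h hE] := Ext_zero_extend sp eM f.
have [g gE] := Ext_zero_projective pP h.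
by exists (g \o i) => x /=; rewrite gE hE.
Qed.

Lemma Ext_zero_retract k M L (s : {linear M -> L}) (r : {linear L -> M}) :
  (forall x, r (s x) = x) -> Ext_zero k L -> Ext_zero k M.
Proof.
move=> sK eL f; have [g gE] := eL (f \o r).
by exists (g \o s) => x /=; rewrite gE /= sK.
Qed.

(** Syzygies of [G] are again Gorenstein projective, so dimension shifting reduces the claim to
    Ext^1. *)
Lemma Ext_zero_Gproj k G : projective N -> Gorenstein_projective G -> Ext_zero k G.
Proof.
move=> pN; elim: k G => [|k IH] G GG; have [K [P [i [p [pP sp GK]]]]] := Gproj_syzygy GG.
  apply: (Ext_zero_coker sp (Ext_zero_projective pP)) => f.
  exact: (Gproj_Ext1 GG pN sp).
by apply: (Ext_zero_shift sp); [apply: Ext_zero_projective | apply: IH].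
Qed.

Lemma Ext_zero_Gprojdim M d k : projective N -> Gprojdim_le M d -> (d <= k)%N ->
  Ext_zero k M.
Proof.
move=> pN /(Gprojdim_ind (S := fun d M => forall k, (d <= k)%N -> Ext_zero k M)).
apply=> {M d k} [n G GG k _|n K G M i p sp GG eK [//|k] nk].
  exact: Ext_zero_Gproj.
by apply: (Ext_zero_shift sp); [apply: Ext_zero_Gproj | apply: eK].
Qed.

End Ext.

Definition trivmod : lmodType A := 'rV[A]_0.

Lemma trivmod_zero : zero_module trivmod.
Proof. by move=> x; apply/rowP=> -[]. Qed.

Lemma injective_zero I : zero_module I -> injective_module I.
Proof. by move=> I0 M N g f _; exists \0 => x; rewrite [RHS]I0. Qed.

Lemma inj_resolution0 N : injective_module N -> inj_resolution N 0.
Proof.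
move=> iN; exists (fun k => if k is 0%N then N else trivmod), (fun=> \0), idfun.
split=> //.
- by case=> [_|//]; exact: iN.
- by case=> // k _; exact: trivmod_zero.
- by move=> x; split=> // _; exists x.
- move=> k x; split=> [_|_]; last exact: trivmod_zero.
  by exists 0; rewrite [x]trivmod_zero.
Qed.

Lemma inj_resolutionS N I C (i : {linear N -> I}) (p : {linear I -> C}) n :
  injective_module I -> ses i p -> inj_resolution C n -> inj_resolution N n.+1.
Proof.
move=> iI sp [J [d [e [iJ J0 ie ee ed]]]].
pose IJ k := if k is k'.+1 then J k' else I.
pose dIJ k : {linear IJ k -> IJ k.+1} :=
  match k with 0%N => e \o p | k'.+1 => d k' end.
exists IJ, dIJ, i; split.
- by case.
- by case.
- exact: ses_inj sp.
- move=> x; rewrite -(ses_exact sp x); split=> [/= ex|/= ->]; last exact: linear0.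
  by apply: ie; rewrite linear0.
- case=> [|k] x; last exact: ed.
  rewrite (ee x); split=> [[c <-]|[y <-]]; last by exists (p y).
  by have [y <-] := ses_surj sp c; exists y.
Qed.

(** Truncate the coresolution at its [d]-th cosyzygy and splice the short exact sequences back, from
    index [d] down to 0. *)
Lemma cores_inj_resolution N (R : coresolution N) d :
  injective_module (cosyzygy N (cores_coker R) d) -> injdim_le N d.
Proof.
move=> iC; exists d => //; have: inj_resolution (cosyzygy N (cores_coker R) d) 0.
  exact: inj_resolution0.
rewrite -{2}[d]addn0; elim: d {iC} 0%N => [//|d IH] n rC.
rewrite addSnnS; apply: IH.
exact: inj_resolutionS (@cores_injective _ R d) (cores_ses R d) rC.
Qed.

(** The given resolution is cut into short exact sequences. Its cokernel of index [k] lies in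
    [I k.+1], which is zero for [d <= k], so there is nothing to lift. *)
Lemma injdim_Ext_zero N d : injdim_le N d ->
  exists R : coresolution N, forall k M, (d <= k)%N -> Ext_zero R k M.
Proof.
move=> [n nd [I [dI [e [iI I0 ie ee ed]]]]].
have injI k : injective_module (I k).
  have [/iI//|/I0] := leqP k n; exact: injective_zero.
pose C k : lmodType A := submod (submodule_ker (dI k.+1)).
have CP k (x : I k) : dI k x \in submod_pd (fun x => dI k.+1 x = 0).
  by apply/submod_pdP/ed; exists x.
have lp k : linear (fun x => Submod (submodule_ker (dI k.+1)) (CP k x) : C k).
  by move=> a x y; apply: val_inj; rewrite /= linearP.
pose p k : {linear I k -> C k} := mkLinear (lp k).
pose i k : {linear cosyzygy N C k -> I k} :=
  match k with 0%N => e | k'.+1 => (val : C k' -> I k'.+1) end.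
have ss k : ses (i k) (p k).
  have pE (x : I k) : p k x = 0 <-> dI k x = 0.
    by split=> [/(congr1 val)|dx]; last exact: val_inj.
  split=> [|x|[x /= xP]].
  - by case: k {pE} => [|k]; [exact: ie | exact: val_inj].
  - rewrite pE; case: k x {pE} => [|k] x; first exact: ee.
    split=> [dx|[[y yP] <-]]; last by have /submod_pdP := yP.
    by exists (Submod (submodule_ker (dI k.+1)) ((submod_pdP _ _).2 dx)).
  - have /submod_pdP/ed[y yE] := xP.
    by exists y; apply: val_inj.
exists (Coresolution injI ss) => k M dk f; exists \0 => x; apply: val_inj => /=.
by rewrite [RHS]I0 ?[LHS]I0 // ltnS (leq_trans nd).
Qed.

End Coresolutions.

(** * Chain conditions *)

Section ChainConditions.
Variable A : pzRingType.
Implicit Types K L M V : lmodType A.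

Definition sub_dir (b : bool) V (U U' : V -> Prop) : Prop :=
  if b then forall x, U x -> U' x else forall x, U' x -> U x.

(* the maximum principle for submodules if [b], the minimum principle if not *)
Definition chain_cond (b : bool) V : Prop :=
  forall S : (V -> Prop) -> Prop, (exists2 U, submodule U & S U) ->
  exists U, [/\ submodule U, S U &
    forall U', submodule U' -> S U' -> sub_dir b U U' -> sub_dir b U' U].

Lemma submoduleD V (U : V -> Prop) x y : submodule U -> U x -> U y -> U (x + y).
Proof. by case=> _ lin Ux Uy; rewrite -[x]scale1r; apply: lin. Qed.

Lemma submoduleZ V (U : V -> Prop) a x : submodule U -> U x -> U (a *: x).
Proof. by case=> U0 lin Ux; rewrite -[_ *: _]addr0; apply: lin. Qed.

Lemma submoduleN V (U : V -> Prop) x : submodule U -> U x -> U (- x).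
Proof. by rewrite -scaleN1r; apply: submoduleZ. Qed.

Lemma submoduleB V (U : V -> Prop) x y : submodule U -> U x -> U y -> U (x - y).
Proof. by move=> sU Ux Uy; apply: submoduleD => //; apply: submoduleN. Qed.

Lemma submodule_image V M (f : {linear V -> M}) (U : V -> Prop) :
  submodule U -> submodule (fun y => exists2 x, U x & f x = y).
Proof.
case=> U0 lin; split=> [|a _ _ [x Ux <-] [y Uy <-]]; first by exists 0; rewrite ?linear0.
by exists (a *: x + y); rewrite ?linearP //; apply: lin.
Qed.

Lemma submodule_preimage V M (f : {linear V -> M}) (U : M -> Prop) :
  submodule U -> submodule (fun x => U (f x)).
Proof.
by case=> U0 lin; split=> [|a x y Ux Uy]; rewrite ?linear0 // linearP; apply: lin.
Qed.

(** Optimize first the image in [M], then the preimage in [K] among submodules with that image. By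
    [key], nested submodules with equal images and equal preimages coincide. Exactness in the middle
    alone makes this cover submodules and quotients too. *)
Lemma chain_cond_ext b K L M (i : {linear K -> L}) (p : {linear L -> M}) :
  exact_at i p -> chain_cond b K -> chain_cond b M -> chain_cond b L.
Proof.
move=> ex cK cM S [U0 sU0 SU0].
have key (V1 V2 : L -> Prop) : submodule V1 -> submodule V2 ->
    (forall x, V1 x -> V2 x) ->
    (forall x, V2 x -> exists2 y, V1 y & p y = p x) ->
    (forall k, V2 (i k) -> V1 (i k)) -> forall x, V2 x -> V1 x.
  move=> s1 s2 V12 im pre x V2x; have [y V1y pE] := im _ V2x.
  have /ex[k kE] : p (x - y) = 0 by rewrite linearB pE subrr.
  rewrite -(subrK y x); apply: submoduleD => //; rewrite -kE; apply: pre.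
  by rewrite kE; apply: submoduleB => //; apply: V12.
pose im (U : L -> Prop) y := exists2 x, U x & p x = y.
have [|W [sW [U1 sU1 [SU1 WE1]] Wmax]] :=
  cM (fun W => exists2 U, submodule U & S U /\ forall y, W y <-> im U y).
  by exists (im U0); [exact: submodule_image | exists U0].
have [|T [sT [U [sU SU WE TE]] Tmax]] := cK (fun T => exists U, [/\ submodule U, S U,
    forall y, W y <-> im U y & forall k, T k <-> U (i k)]).
  by exists (fun k => U1 (i k)); [exact: submodule_preimage | exists U1].
exists U; split=> // U' sU' SU' UU'.
have WU' : sub_dir b W (im U').
  by case: b {cK cM Wmax Tmax} UU' => /= UU' y; rewrite ?WE => -[x Ux <-];
    exists x => //; apply: UU'.
have {}Wmax := Wmax (im U') (submodule_image _ sU').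
have {Wmax} U'W : sub_dir b (im U') W by apply: Wmax => //; exists U'.
have WE' y : W y <-> im U' y.
  by case: b {cK cM Tmax UU'} WU' U'W => /= WU' U'W; split; auto.
have {}Tmax := Tmax (fun k => U' (i k)) (submodule_preimage _ sU').
have {Tmax} U'T : sub_dir b (fun k => U' (i k)) T.
  apply: Tmax; first by exists U'.
  by case: b {cK cM WU' U'W} UU' => /= UU' k; rewrite ?TE; apply: UU'.
case: b {cK cM WU' U'W} UU' U'T => /= UU' U'T.
  apply: key => // [x U'x|k /U'T/TE//]; apply/WE/WE'.
  by exists x.
by apply: key => // [x Ux|k /TE/U'T//]; apply/WE'/WE; exists x.
Qed.

Lemma chain_cond_simple b V :
  (forall U : V -> Prop, submodule U -> (forall x, U x -> x = 0) \/ (forall x, U x)) ->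
  chain_cond b V.
Proof.
move=> simp S [U0 sU0 SU0].
pose top (U : V -> Prop) := if b then forall x, U x else forall x, U x -> x = 0.
have [[U [sU SU tU]]|nU] := pselect (exists U, [/\ submodule U, S U & top U]).
  exists U; split=> // U' sU' _ _; case: b @top tU => //= tU x /tU->.
  by case: sU'.
exists U0; split=> // U' sU' SU' _.
have ntop U : submodule U -> S U -> ~ top U by move=> ? ? ?; apply: nU; exists U.
have := ntop _ sU' SU'; have := ntop _ sU0 SU0; rewrite /top.
case: b {top nU ntop} => /= n1 n2 x.
  by have [/(_ x)h|//] := simp _ sU' => /h->; case: sU0.
by have [h|h] := simp _ sU' => //; move=> _; apply: h.
Qed.

Lemma chain_cond_zero b V : zero_module V -> chain_cond b V.
Proof. by move=> V0; apply: chain_cond_simple => U _; left=> x _. Qed.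

Lemma chain_cond_sub b K L (i : {linear K -> L}) :
  injective i -> chain_cond b L -> chain_cond b K.
Proof.
move=> ii cL; apply: (chain_cond_ext (i := \0 : {linear trivmod A -> K}) (p := i)) => //.
  move=> y; split=> [y0|[x <-]]; last by rewrite linear0.
  by exists 0; apply: ii; rewrite y0 /= linear0.
exact/chain_cond_zero/trivmod_zero.
Qed.

Lemma chain_cond_quot b L M (p : {linear L -> M}) :
  surjective p -> chain_cond b L -> chain_cond b M.
Proof.
move=> sp cL; apply: (chain_cond_ext (i := p) (p := \0 : {linear M -> trivmod A})) => //.
exact/chain_cond_zero/trivmod_zero.
Qed.

Lemma noetherian_acc V : noetherian V -> chain_cond true V.
Proof.
move=> nV S [U0 sU0 SU0]; apply: contrapT => nmax.
pose T := {U : V -> Prop | submodule U /\ S U}.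
have /choice[next nextP] (U : T) : exists U' : T,
    (forall x, sval U x -> sval U' x) /\ ~ (forall x, sval U' x -> sval U x).
  case: U => U [sU SU]; apply: contrapT => nU; apply: nmax; exists U; split=> //.
  move=> U' sU' SU' UU' /=; apply: contrapT => nU'; apply: nU.
  by exists (exist _ U' (conj sU' SU')).
pose I k := iter k next (exist _ U0 (conj sU0 SU0)).
have [k|k x|N NI] := nV (fun k => submod_pd (sval (I k))).
- by apply: submod_pd_closed; case: (svalP (I k)).
- by move=> /submod_pdP/(nextP (I k)).1 Ux; apply/submod_pdP.
have [_ []] := nextP (I N).
by move=> x /submod_pdP; rewrite (NI N.+1 (leqnSn N)) => /submod_pdP.
Qed.

Lemma acc_noetherian V : chain_cond true V -> noetherian V.
Proof.
move=> cV I sI incI.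
have [|U [sU [N UE] Umax]] := cV (fun U => exists N, forall x, U x <-> x \in I N).
  by exists (fun x => x \in I 0%N); [exact: submodule_pred | exists 0%N].
have inc k l x : (k <= l)%N -> x \in I k -> x \in I l.
  by move=> /subnK <-; elim: (l - k)%N => // n IH /IH/incI.
exists N => k Nk x; apply/idP/idP => [xk|]; last exact: inc.
apply/UE; apply: (Umax (fun x => x \in I k)) xk; first exact: submodule_pred.
  by exists k.
by move=> y /UE; apply: inc.
Qed.

Definition fgen V : Prop :=
  exists n (s : 'I_n -> V), forall x, exists c : 'I_n -> A, x = \sum_i c i *: s i.

(** A maximal finitely generated submodule is everything: adjoining a further [x] cannot enlarge
    it. *)
Lemma acc_fgen V : chain_cond true V -> fgen V.
Proof.
move=> cV; pose span n (s : 'I_n -> V) x := exists c : 'I_n -> A, x = \sum_i c i *: s i.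
have sspan n s : submodule (@span n s).
  split=> [|a _ _ [c ->] [c' ->]].
    by exists (fun=> 0); rewrite big1 // => i _; rewrite scale0r.
  exists (fun i => a * c i + c' i); rewrite scaler_sumr -big_split.
  by apply: eq_bigr => i _; rewrite scalerDl scalerA.
have [|U [_ [n [s UE]] Umax]] :=
  cV (fun U => exists n (s : 'I_n -> V), forall x, U x <-> span n s x).
  by exists (span 0%N (fun=> 0)); [exact: sspan | exists 0%N, (fun=> 0)].
exists n, s => x; apply/UE.
pose s' (j : 'I_n.+1) := if unlift ord0 j is Some i then s i else x.
have s'E c : \sum_j c j *: s' j = c ord0 *: x + \sum_i c (lift ord0 i) *: s i.
  rewrite big_ord_recl /s' unlift_none; congr (_ + _).
  by apply: eq_bigr => i _; rewrite liftK.
apply: (Umax (span _ s')).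
- exact: sspan.
- by exists n.+1, s'.
- move=> y /UE[c ->]; exists (fun j => if unlift ord0 j is Some i then c i else 0).
  rewrite s'E unlift_none scale0r add0r.
  by apply: eq_bigr => i _; rewrite liftK.
- exists (fun j => (j == ord0)%:R); rewrite s'E eqxx scale1r big1 ?addr0 // => i _.
  by rewrite scale0r.
Qed.

Lemma fgen_quot L M (p : {linear L -> M}) : surjective p -> fgen L -> fgen M.
Proof.
move=> sp [n [s gen]]; exists n, (p \o s) => y; have [x <-] := sp y.
have [c ->] := gen x; exists c; rewrite linear_sum.
by apply: eq_bigr => i _; rewrite linearZ.
Qed.

(** Induction on the number of generators, splitting off the cyclic submodule on the first. The set
    [I] keeps the induction among modules annihilated by given scalars. *)
Lemma fgen_ind (I : A -> Prop) (S : lmodType A -> Prop) :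
  (forall K L M (i : {linear K -> L}) (p : {linear L -> M}),
    ses i p -> S K -> S M -> S L) ->
  (forall K (x : K), (forall a, I a -> forall y : K, a *: y = 0) ->
    (forall y, exists a, y = a *: x) -> S K) ->
  forall V, (forall a, I a -> forall y : V, a *: y = 0) -> fgen V -> S V.
Proof.
move=> Sext Scyc V IV [n [s gen]]; elim: n V IV s gen => [|n IH] V IV s gen.
  by apply: (Scyc V 0) => // y; have [c ->] := gen y; exists 0; rewrite big_ord0 scaler0.
have sU : submodule (fun x => exists a, x = a *: s ord0).
  split=> [|a _ _ [b ->] [c ->]]; first by exists 0; rewrite scale0r.
  by exists (a * b + c); rewrite scalerDl scalerA.
have [K [i [ii KE]]] := submod_sub sU; have [M [p sp]] := coker_ses ii.
have /KE[x xE] : exists a, s ord0 = a *: s ord0 by exists 1; rewrite scale1r.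
apply: (Sext _ _ _ _ _ sp).
  apply: (Scyc _ x) => [a Ia y|y]; first by apply: ii; rewrite linearZ_LR IV // linear0.
  have /KE[a aE] : exists k, i k = i y by exists y.
  by exists a; apply: ii; rewrite aE linearZ xE.
apply: (IH _ _ (fun j => p (s (lift ord0 j)))) => [a Ia y|y].
  by have [z <-] := ses_surj sp y; rewrite -linearZ_LR IV ?linear0.
have [z <-] := ses_surj sp y; have [c ->] := gen z; exists (fun j => c (lift ord0 j)).
rewrite big_ord_recl linearD linearZ /= -xE (ses_comp0 sp) scaler0 add0r linear_sum.
by apply: eq_bigr => j _; rewrite linearZ.
Qed.

Lemma cyclic_quot V (x : V) : (forall y, exists a, y = a *: x) ->
  exists p : {linear A^o -> V}, surjective p /\ forall a : A, p a = a *: x.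
Proof.
move=> cyc; have lp : linear (fun a : A^o => (a : A) *: x).
  by move=> a b c; rewrite scalerDl scalerA.
by exists (mkLinear lp); split=> // y; have [a ->] := cyc y; exists a.
Qed.

End ChainConditions.

(** * Noether algebras *)

(** Maximality among the submodules avoiding [z] is plain maximality when [z] generates the module
    modulo [W]. *)
Lemma maximal_submodE (A : pzRingType) (V : lmodType A) (W : V -> Prop) (z : V) :
  submodule W -> ~ W z ->
  (forall U, submodule U -> ~ U z -> (forall x, W x -> U x) -> forall x, U x -> W x) ->
  (forall U, submodule U -> U z -> (forall x, W x -> U x) -> forall x, U x) ->
  maximal_submod (submod_pd W).
Proof.
move=> sW nWz Wmax topz; split; first exact: submod_pd_closed.
  by exists z; apply/negP=> /submod_pdP.
move=> n cn Wn; have sn := submodule_pred cn.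
have Wn' x : W x -> x \in n by move=> Wx; apply/Wn/submod_pdP.
have [nz|nz] := pselect (z \in n); [right | left] => x.
  by rewrite inE; apply: (topz (fun x => x \in n)).
by apply/idP/idP => [nx|]; [apply/submod_pdP/(Wmax (fun x => x \in n)) | exact: Wn].
Qed.

(** Otherwise the left ideal generated by [1 - x] lies in a maximal one; that one contains [x],
    hence 1. *)
Lemma jacobson_linv (A : pzRingType) (x : A) : chain_cond true A^o ->
  x \in @jacobson A -> exists u, u * (1 - x) = 1.
Proof.
move=> cA Jx; apply: contrapT => nu.
pose S (U : A^o -> Prop) := U (1 - x) /\ ~ U 1.
have [|W [sW [W1x nW1] Wmax]] := cA S.
  exists (fun y : A^o => exists a : A, y = a * (1 - x)).
    split=> [|a _ _ [b ->] [c ->]]; first by exists 0; rewrite mul0r.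
    by exists (a * b + c); rewrite mulrDl -mulrA.
  split=> [|[u uE]]; first by exists 1; rewrite mul1r.
  by apply: nu; exists u.
have mW : maximal_submod (submod_pd W).
  apply: (maximal_submodE sW nW1) => [U sU nU1 WU|U sU U1 WU y].
    by apply: Wmax => //; split=> //; apply: WU.
  by have := submoduleZ y sU U1; rewrite [_ *: _]mulr1.
have /jacobsonP/(_ _ mW)/submod_pdP Wx := Jx.
by apply: nW1; have := submoduleD sW W1x Wx; rewrite subrK.
Qed.

(** Restriction of scalars. [f] occurs in the type so that the [R]-action can be inferred from
    it. *)
Definition restr (R A : pzRingType) (f : {rmorphism R -> A}) (V : lmodType A) : Type := V.

Section Restriction.
Variables (R : comPzRingType) (A : pzRingType) (f : {rmorphism R -> A}).

Section Lmodule.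
Variable V : lmodType A.
HB.instance Definition _ := GRing.Zmodule.on (restr f V).
Definition restr_scale (r : R) (v : restr f V) : restr f V := f r *: (v : V).
Fact restr_scaleA a b v : restr_scale a (restr_scale b v) = restr_scale (a * b) v.
Proof. by rewrite /restr_scale scalerA rmorphM. Qed.
Fact restr_scale1 : left_id 1 restr_scale.
Proof. by move=> v; rewrite /restr_scale rmorph1 scale1r. Qed.
Fact restr_scaleDr : right_distributive restr_scale +%R.
Proof. by move=> a u v; rewrite /restr_scale scalerDr. Qed.
Fact restr_scaleDl v : {morph restr_scale^~ v : a b / a + b}.
Proof. by move=> a b; rewrite /restr_scale rmorphD scalerDl. Qed.
HB.instance Definition _ := GRing.Zmodule_isLmodule.Build R (restr f V)
  restr_scaleA restr_scale1 restr_scaleDr restr_scaleDl.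
End Lmodule.

Local Notation restrm V := (restr f V : lmodType R).

Lemma restrE (V : lmodType A) r (v : restr f V) : r *: v = f r *: (v : V) :> V.
Proof. by []. Qed.

Section RestrLinear.
Variables (U V : lmodType A) (g : {linear U -> V}).
Fact restr_linear_subproof : linear (g : restr f U -> restr f V).
Proof. by move=> a x y; rewrite !restrE linearP. Qed.
Definition restr_linear : {linear restrm U -> restrm V} := mkLinear restr_linear_subproof.
End RestrLinear.

Lemma restr_submodule (V : lmodType A) (U : V -> Prop) :
  submodule U -> @submodule R (restrm V) U.
Proof. by case=> U0 lin; split=> // a x y; apply: lin. Qed.

Lemma restr_chain_cond b (V : lmodType A) :
  chain_cond b (restrm V) -> chain_cond b V.
Proof.
move=> cV S [U0 sU0 SU0].
have [|U [_ [sU SU] Umax]] := cV (fun U => @submodule A V U /\ S U).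
  by exists U0; [exact: restr_submodule | split].
exists U; split=> // U' sU' SU'; apply: Umax => //; exact: restr_submodule.
Qed.

Section Algebra.
Hypothesis f_central : forall r x, f r * x = x * f r.
Hypothesis accR : chain_cond true R^o.
Hypothesis fgenA : fgen (restrm A^o).

Lemma fgen_acc (V : lmodType R) : fgen V -> chain_cond true V.
Proof.
move: V; have H := @fgen_ind R (fun=> False) (fun V => chain_cond true V).
move=> V; apply: H => // [K L M i p sp|K x _ /cyclic_quot[p [sp _]]].
  exact: chain_cond_ext (ses_exact sp).
exact: chain_cond_quot sp accR.
Qed.

Lemma acc_restr (V : lmodType A) : fgen V -> chain_cond true (restrm V).
Proof.
move: V; have H := @fgen_ind A (fun=> False) (fun V => chain_cond true (restrm V)).
move=> V; apply: H => // [K L M i p sp|K x _ /cyclic_quot[p [sp _]]].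
  by apply: (chain_cond_ext (i := restr_linear i) (p := restr_linear p)) => y;
     apply: ses_exact sp y.
apply: (chain_cond_quot (p := restr_linear p)); first exact: sp.
exact: fgen_acc.
Qed.

Lemma acc_fgenA (V : lmodType A) : fgen V -> chain_cond true V.
Proof. by move=> /acc_restr/restr_chain_cond. Qed.

Lemma fgen_restr (V : lmodType A) : fgen V -> fgen (restrm V).
Proof. by move=> /acc_restr/acc_fgen. Qed.

Lemma fgen_reg : fgen (A^o : lmodType A).
Proof.
exists 1%N, (fun=> 1) => x; exists (fun=> x).
by rewrite big_ord1; apply/esym/mulr1.
Qed.

Lemma fgen_sub (K L : lmodType A) (i : {linear K -> L}) :
  injective i -> fgen L -> fgen K.
Proof. by move=> ii /acc_fgenA /(chain_cond_sub ii) /acc_fgen. Qed.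

(** Nakayama's lemma for the quotient of [V] by [T], stated with congruences modulo [T] so that no
    quotient is formed. Generators are eliminated one at a time. *)
Lemma nakayama (x : R) (V : lmodType R) (T : V -> Prop) : x \in @jacobson R ->
  submodule T ->
  (exists n (s : 'I_n -> V), forall y, exists c : 'I_n -> R, T (y - \sum_i c i *: s i)) ->
  (forall y, exists z, T (y - x *: z)) -> forall y, T y.
Proof.
move=> Jx sT [n [s gen]] xV; elim: n s gen => [|n IH] s gen.
  by move=> y; have [c] := gen y; rewrite big_ord0 subr0.
apply: (IH (fun i => s (lift ord0 i))) => y.
pose v := s ord0; pose s' i := s (lift ord0 i).
have gen' z : exists c0 c', T (z - (c0 *: v + \sum_i c' i *: s' i)).
  have [c Tc] := gen z; exists (c ord0), (fun i => c (lift ord0 i)).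
  by move: Tc; rewrite big_ord_recl.
have [z Tz] := xV v; have [a [c Tc]] := gen' z.
(* Modulo [T], [v = x *: z] and [z] has coefficient [a] at [v], so [(1 - x * a) *: v] is a
   combination of the other generators; [u] inverts [1 - x * a]. *)
have [u uE] := jacobson_linv accR (jacobsonMr a Jx).
have Tv : T (v - \sum_i (u * x * c i) *: s' i).
  have -> : v - \sum_i (u * x * c i) *: s' i =
      u *: (v - x *: z) + (u * x) *: (z - (a *: v + \sum_i c i *: s' i)).
    have -> : \sum_i (u * x * c i) *: s' i = (u * x) *: \sum_i c i *: s' i.
      by rewrite scaler_sumr; apply: eq_bigr => i _; rewrite scalerA.
    rewrite [u *: _]scalerBr scalerA [(u * x) *: (z - _)]scalerBr addrA subrK.
    rewrite scalerDr opprD addrA; congr (_ - _).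
    by rewrite scalerA -scalerBl -mulrA -{1}[u]mulr1 -mulrBr uE scale1r.
  by apply: submoduleD => //; apply: submoduleZ.
have [b [c' Tc']] := gen' y.
exists (fun i => b * (u * x * c i) + c' i).
have -> : y - \sum_i (b * (u * x * c i) + c' i) *: s' i =
   (y - (b *: v + \sum_i c' i *: s' i)) + b *: (v - \sum_i (u * x * c i) *: s' i).
  have -> : \sum_i (b * (u * x * c i) + c' i) *: s' i =
     b *: (\sum_i (u * x * c i) *: s' i) + \sum_i c' i *: s' i.
    by rewrite scaler_sumr -big_split; apply: eq_bigr => i _; rewrite scalerDl scalerA.
  rewrite scalerBr !opprD -[RHS]addrA; congr (y + _).
  by rewrite [RHS]addrACA addNr add0r addrC.
by apply: submoduleD => //; apply: submoduleZ.
Qed.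

(** The multiples of [f x] form a submodule of [M]; were it all of [M], Nakayama's lemma would give
    [M = 0]. *)
Lemma simple_rad (M : lmodType A) (x : R) : x \in @jacobson R -> fgen M ->
  (forall U : M -> Prop, submodule U -> (forall x, U x -> x = 0) \/ (forall x, U x)) ->
  forall m : M, f x *: m = 0.
Proof.
move=> Jx gM simp; have sU : submodule (fun y : M => exists m, f x *: m = y).
  split=> [|a _ _ [m <-] [m' <-]]; first by exists 0; rewrite scaler0.
  by exists (a *: m + m'); rewrite scalerDr !scalerA f_central.
have [U0|U1] := simp _ sU => m; first by apply: U0; exists m.
suff M0 y : y = 0 :> M by rewrite [LHS]M0.
apply: (nakayama (V := restrm M) (T := fun y => y = 0) Jx) y.
- by split=> // a ? ? -> ->; rewrite scaler0 addr0.
- have [n [s gen]] := fgen_restr gM; exists n, s => y.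
  by have [c ->] := gen y; exists c; rewrite subrr.
- by move=> y; have [z <-] := U1 y; exists z; rewrite restrE subrr.
Qed.

Lemma maximal_simple (U : {pred A^o}) : maximal_submod U ->
  exists (S : lmodType A) (p : {linear A^o -> S}),
    [/\ surjective p, forall x, p x = 0 <-> x \in U, exists x : S, x <> 0 &
      forall W : S -> Prop, submodule W -> (forall x, W x -> x = 0) \/ (forall x, W x)].
Proof.
move=> [cU [z nUz] Umax]; have [S [p [sp kp]]] := quotmod_quot (submodule_pred cU).
exists S, p; split=> //; first by exists (p z) => /kp; apply/negP.
move=> W sW; have cW := submod_pd_closed (submodule_preimage p sW).
have [|WU|WT] := Umax _ cW.
- by move=> x Ux; apply/submod_pdP; rewrite (kp x).2 //; case: sW.
- left=> y; have [x <-] := sp y => Wx; apply/kp; rewrite -WU; exact/submod_pdP.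
- by right=> y; have [x <-] := sp y; apply/(submod_pdP (fun x => W (p x))); rewrite WT.
Qed.

(** A maximal left ideal is the kernel of a map from [A] to a simple module, and [f x] kills simple
    modules. *)
Lemma rad_jacobson x : x \in @jacobson R -> f x \in @jacobson A.
Proof.
move=> Jx; apply/jacobsonP => m mm.
have [S [p [sp kp _ simp]]] := maximal_simple mm.
apply/kp; have -> : (f x : A^o) = f x *: (1 : A^o) by apply/esym/mulr1.
rewrite linearZ; apply: simple_rad => //; exact: fgen_quot sp fgen_reg.
Qed.

End Algebra.
End Restriction.

(** * Finite length over a semilocal ring modulo its radical *)

Section Artinian.
Variable R : comPzRingType.
Hypothesis accR : chain_cond true R^o.

(** Enumerates the maximal ideals by indices below [n]; indices that name no maximal ideal receive
    the whole ring as a default value. *)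
Lemma semilocal_enum : semilocal R -> exists n (m : nat -> {pred R^o}),
  (forall i, maximal_submod (m i) \/ m i = (fun=> true)) /\
  forall m', maximal_submod m' -> exists2 i, (i < n)%N & m' = m i.
Proof.
move=> [n /card_set_bijP[g [gfun ginj _]]].
have /choice[m mP] i : exists m : {pred R^o}, (maximal_submod m \/ m = (fun=> true)) /\
    forall m', maximal_submod m' -> g m' = i -> m' = m.
  have [[m [mm gm]]|nm] := pselect (exists m, maximal_submod m /\ g m = i).
    exists m; split=> [|m' mm' gm']; first by left.
    exact: (ginj m' m (mem_set mm') (mem_set mm) (etrans gm' (esym gm))).
  exists (fun=> true); split=> [|m' mm' gm']; first by right.
  by case: nm; exists m'.
exists n, m; split=> [i|m' mm']; first by case: (mP i).
by exists (g m'); [exact: (gfun m') | case: (mP (g m')) => _; apply].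
Qed.

Lemma maximal_cyclic_simple (m : {pred R^o}) (K : lmodType R) (x : K) :
  maximal_submod m \/ m = (fun=> true) ->
  (forall r, r \in m -> forall y : K, r *: y = 0) ->
  (forall y, exists a, y = a *: x) ->
  forall U : K -> Prop, submodule U -> (forall x, U x -> x = 0) \/ (forall x, U x).
Proof.
move=> mm mK cyc U sU; have [[[m0 mlin] _ mmax]|mT] := mm; last first.
  by left=> y _; rewrite -[y]scale1r mK // mT.
have [[y [Uy y0]]|nU] := pselect (exists y, U y /\ y <> 0); last first.
  by left=> y Uy; apply: contrapT => y0; apply: nU; exists y.
right=> z; have [r yE] := cyc y; have [c ->] := cyc z.
pose B (a : R^o) := exists2 b, b \in m & exists c : R, a = b + c * r.
have sB : @submodule R R^o B.
  split=> [|a _ _ [b mb [d ->]] [b' mb' [d' ->]]].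
    by exists 0 => //; exists 0; rewrite mul0r addr0.
  exists (a *: b + b'); first exact: mlin.
  by exists (a * d + d'); rewrite scalerDr mulrDl addrACA -mulrA.
have [|Bm|BT] := mmax _ (submod_pd_closed sB).
- by move=> a ma; apply/submod_pdP; exists a => //; exists 0; rewrite mul0r addr0.
- have rm : r \in m.
    by rewrite -Bm; apply/submod_pdP; exists 0 => //; exists 1; rewrite add0r mul1r.
  by case: y0; rewrite yE mK.
- have [b mb [d cE]] : B c by apply/(submod_pdP B); rewrite BT.
  by rewrite cE scalerDl mK // add0r -scalerA -yE; apply: submoduleZ.
Qed.

(** Filter [V] by peeling off one maximal ideal at a time. The top quotient is killed by [m n], so
    its cyclic pieces are simple or zero, while [m n] times [V] is killed by the intersection of the
    remaining ideals. *)
Lemma rad_artinian (V : lmodType R) : semilocal R -> fgen V ->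
  (forall r, r \in @jacobson R -> forall v : V, r *: v = 0) -> chain_cond false V.
Proof.
move=> /semilocal_enum[n [m [mP menum]]] gV JV.
have {JV}: forall r, (forall i, (i < n)%N -> r \in m i) -> forall v : V, r *: v = 0.
  move=> r rm; apply: JV; apply/jacobsonP => m' /menum[i ni ->]; exact: rm.
elim: n {menum} V gV => [|n IH] V gV kV.
  by apply: chain_cond_zero => v; rewrite -[v]scale1r kV.
(* [W] is the product of the ideal [m n] with [V], as the least submodule containing all
   [r *: v]. *)
pose W (x : V) := forall U : V -> Prop, submodule U ->
  (forall r, r \in m n -> forall v, U (r *: v)) -> U x.
have sW : submodule W.
  split=> [U [U0 _] _|a x y Wx Wy U sU rU]; first exact: U0.
  by apply: submoduleD => //; [apply: submoduleZ => //; apply: Wx | apply: Wy].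
have [K [M [i [p [sp pE]]]]] := submod_ses sW.
apply: (chain_cond_ext (ses_exact sp)).
  apply: IH => [|r rm k].
    exact/acc_fgen/(chain_cond_sub (ses_inj sp))/fgen_acc.
  apply: (ses_inj sp); rewrite linear0 linearZ.
  have /pE : p (i k) = 0 by exact: ses_comp0 sp _.
  move=> /(_ (fun y => r *: y = 0)); apply=> [|s sn v /=].
    split=> [|a x y rx ry]; rewrite ?scaler0 // scalerDr scalerA mulrC -scalerA.
    by rewrite rx ry scaler0 addr0.
  rewrite scalerA; apply: kV => j; rewrite ltnS leq_eqVlt => /orP[/eqP->|jn].
    have [[[_ lin] _ _]|->] := mP n; last by [].
    by have := lin r s 0 sn; rewrite addr0; apply; have [[[]]|->] := mP n.
  have [[[m0 lin] _ _]|->] := mP j; last by [].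
  by have := lin s r 0 (rm _ jn) m0; rewrite addr0 [_ *: _]mulrC.
have gM := fgen_quot (ses_surj sp) gV.
have H := @fgen_ind R (fun r => r \in m n) (fun V => chain_cond false V).
apply: H gM => // [K' L M' i' p' sp'|K' x kK' cyc|r rm y].
- exact: chain_cond_ext (ses_exact sp').
- by apply: chain_cond_simple; apply: (maximal_cyclic_simple (mP n) kK' cyc).
- have [v <-] := ses_surj sp y; rewrite -linearZ_LR; apply/pE => U sU; exact.
Qed.

End Artinian.

(** * Devissage over a semilocal Noether algebra *)

Section NoetherAlgebra.
Variables (R : comPzRingType) (A : pzRingType) (f : {rmorphism R -> A}).
Hypothesis f_central : forall r x, f r * x = x * f r.
Hypothesis accR : chain_cond true R^o.
Hypothesis semiR : semilocal R.
Hypothesis fgenA : fgen (restr f A^o : lmodType R).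

Local Notation restrm V := (restr f V : lmodType R).
Implicit Types K L M N S : lmodType A.

Definition simple_module M : Prop := (exists x : M, x <> 0) /\
  forall U : M -> Prop, submodule U -> (forall x, U x -> x = 0) \/ (forall x, U x).

Lemma rad_dcc M : fgen M ->
  (forall r, r \in @jacobson R -> forall m : M, f r *: m = 0) -> chain_cond false M.
Proof.
move=> gM JM; apply: (restr_chain_cond (f := f)); apply: rad_artinian => //.
exact: fgen_restr.
Qed.

Lemma mulr_linear M r : exists g : {linear M -> M}, forall m, g m = f r *: m.
Proof.
have lg : linear (fun m : M => f r *: m).
  by move=> a x y; rewrite scalerDr !scalerA f_central.
by exists (mkLinear lg).
Qed.

Section Devissage.
Variable C : lmodType A -> Prop.
Hypothesis C_ext : forall K L M (i : {linear K -> L}) (p : {linear L -> M}),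
  ses i p -> C K -> C M -> C L.
Hypothesis C_zero : forall M, zero_module M -> C M.
Hypothesis C_simple : forall M, fgen M -> simple_module M -> C M.
Hypothesis C_rad : forall M M' x (p : {linear M -> M'}), fgen M ->
  x \in @jacobson R -> (forall m : M, f x *: m = 0 -> m = 0) -> surjective p ->
  (forall m, p m = 0 <-> exists m', f x *: m' = m) -> C M' -> C M.

(** A minimal submodule violating [C] would be nonzero, and its maximal proper submodule would
    satisfy [C] with simple quotient. *)
Let devissage_dcc M : fgen M -> chain_cond false M -> C M.
Proof.
move=> gM dM; apply: contrapT => nC.
(* [C] speaks of modules, not of predicates, so it is asked of every module embedded with image
   [U]. *)
pose C' (U : M -> Prop) := forall K (i : {linear K -> M}), injective i ->
  (forall x, U x <-> exists k, i k = x) -> C K.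
have [|U [sU nCU Umin]] := dM (fun U => ~ C' U).
  exists (fun=> True) => // CT; apply: nC; apply: (CT M idfun) => // x.
  by split=> // _; exists x.
apply: nCU => K i ii UE.
have [K0|K0] := pselect (zero_module K); first exact: C_zero.
have gK : fgen K by apply: fgen_sub gM => //; eassumption.
have accK := acc_fgenA accR fgenA gK.
have [|W [sW [z nWz] Wmax]] := accK (fun W => exists z, ~ W z).
  exists (fun x => x = 0); first by split=> // a x y -> ->; rewrite scaler0 addr0.
  by apply: contrapT => nz; apply: K0 => x; apply: contrapT => x0; apply: nz; exists x.
have [K' [S [j [p [sp pE]]]]] := submod_ses sW.
apply: (C_ext sp).
- pose U' x := exists2 k, W k & i k = x.
  have CU' : C' U'.
    apply: contrapT => nC'; apply: nWz.
    have [y Wy /ii <-//] : U' (i z).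
    apply: (Umin U' (submodule_image _ sW) nC'); last by apply/UE; exists z.
    by move=> x [k _ <-]; apply/UE; exists k.
  apply: (CU' K' (i \o j)); first by apply: inj_comp => //; exact: ses_inj sp.
  move=> x; split=> [[k /pE/(ses_exact sp)[k' <-] <-]|[k' <-]]; first by exists k'.
  by exists (j k') => //; apply/pE; rewrite (ses_comp0 sp).
- apply: C_simple; first exact: fgen_quot (ses_surj sp) gK.
  split=> [|V sV]; first by exists (p z) => /pE.
  have sV' := submodule_preimage p sV.
  have WV x : W x -> V (p x) by move=> /pE->; case: sV.
  have [[y nVy]|nV] := pselect (exists y, ~ V (p y)).
    left=> s; have [x <-] := ses_surj sp s => Vx; apply/pE.
    by apply: (Wmax _ sV') => //; exists y.
  right=> s; have [x <-] := ses_surj sp s; apply: contrapT => nVx.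
  by apply: nV; exists x.
Qed.

Let killed (I : R -> Prop) M := forall a, I a -> forall m : M, f a *: m = 0.

Let killed_sub I K L (i : {linear K -> L}) : injective i -> killed I L -> killed I K.
Proof. by move=> ii kL a Ia k; apply: ii; rewrite linearZ_LR kL // linear0. Qed.

Let killed_quot I L M (p : {linear L -> M}) : surjective p -> killed I L -> killed I M.
Proof. by move=> sp kL a Ia m; have [l <-] := sp m; rewrite -linearZ_LR kL // linear0. Qed.

(* Noetherian induction on the ideals of [R] annihilating [M]. *)
Lemma devissage M : fgen M -> C M.
Proof.
pose P I := forall M, fgen M -> killed I M -> C M.
suff: P (fun=> False) by move=> PF gM; apply: PF.
apply: contrapT => nP; have [|I [sI nPI Imax]] := @accR (fun I => ~ P I).
  exists (fun x => x = 0); first by split=> // a x y -> ->; rewrite scaler0 addr0.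
  by move=> P0; apply: nP => N gN _; apply: P0 => // a -> m; rewrite rmorph0 scale0r.
apply: nPI => {}M gM kM.
(* If the radical lies in [I], then [M] satisfies the descending chain condition. Otherwise some [x]
   of the radical enlarges [I] to the ideal [I'], for which the claim is known by maximality. *)
have [radI|/existsNP[x /not_implyP[Jx nIx]]] :=
    pselect (forall x, x \in @jacobson R -> I x).
  by apply: devissage_dcc => //; apply: rad_dcc => // r /radI; apply: kM.
pose I' (a : R^o) := exists b c, I b /\ a = b + c * x.
have sI' : submodule I'.
  split=> [|a _ _ [b [c [Ib ->]]] [b' [c' [Ib' ->]]]].
    by exists 0, 0; rewrite mul0r addr0; split=> //; case: sI.
  exists (a *: b + b'), (a * c + c'); split; first by case: sI => _; apply.
  by rewrite scalerDr mulrDl addrACA -mulrA.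
have PI' : P I'.
  apply: contrapT => nPI'; apply: nIx; apply: (Imax _ sI' nPI').
    by move=> a Ia; exists a, 0; rewrite mul0r addr0.
  by exists 0, 1; rewrite add0r mul1r; split=> //; case: sI.
have kI' N : killed I N -> (forall m : N, f x *: m = 0) -> killed I' N.
  move=> kN xN _ [b [c [Ib ->]]] m.
  by rewrite rmorphD rmorphM scalerDl kN // -scalerA xN scaler0 addr0.
(* On modules where [x] acts nilpotently: the kernel of [x] is killed by [I'], and the nilpotency
   exponent drops on the image. *)
have Cnil n N : fgen N -> killed I N -> (forall m : N, f x ^+ n *: m = 0) -> C N.
  elim: n N => [|n IH] N gN kN xN.
    by apply: C_zero => m; rewrite -[m]scale1r -(expr0 (f x)) xN.
  have [g gE] := mulr_linear N x.
  have [Y [j [ij YE]]] := submod_sub (submodule_im g).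
  have [p pE] : exists p : {linear N -> Y}, forall m, j (p m) = g m.
    by apply: inj_lift => // m; apply/YE; exists m.
  have sp : surjective p.
    move=> y; have /YE[m mE] : exists k, j k = j y by exists y.
    by exists m; apply: ij; rewrite pE.
  have [K [k sk]] := ker_ses sp; apply: (C_ext sk).
    apply: PI'; first by apply: fgen_sub (ses_inj sk) gN => //; eassumption.
    apply: kI' => [|m]; first exact: killed_sub (ses_inj sk) kN.
    by apply: (ses_inj sk); rewrite linearZ_LR -gE -pE (ses_comp0 sk) !linear0.
  apply: IH; first exact: fgen_quot sp gN.
    exact: killed_quot sp kN.
  move=> y; have [m <-] := sp y; apply: ij.
  by rewrite linearZ_LR pE gE scalerA -exprSr xN linear0.
(* The [x]-power torsion stabilizes at some [T n], covered by [Cnil]. On the quotient [x] is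
   injective, and [C_rad] passes to the cokernel of [x], which is killed by [I']. *)
pose T n (m : M) := f x ^+ n *: m = 0.
have sT n : submodule (T n).
  split=> [|a u v Tu Tv]; rewrite /T ?scaler0 // scalerDr scalerA.
  by rewrite -rmorphXn f_central -scalerA rmorphXn Tu Tv scaler0 addr0.
have accM := acc_fgenA accR fgenA gM.
have [|U [sU [n UE] Umax]] := accM (fun U => exists n, forall m, U m <-> T n m).
  by exists (T 0%N); [exact: sT | exists 0%N].
have Tn m : T n.+1 m -> T n m.
  move=> Tm; apply/UE; apply: (Umax _ (sT n.+1)) => //; first by exists n.+1.
  by move=> y /UE; rewrite /T exprS -scalerA => ->; rewrite scaler0.
have [K [M' [k [p [sp pE]]]]] := submod_ses (sT n).
apply: (C_ext sp).
  apply: (Cnil n); first by apply: fgen_sub (ses_inj sp) gM => //; eassumption.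
    exact: killed_sub (ses_inj sp) kM.
  move=> y; apply: (ses_inj sp); rewrite linearZ_LR linear0.
  by apply/pE; rewrite (ses_comp0 sp).
have gM' := fgen_quot (ses_surj sp) gM; have kM' := killed_quot (ses_surj sp) kM.
have [g gE] := mulr_linear M' x.
have [Q [q [sq qE]]] := quotmod_quot (submodule_im g).
apply: (C_rad gM' Jx _ sq).
- move=> m'; have [m <-] := ses_surj sp m'; rewrite -linearZ_LR => /pE xm.
  by apply/pE/Tn; rewrite /T exprSr -scalerA.
- by move=> m; rewrite qE; split=> -[m' <-]; exists m'; rewrite gE.
- apply: PI'; first exact: fgen_quot sq gM'.
  apply: kI' => [|y]; first exact: killed_quot sq kM'.
  by have [m <-] := sq y; rewrite -linearZ_LR; apply/qE; exists m; rewrite gE.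
Qed.

End Devissage.

End NoetherAlgebra.

(** * Finiteness and vanishing of Ext over Noether algebras *)

Section NoetherAlgebraExt.
Variables (R : comPzRingType) (A : pzRingType) (f : {rmorphism R -> A}).
Hypothesis f_central : forall r x, f r * x = x * f r.
Hypothesis accR : chain_cond true R^o.
Hypothesis semiR : semilocal R.
Hypothesis fgenA : fgen (restr f A^o : lmodType R).

Local Notation restrm V := (restr f V : lmodType R).
Implicit Types K L M N S Q : lmodType A.

Section SimpleSummand.
Variables (Q : lmodType A) (p : {linear A^o -> Q}).
Hypothesis p_surj : surjective p.
Hypothesis p_ker : forall x : A, p x = 0 <-> x \in @jacobson A.

(* A submodule [W] of [Q = A/J] minimal among those mapping onto [S] meets the
   kernel trivially: an element [w <> 0] of the kernel avoids some maximal left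
   ideal [m], and [W] intersected with [m/J] would be smaller. *)
Lemma simple_summand S : simple_module S ->
  exists (s : {linear S -> Q}) (r : {linear Q -> S}), forall x, r (s x) = x.
Proof.
move=> [[y y0] simp].
have pZ (a b : A) : p (a * b) = a *: p b by rewrite -linearZ_LR.
have dQ : chain_cond false Q.
  apply: (rad_dcc (f := f)) => //; first exact: fgen_quot p_surj (fgen_reg A).
  move=> r Jr q; have [a <-] := p_surj q; rewrite -pZ; apply/p_ker/jacobsonMr.
  exact: (rad_jacobson f_central accR fgenA Jr).
have lr : linear (fun a : A^o => (a : A) *: y).
  by move=> a b c; rewrite scalerDl scalerA.
have all_y (U : S -> Prop) : submodule U -> U y -> forall x, U x.
  by move=> sU Uy; have [U0|//] := simp _ sU; have := U0 _ Uy.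
have y_gen x : exists a : A, x = a *: y.
  apply: (all_y (fun x => exists a : A, x = a *: y)); last by exists 1; rewrite scale1r.
  split=> [|a _ _ [b ->] [c ->]]; first by exists 0; rewrite scale0r.
  by exists (a * b + c); rewrite scalerDl scalerA.
pose Wy (a : A^o) := (a : A) *: y = 0.
have sWy : submodule Wy := submodule_ker (mkLinear lr).
have mann : maximal_submod (submod_pd Wy).
  apply: (@maximal_submodE A A^o Wy 1 sWy) => [|U sU nU1 WU a Ua|U sU U1 _ a].
  - by rewrite /Wy scale1r.
  - apply: contrapT => ay; have [c cE] : exists c : A, y = c *: ((a : A) *: y).
      have sB : submodule (fun x => exists c : A, x = c *: ((a : A) *: y)).
        split=> [|d _ _ [b ->] [c ->]]; first by exists 0; rewrite scale0r.
        by exists (d * b + c); rewrite scalerDl scalerA.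
      have [Z|Z] := simp _ sB; last exact: Z.
      by case: ay; apply: Z; exists 1; rewrite scale1r.
    apply: nU1; rewrite -[1](subrK (c * a)); apply: (submoduleD sU).
      by apply: WU; rewrite /Wy scalerBl scale1r -scalerA -cE subrr.
    exact: (submoduleZ c).
  - by have := submoduleZ a sU U1; rewrite [_ *: _]mulr1.
have [r rE] : exists r : {linear Q -> S}, forall a, r (p a) = mkLinear lr a.
  by apply: surj_factor => // a /p_ker/jacobsonP/(_ _ mann)/submod_pdP.
have [|W [sW [q Wq rq] Wmin]] := dQ (fun W => exists2 q, W q & r q = y).
  by exists (fun=> True) => //; exists (p 1) => //; rewrite rE /= scale1r.
have W0 w : W w -> r w = 0 -> w = 0.
  move=> Ww rw; apply: contrapT => w0; have [a aE] := p_surj w.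
  have /existsNP[m /not_implyP[mm /negP am]] :
      ~ (forall m : {pred A^o}, maximal_submod m -> a \in m).
    by move=> am; apply: w0; rewrite -aE; apply/p_ker/jacobsonP.
  have [[m0 mlin] _ mmax] := mm.
  pose W' q := W q /\ exists2 b, b \in m & p b = q.
  have sW' : submodule W'.
    split=> [|c u v [Wu [b mb ub]] [Wv [b' mb' vb]]].
      by split; [case: sW | exists 0; rewrite ?linear0].
    split; first by case: sW => _; apply.
    by exists (c *: b + b'); [apply: mlin | rewrite linearP ub vb].
  have rW' q' : W' q' -> r q' = 0.
    have sI := submodule_image r sW'.
    have [Z W'q|Z] := simp _ sI; first by apply: Z; exists q'.
    have [q'' W'q'' rq''] := Z y.
    have W'W : sub_dir false W W' by move=> ? [].
    have WW' : sub_dir false W' W by apply: Wmin => //; exists q''.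
    have [_ [b mb pb]] := WW' _ Ww.
    have : a - b \in m.
      have /p_ker/jacobsonP/(_ _ mm) // : p (a - b) = 0 by rewrite linearB pb aE subrr.
    move=> abm; case/negP: am; have := mlin 1 _ _ abm mb.
    by rewrite scale1r subrK.
  pose B (x : A^o) := exists2 b, b \in m & exists c : A, x = b + c * a.
  have sB : submodule B.
    split=> [|c _ _ [b mb [d ->]] [b' mb' [d' ->]]].
      by exists 0 => //; exists 0; rewrite mul0r addr0.
    exists (c *: b + b'); first exact: mlin.
    by exists (c * d + d'); rewrite scalerDr mulrDl addrACA -mulrA.
  have [|Bm|BT] := mmax _ (submod_pd_closed sB).
  - by move=> b mb; apply/(submod_pdP B); exists b => //; exists 0; rewrite mul0r addr0.
  - case/negP: am; rewrite -Bm; apply/(submod_pdP B).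
    by exists 0 => //; exists 1; rewrite mul1r add0r.
  - have [x xE] := p_surj q; have [b mb [c cE]] : B x by apply/(submod_pdP B); rewrite BT.
    apply: y0; rewrite -rq -xE cE linearD pZ aE linearD linearZ_LR rw scaler0 addr0.
    apply: rW'; split; last by exists b.
    have -> : p b = q - c *: w by rewrite -xE cE linearD pZ aE addrK.
    by apply: submoduleB => //; apply: submoduleZ.
have [K [i [ii KE]]] := submod_sub sW.
have ri : injective (r \o i).
  apply: linear_inj0 => k /= rk; apply: ii; rewrite linear0.
  by apply: W0 => //; apply/KE; exists k.
have [g gE] : exists g : {linear S -> K}, forall x, (r \o i) (g x) = x.
  apply: (inj_lift (f := idfun)) => // x /=.
  apply: (all_y _ (submodule_im (r \o i))).
  by have /KE[k kE] := Wq; exists k; rewrite /= kE.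
by exists (i \o g), r.
Qed.

End SimpleSummand.

(** * Hom groups as modules over the central ring [R] *)

Fact linear_submodule M N :
  @submodule R (restrm (M -> N)) (fun g : M -> N => linear g).
Proof.
split=> [a x y|r g h lg lh a x y]; first by rewrite /GRing.zero /= scaler0 addr0.
rewrite -[LHS]/(f r *: g (a *: x + y) + h (a *: x + y)).
rewrite -[RHS]/(a *: (f r *: g x + h x) + (f r *: g y + h y)).
by rewrite lg lh !scalerDr !scalerA f_central addrACA.
Qed.

Definition lhom M N : lmodType R := submod (@linear_submodule M N).

Lemma lhom_linear M N (g : lhom M N) : linear (val g : M -> N).
Proof. by case: g => g /= /submod_pdP. Qed.

Lemma lhom_0 M N (g : lhom M N) : (val g : M -> N) 0 = 0.
Proof. exact: linear0 (mkLinear (lhom_linear g)). Qed.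

Lemma lhomZ M N (g : lhom M N) a x : (val g : M -> N) (a *: x) = a *: (val g : M -> N) x.
Proof. exact: linearZ_LR (mkLinear (lhom_linear g)) a x. Qed.

Definition lhom_mk M N (g : {linear M -> N}) : lhom M N :=
  Submod (@linear_submodule M N) ((submod_pdP _ _).2 (linearP g)).

Lemma lhomE M N r (g h : lhom M N) x :
  (val (r *: g + h) : M -> N) x = f r *: (val g : M -> N) x + (val h : M -> N) x.
Proof.
have -> : val (r *: g + h) = r *: (val g : restrm (M -> N)) + val h by exact: linearP.
by [].
Qed.

Lemma lhom_combE M N n (c : 'I_n -> R) (s : 'I_n -> lhom M N) x :
  (val (\sum_i c i *: s i) : M -> N) x = \sum_i f (c i) *: (val (s i) : M -> N) x.
Proof.
elim/big_rec2: _ => [//|i u v _ IH].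
by rewrite lhomE IH.
Qed.

Lemma lhom_subcombE M N n (c : 'I_n -> R) (s : 'I_n -> lhom M N) (y : lhom M N) x :
  (val (y - \sum_i c i *: s i) : M -> N) x =
  (val y : M -> N) x - \sum_i f (c i) *: (val (s i) : M -> N) x.
Proof.
rewrite -lhom_combE addrC -scaleN1r [LHS](lhomE (- 1)) rmorphN1 scaleN1r.
exact: addrC.
Qed.

Lemma linear_comb L M n (c : 'I_n -> R) (t : 'I_n -> {linear L -> M}) :
  exists h : {linear L -> M}, forall x, h x = \sum_i f (c i) *: t i x.
Proof.
have lh : linear (fun x => \sum_i f (c i) *: t i x).
  move=> a x y; rewrite scaler_sumr -big_split; apply: eq_bigr => i _ /=.
  by rewrite linearP scalerDr !scalerA f_central.
by exists (mkLinear lh).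
Qed.

Fact lhom_pre_subproof K L N (g : {linear K -> L}) (u : lhom L N) :
  linear ((val u : L -> N) \o g).
Proof. by move=> a x y; rewrite /= linearP lhom_linear. Qed.

Definition lhom_pre K L N (g : {linear K -> L}) (u : lhom L N) : lhom K N :=
  lhom_mk (mkLinear (lhom_pre_subproof g u)).

Fact lhom_pre_linear K L N (g : {linear K -> L}) : linear (@lhom_pre K L N g).
Proof. by move=> a x y; apply/val_inj/funext=> k. Qed.

Lemma lhom_zero M N (g : lhom M N) : (forall x, (val g : M -> N) x = 0) -> g = 0.
Proof. by move=> g0; apply/val_inj/funext. Qed.

(** Hom(-, N) is left exact, which handles extensions; for cyclic [K], evaluation at the generator
    embeds Hom(K, N) in [N]. *)
Lemma lhom_acc N M : chain_cond true (restrm N) -> fgen M -> chain_cond true (lhom M N).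
Proof.
move=> cN; move: M.
have H := @fgen_ind A (fun=> False) (fun M => chain_cond true (lhom M N)).
move=> M; apply: H => // [K L {}M i p sp cK cM|K x _ cyc].
  apply: (chain_cond_ext (i := mkLinear (@lhom_pre_linear _ _ N p))
    (p := mkLinear (@lhom_pre_linear _ _ N i))) cM cK => y.
  split=> [/(congr1 val) yi|[g <-]]; last first.
    by apply: lhom_zero => k /=; rewrite (ses_comp0 sp) lhom_0.
  have [g gE] : exists g : {linear M -> N}, forall l, g (p l) = (val y : L -> N) l.
    apply: (ses_factor (f := mkLinear (lhom_linear y)) sp) => k.
    by have /(congr1 (@^~ k)) := yi.
  by exists (lhom_mk g); apply/val_inj/funext.
have le : linear (fun g : lhom K N => (val g : K -> N) x : restrm N).
  by move=> a g h; exact: lhomE.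
apply: (chain_cond_sub (i := mkLinear le)) cN.
apply: linear_inj0 => g gx; apply: lhom_zero => y; have [a ->] := cyc y.
by rewrite lhomZ [X in _ *: X]gx scaler0.
Qed.

Lemma row_linear n M (s : 'I_n -> M) :
  exists g : {linear 'rV[A]_n -> M}, forall u, g u = \sum_i u 0 i *: s i.
Proof.
have lg : linear (fun u : 'rV[A]_n => \sum_i u 0 i *: s i).
  move=> a u v; rewrite scaler_sumr -big_split; apply: eq_bigr => i _.
  by rewrite !mxE scalerDl scalerA.
by exists (mkLinear lg).
Qed.

Lemma projective_row n : projective ('rV[A]_n : lmodType A).
Proof.
move=> M N g h sg.
have /choice[s sE] i := sg (h (delta_mx 0 i)).
have [k kE] := row_linear s; exists k => u.
rewrite kE linear_sum [u in RHS]row_sum_delta linear_sum.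
by apply: eq_bigr => i _; rewrite !linearZ sE.
Qed.

Lemma fgen_row n : fgen ('rV[A]_n : lmodType A).
Proof.
by exists n, (fun i => delta_mx 0 i) => u; exists (fun i => u 0 i); exact: row_sum_delta.
Qed.

Lemma fgen_cover M : fgen M -> exists n (p : {linear 'rV[A]_n -> M}), surjective p.
Proof.
move=> [n [s gen]]; have [p pE] := row_linear s; exists n, p => x.
have [c ->] := gen x; exists (\row_i c i); rewrite pE.
by apply: eq_bigr => i _; rewrite mxE.
Qed.

Section ExtFinite.
Variables (N : lmodType A) (D : coresolution N).
Local Notation C := (cosyzygy N (cores_coker D)).

(* the maps that vanish in [Ext^k(M, N)], a quotient of [Hom(M, C k)] *)
Definition Ext_trivial k M : (M -> C k) -> Prop :=
  match k return (M -> C k) -> Prop with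
  | 0%N => fun u => forall x, u x = 0
  | k'.+1 => fun u => exists g : {linear M -> cores_inj D k'},
      forall x, cores_p D k' (g x) = u x
  end.

Lemma Ext_trivial_submodule k M :
  @submodule R (lhom M (C k)) (fun u => Ext_trivial (val u : M -> C k)).
Proof.
case: k => [|k]; split=> //=.
- move=> a x y x0 y0 m; apply: etrans (lhomE a x y m) _.
  by rewrite [X in _ *: X + _]x0 [X in _ + X]y0 scaler0 addr0.
- by exists \0 => m; exact: linear0.
move=> a x y [g gE] [h hE].
have lg : linear (fun m => f a *: g m + h m).
  by move=> b u v; rewrite !linearP !scalerDr !scalerA f_central addrACA.
exists (mkLinear lg) => m; apply: etrans (esym (lhomE a x y m)).
by rewrite -[X in _ = _ *: X + _]gE -[X in _ = _ + X]hE /= linearD linearZ_LR.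
Qed.

Lemma Ext_trivial_extend k K L M (i : {linear K -> L}) (p : {linear L -> M})
    (u : K -> C k) : ses i p -> Ext_trivial u ->
  exists v : {linear L -> C k}, forall x, v (i x) = u x.
Proof.
case: k u => [|k] u sp /=; first by move=> u0; exists \0 => x; rewrite u0.
move=> [g gE]; have [h hE] := ses_extend (@cores_injective _ _ D k) sp g.
by exists (cores_p D k \o h) => x /=; rewrite hE.
Qed.

(** Dimension shifting: for the first syzygy [K] of [M], the connecting map Ext^k(K, N) ->
    Ext^(k+1)(M, N) is onto, so the images [w j] of generators generate. *)
Lemma Ext_finite k M : chain_cond true (restrm N) -> fgen M ->
  exists n (s : 'I_n -> lhom M (C k)), forall y, exists c : 'I_n -> R,
    Ext_trivial (val (y - \sum_i c i *: s i) : M -> C k).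
Proof.
move=> accN; elim: k M => [|k IH] M gM.
  have [n [s gen]] := acc_fgen (lhom_acc accN gM).
  by exists n, s => y; have [c ->] := gen y; exists c; rewrite subrr.
have [m [p sp]] := fgen_cover gM; have [K [i ss]] := ker_ses sp.
have gK : fgen K.
  by apply: (fgen_sub (f := f)) (fgen_row m) => //; first exact: ses_inj ss.
have sk := cores_ses D k.
have [n [s gen]] := IH K gK.
have /choice[t tE] j : exists t : {linear 'rV[A]_m -> cores_inj D k},
    forall x, t (i x) = cores_i D k ((val (s j) : K -> C k) x).
  exact: (ses_extend (@cores_injective _ _ D k) ss
    (cores_i D k \o mkLinear (lhom_linear (s j)))).
have /choice[w wE] j : exists w : {linear M -> C k.+1},
    forall u, w (p u) = cores_p D k (t j u).
  apply: (ses_factor (f := cores_p D k \o t j) ss) => x.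
  by rewrite /= tE (ses_comp0 sk).
exists n, (fun j => lhom_mk (w j)) => y.
have [g gE] := projective_row (mkLinear (lhom_linear y) \o p) (ses_surj sk).
have [u uE] : exists u : {linear K -> C k}, forall x, cores_i D k (u x) = g (i x).
  apply: (ses_lift (f := g \o i) sk) => x.
  by rewrite /= gE /= (ses_comp0 ss) lhom_0.
have [c cT] := gen (lhom_mk u); exists c.
have [v vE] := Ext_trivial_extend ss cT.
have [h hE] := linear_comb c t.
(* The lift [g] of [y], minus the combination of the [t j], agrees on [K] with the extended trivial
   part [v]; the difference descends to [M]. *)
have [z zE] : exists z : {linear M -> cores_inj D k},
    forall x, z (p x) = g x - h x - cores_i D k (v x).
  apply: (ses_factor (f := (g \- h) \- (cores_i D k \o v)) ss) => x /=.
  have -> : h (i x) = cores_i D k (\sum_j f (c j) *: (val (s j) : K -> C k) x).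
    by rewrite hE linear_sum; apply: eq_bigr => j _; rewrite linearZ_LR tE.
  by rewrite vE lhom_subcombE -uE -linearB -linearB subrr linear0.
exists z => x; have [q <-] := sp x.
rewrite zE linearB (ses_comp0 sk) subr0 linearB.
apply: etrans (esym (lhom_subcombE _ _ y (p q))).
rewrite gE /= hE linear_sum; congr (_ - _).
by apply: eq_bigr => j _; rewrite linearZ_LR -wE.
Qed.

(** Since Ext^(k+2)(M/xM, N) = 0, multiplication by [x] is onto on the finitely generated [R]-module
    Ext^(k+1)(M, N), and Nakayama's lemma applies. *)
Lemma Ext_zero_rad k M M' x (p : {linear M -> M'}) : chain_cond true (restrm N) ->
  fgen M -> x \in @jacobson R -> (forall m : M, f x *: m = 0 -> m = 0) -> surjective p ->
  (forall m, p m = 0 <-> exists m', f x *: m' = m) -> Ext_zero D k.+1 M' -> Ext_zero D k M.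
Proof.
move=> accN gM Jx injx sp pE eM'.
have [g gE] := mulr_linear f_central M x.
have ss : ses g p.
  split=> // [|m]; first by apply: linear_inj0 => m; rewrite gE; apply: injx.
  by rewrite pE; split=> -[m' <-]; exists m'; rewrite gE.
have [n [s gen]] := Ext_finite k.+1 accN gM.
suff T y : Ext_trivial (val (y : lhom M (C k.+1)) : M -> C k.+1).
  by move=> u; exact: (T (lhom_mk u)).
apply: (nakayama accR Jx (Ext_trivial_submodule k.+1 M)) y; first by exists n, s.
move=> y; have [h hE] := Ext_zero_extend ss eM' (mkLinear (lhom_linear y)).
exists (lhom_mk h); have -> : y - x *: lhom_mk h = 0.
  apply: lhom_zero => m; rewrite addrC -scaleNr [LHS](lhomE (- x)).
  rewrite rmorphN scaleNr /= -linearZ_LR -gE hE /= addNr //.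
by exists \0 => m; exact: linear0.
Qed.

Lemma Ext_devissage d : chain_cond true (restrm N) ->
  (forall S k, fgen S -> simple_module S -> (d <= k)%N -> Ext_zero D k S) ->
  forall M k, fgen M -> (d <= k)%N -> Ext_zero D k M.
Proof.
move=> accN eS M k gM; move: k.
apply: (devissage f_central accR semiR fgenA
  (C := fun M => forall k, (d <= k)%N -> Ext_zero D k M)) gM => {M}.
- by move=> K L M i p sp eK eM k dk; apply: (Ext_zero_ext sp); [apply: eK | apply: eM].
- by move=> M M0 k _; apply/Ext_zero_projective/projective_zero.
- by move=> M gM sM k dk; apply: eS.
- move=> M M' x p gM Jx injx sp pE eM' k dk.
  by apply: (Ext_zero_rad accN gM Jx injx sp pE); apply/eM'/leqW.
Qed.

(** Baer's criterion for the [d]-th cosyzygy: a map from a left ideal [K] extends because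
    Ext^(d+1)(A/K, N) = 0. *)
Lemma Ext_injdim d : (forall M, fgen M -> Ext_zero D d M) -> injdim_le N d.
Proof.
move=> eM; apply: (cores_inj_resolution (R := D)); apply: baer => K i ii g.
have [Q [p sp]] := coker_ses ii.
apply: (Ext_zero_extend sp); apply: eM; exact: fgen_quot (ses_surj sp) (fgen_reg A).
Qed.

End ExtFinite.

End NoetherAlgebraExt.

(** * Complexes of free modules *)

Section FreeComplexes.
Variable A : pzRingType.
Implicit Types K L M N P Q : lmodType A.

(* A finite part of a dual basis. [F] consists of the pairs [(h, y)] such that
   [y] is the linear combination with coefficients [h] of every sufficiently
   large finite set; this is a stand-in for the free module on [P], with the
   second projection as its canonical map to [P]. *)
Lemma dual_basis P n (q : 'I_n -> P) : projective P ->
  exists m (x : 'I_m -> P) (u : 'I_m -> {linear P -> A^o}),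
    forall i, q i = \sum_j (u j (q i) : A) *: x j.
Proof.
move=> pP.
pose F (z : ((P -> A^o) * P)%type) := exists X : seq P, forall Y : seq P,
  uniq Y -> {subset X <= Y} -> z.2 = \sum_(y <- Y) (z.1 y : A) *: y.
have sF : submodule F.
  split=> [|a [g y] [h z] [X XP] [Y YP]].
    exists [::] => Y _ _ /=; rewrite big1 // => y _; exact: scale0r.
  exists (X ++ Y) => Z uZ XYZ /=.
  have yE : y = \sum_(x <- Z) (g x : A) *: x.
    by apply: (XP Z) => // x xX; apply: XYZ; rewrite mem_cat xX.
  have zE : z = \sum_(x <- Z) (h x : A) *: x.
    by apply: (YP Z) => // x xY; apply: XYZ; rewrite mem_cat xY orbT.
  rewrite yE zE scaler_sumr -big_split; apply: eq_bigr => x _ /=.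
  by rewrite scalerA -scalerDl.
have [G [i [ii GE]]] := submod_sub sF.
have sp : surjective (lsnd _ _ \o i).
  move=> y; have /GE[k kE] : F ((fun x => (x == y)%:R : A^o), y).
    exists [:: y] => Y uY /(_ y (mem_head _ _)) yY /=.
    rewrite (bigD1_seq y) //= eqxx scale1r big1 ?addr0 // => x /negPf ->.
    exact: scale0r.
  by exists k; rewrite /= kE.
have [s sE] := pP _ _ (lsnd _ _ \o i) idfun sp.
have /choice[X XP] y : exists X : seq P, forall Y : seq P, uniq Y -> {subset X <= Y} ->
    y = \sum_(x <- Y) ((i (s y)).1 x : A) *: x.
  have /GE[X XP] : exists k, i k = i (s y) by exists (s y).
  by exists X => Y uY XY; rewrite -XP //; apply: esym (sE y).
pose Y := undup (flatten [seq X (q i) | i <- enum 'I_n]).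
have lu y : linear (fun z => (i (s z)).1 y) by move=> a u v; rewrite !linearP.
exists (size Y), (fun j => Y`_j), (fun j => mkLinear (lu Y`_j)) => k /=.
rewrite {1}(XP (q k) Y) ?undup_uniq //; last first.
  move=> x xX; rewrite mem_undup; apply/flattenP; exists (X (q k)) => //.
  by apply: map_f; rewrite mem_enum.
by rewrite (big_nth 0) big_mkord.
Qed.

(** Matrices act on row modules from the right, and columns are the linear forms on rows. This is
    thus the nontrivial inclusion in the exactness of the complex dualized into [A]. *)
Definition column_exact a b c (D : 'M[A]_(a, b)) (D' : 'M[A]_(b, c)) : Prop :=
  forall v : 'cV[A]_b, D *m v = 0 -> exists w, v = D' *m w.

Definition row_exact a b c (D : 'M[A]_(a, b)) (D' : 'M[A]_(b, c)) : Prop :=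
  forall u : 'rV[A]_b, u *m D' = 0 <-> exists w, u = w *m D.

Lemma linear_row_column a (g : {linear 'rV[A]_a -> A^o}) :
  exists v : 'cV[A]_a, forall u, g u = (u *m v) 0 0.
Proof.
exists (\col_j g (delta_mx 0 j)) => u; rewrite mxE {1}[u]row_sum_delta linear_sum.
by apply: eq_bigr => j _; rewrite linearZ mxE.
Qed.

Lemma column_linear a (v : 'cV[A]_a) : exists g : {linear 'rV[A]_a -> A^o},
  forall u, g u = (u *m v) 0 0.
Proof.
have lg : linear (fun u : 'rV[A]_a => (u *m v) 0 0 : A^o).
  by move=> c x y; rewrite mulmxDl -scalemxAl !mxE.
by exists (mkLinear lg).
Qed.

Lemma row_mulmx_inj a b (D D' : 'M[A]_(a, b)) :
  (forall u : 'rV_a, u *m D = u *m D') -> D = D'.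
Proof. by move=> E; apply/row_matrixP => i; rewrite !rowE. Qed.

(** The values of [g] at the finitely many unit vectors involve only a finite part of a dual basis
    of [P], so [g] is a finite sum of linear forms times elements of [P]; each form factors by
    exactness of the dual. No finiteness of [P] is assumed. *)
Lemma projective_column_exact a b c (D : 'M[A]_(a, b)) (D' : 'M[A]_(b, c)) P
    (g : {linear 'rV[A]_b -> P}) : column_exact D D' -> projective P ->
  (forall u, g (u *m D) = 0) ->
  exists h : {linear 'rV[A]_c -> P}, forall u, h (u *m D') = g u.
Proof.
move=> ex pP gD.
have [m [x [l lE]]] := dual_basis (fun i => g (delta_mx 0 i)) pP.
have gu u : g u = \sum_i u 0 i *: g (delta_mx 0 i).
  rewrite {1}[u]row_sum_delta linear_sum; apply: eq_bigr => i _.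
  by rewrite linearZ_LR.
have gE u : g u = \sum_j (l j (g u) : A) *: x j.
  transitivity (\sum_i \sum_j (u 0 i * (l j (g (delta_mx 0 i)) : A)) *: x j).
    rewrite [LHS]gu; apply: eq_bigr => i _; rewrite [in LHS]lE scaler_sumr.
    by apply: eq_bigr => j _; rewrite scalerA.
  rewrite exchange_big; apply: eq_bigr => j _.
  rewrite [in RHS]gu linear_sum scaler_suml; apply: eq_bigr => i _.
  by rewrite linearZ_LR.
have /choice[w wE] j : exists w : 'cV[A]_c, forall u, l j (g u) = (u *m D' *m w) 0 0.
  have [v vE] := linear_row_column (l j \o g).
  have [|w wE] := ex v.
    apply: row_mulmx_inj => u; rewrite mulmxA mulmx0.
    apply/matrixP=> i k; rewrite !ord1 -vE /= gD linear0 mxE //.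
  by exists w => u; rewrite -[LHS]/((l j \o g) u) vE wE mulmxA.
have lh : linear (fun u : 'rV[A]_c => \sum_j ((u *m w j) 0 0 : A) *: x j).
  move=> d u v; rewrite scaler_sumr -big_split; apply: eq_bigr => j _.
  have -> : ((d *: u + v) *m w j) 0 0 = d * (u *m w j) 0 0 + (v *m w j) 0 0.
    by rewrite mulmxDl -scalemxAl !mxE.
  by rewrite scalerDl scalerA.
exists (mkLinear lh) => u; rewrite [RHS]gE.
by apply: eq_bigr => j _; rewrite wE.
Qed.

(** Dimension shifting on [L]: each step to a syzygy moves one place to the left in the complex, and
    [n <= m] leaves room for that. *)
Lemma projdim_column_exact (p : nat -> nat) (D : forall k, 'M[A]_(p k, p k.+1)) :
  (forall k, column_exact (D k) (D k.+1)) -> (forall k, D k *m D k.+1 = 0) ->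
  forall n L m (g : {linear 'rV[A]_(p m.+1) -> L}), projdim_le n L -> (n <= m)%N ->
  (forall u, g (u *m D m) = 0) ->
  exists h : {linear 'rV[A]_(p m.+2) -> L}, forall u, h (u *m D m.+1) = g u.
Proof.
move=> ex DD; elim=> [|n IH] L m g.
  by move=> pL _; apply: projective_column_exact.
move=> [K [P [i [q [pP sp pK]]]]]; case: m g => // m g nm gD.
have [g' g'E] := projective_row g (ses_surj sp).
have [w wE] : exists w : {linear 'rV[A]_(p m.+1) -> K},
    forall u, i (w u) = g' (u *m D m.+1).
  apply: (ses_lift (f := g' \o mulmxr (D m.+1)) sp) => u.
  by rewrite /= g'E gD.
have [|h' h'E] := IH K m w pK nm.
  by move=> u; apply: (ses_inj sp); rewrite wE -mulmxA DD mulmx0 !linear0.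
have [|h hE] := @projective_column_exact _ _ _ (D m.+1) (D m.+2) P
    (g' \- (i \o h')) (ex _) pP.
  by move=> u /=; rewrite h'E wE subrr.
exists (q \o h) => u; rewrite /= hE /= linearB (ses_comp0 sp) subr0.
exact: g'E.
Qed.

(** The dual of [coresolution], with terms of finite rank: [fr_syz k] is the syzygy of order
    [k + 1], and [cosyzygy] again only inserts [M] at index 0. *)
Record free_resolution M := FreeResolution {
  fr_rank : nat -> nat;
  fr_syz : nat -> lmodType A;
  fr_q : forall k, {linear 'rV[A]_(fr_rank k) -> cosyzygy M fr_syz k};
  fr_i : forall k, {linear fr_syz k -> 'rV[A]_(fr_rank k)};
  fr_ses : forall k, ses (fr_i k) (fr_q k)
}.

Lemma free_resolution_exists M :
  (forall K L (i : {linear K -> L}), injective i -> fgen L -> fgen K) ->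
  fgen M -> inhabited (free_resolution M).
Proof.
move=> fgs gM; pose T := {M : lmodType A | fgen M}.
have step (X : T) : {n : nat & {K : T & {i : {linear sval K -> 'rV[A]_n} &
    {q : {linear 'rV[A]_n -> sval X} | ses i q}}}}.
  case: X => X gX; have [n /cid[q sq]] := cid (fgen_cover gX).
  have [K /cid[i si]] := cid (ker_ses sq).
  by exists n, (exist _ K (fgs _ _ i (ses_inj si) (fgen_row A n))), i, q.
pose st := fix st k := if k is k'.+1 then projT1 (projT2 (step (st k')))
  else exist _ M gM.
pose n k := projT1 (step (st k)).
have E k : sval (st k) = cosyzygy M (fun k => sval (st k.+1)) k by case: k.
pose q k : {linear 'rV[A]_(n k) -> cosyzygy M (fun k => sval (st k.+1)) k} :=
  ecast X {linear 'rV[A]_(n k) -> X} (E k)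
    (sval (projT2 (projT2 (projT2 (step (st k)))))).
constructor; apply: (@FreeResolution M n (fun k => sval (st k.+1)) q
  (fun k => projT1 (projT2 (projT2 (step (st k)))))) => k.
have := svalP (projT2 (projT2 (projT2 (step (st k))))).
by rewrite /q; case: _ / (E k).
Qed.

Section FreeResolution.
Variables (M : lmodType A) (F : free_resolution M).
Local Notation p := (fr_rank F).
Local Notation Y := (cosyzygy M (fr_syz F)).

Definition fr_mx k : 'M[A]_(p k.+1, p k) := lin1_mx (fr_i F k \o fr_q F k.+1).

Lemma fr_mxE k u : u *m fr_mx k = fr_i F k (fr_q F k.+1 u).
Proof. exact: mul_rV_lin1. Qed.

Lemma fr_mx_exact k : row_exact (fr_mx k.+1) (fr_mx k).
Proof.
move=> u; rewrite fr_mxE; have sk := fr_ses F k; have sk1 := fr_ses F k.+1.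
split=> [u0|[w ->]]; last by rewrite fr_mxE (ses_comp0 sk1) linear0.
have /(ses_exact sk1)[y <-] : fr_q F k.+1 u = 0 by apply: (ses_inj sk); rewrite u0 linear0.
have [w <-] := ses_surj (fr_ses F k.+2) y.
by exists w; rewrite fr_mxE.
Qed.

Variable D : coresolution (A^o : lmodType A).

Lemma Ext_zero_fr_shift j k : Ext_zero D j (Y k.+1) -> Ext_zero D j.+1 (Y k).
Proof.
apply: (Ext_zero_shift (fr_ses F k)).
exact/Ext_zero_projective/projective_row.
Qed.

(** The dual of [F] at index [m + 1] computes Ext^(m+1)(M, A). Exactness there says that every form
    on the syzygy [Y m.+1] extends, i.e. Ext^1(Y m, A) = 0; then shift [m] times. *)
Lemma column_exact_Ext_zero m :
  column_exact (fr_mx m.+1) (fr_mx m) -> Ext_zero D m M.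
Proof.
move=> ex; have e0 : Ext_zero D 0 (Y m).
  apply: (Ext_zero_coker (fr_ses F m)).
    exact/Ext_zero_projective/projective_row.
  move=> g; have [v vE] := linear_row_column (g \o fr_q F m.+1).
  have [|w wE] := ex v.
    apply: row_mulmx_inj => u; rewrite mulmxA mulmx0.
    apply/matrixP=> i k; rewrite !ord1 -vE /= fr_mxE (ses_comp0 (fr_ses F m.+1)).
    by rewrite linear0 mxE.
  have [h hE] := column_linear w; exists h => y.
  have [u <-] := ses_surj (fr_ses F m.+1) y.
  by rewrite hE -fr_mxE -mulmxA -wE -vE.
suff H j k : (j + k)%N = m -> Ext_zero D j (Y k) by apply: (H m 0%N); rewrite addn0.
elim: j k => [|j IH] k; first by rewrite add0n => ->.
by rewrite addSnnS => /IH/Ext_zero_fr_shift.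
Qed.

Lemma Ext_zero_column_exact m : Ext_zero D m M -> column_exact (fr_mx m.+1) (fr_mx m).
Proof.
move=> eM; have H j k : (j + k)%N = m -> Ext_zero D j (Y k).
  elim: k j => [|k IH] j; first by rewrite addn0 => ->.
  rewrite -addSnnS => /IH; apply: Ext_zero_syzygy (fr_ses F k).
  exact: projective_row.
move=> v Nv; have [g gE] := column_linear v.
have [h hE] : exists h : {linear Y m.+1 -> A^o}, forall u, h (fr_q F m.+1 u) = g u.
  apply: (ses_factor (fr_ses F m.+1)) => y.
  have [u <-] := ses_surj (fr_ses F m.+2) y.
  by rewrite gE -fr_mxE -mulmxA Nv mulmx0 mxE.
have [l lE] := Ext_zero_extend (fr_ses F m) (H 0%N m (add0n m)) h.
have [w wE] := linear_row_column l; exists w; apply: row_mulmx_inj => u.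
apply/matrixP=> i j; rewrite !ord1 -gE -hE -lE.
by rewrite mulmxA fr_mxE -wE.
Qed.

End FreeResolution.

End FreeComplexes.

(* As [A^c^c] is not convertible to [A], duality is stated for a pair of rings
   [A], [B] with mutually inverse anti-isomorphisms. *)
Section Dual.
Variables (A B : pzRingType) (o : A -> B) (o' : B -> A).
Hypotheses (oK : cancel o o') (o'K : cancel o' o).
Hypotheses (oD : {morph o : x y / x + y}) (oM : forall x y, o (x * y) = o y * o x).

Definition dual_mx a b (D : 'M[A]_(a, b)) : 'M[B]_(b, a) := \matrix_(i, j) o (D j i).

Lemma dual_mxM a b c (D : 'M[A]_(a, b)) (E : 'M[A]_(b, c)) :
  dual_mx (D *m E) = dual_mx E *m dual_mx D.
Proof.
have o0 : o 0 = 0 by apply: (addrI (o 0)); rewrite -oD !addr0.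
apply/matrixP=> i j; rewrite !mxE (big_morph o oD o0).
by apply: eq_bigr => k _; rewrite oM !mxE.
Qed.

Lemma dual_mx0 a b : dual_mx (0 : 'M[A]_(a, b)) = 0.
Proof.
have o0 : o 0 = 0 by apply: (addrI (o 0)); rewrite -oD !addr0.
by apply/matrixP=> i j; rewrite !mxE.
Qed.

End Dual.

Lemma dual_mxK (A B : pzRingType) (o : A -> B) (o' : B -> A) a b : cancel o o' ->
  cancel (@dual_mx A B o a b) (@dual_mx B A o' b a).
Proof. by move=> oK D; apply/matrixP=> i j; rewrite !mxE oK. Qed.

(** * From the Gorenstein dimension of A/J to the injective dimensions *)

Lemma projective_reg (A : pzRingType) : projective (A^o : lmodType A).
Proof.
move=> M N g h sg; have [x xE] := sg (h 1).
have lk : linear (fun a : A^o => (a : A) *: x).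
  by move=> a b c; rewrite scalerDl scalerA.
exists (mkLinear lk) => a /=; rewrite linearZ_LR xE -linearZ_LR.
by congr (h _); apply: mulr1.
Qed.

Lemma Gdim_iso (A : pzRingType) n (D D' : lmodType A) (e : {linear D -> D'}) :
  injective e -> surjective e -> Gdim_le n D -> Gdim_le n D'.
Proof.
move=> ie se gD; apply: (Gdim_ext (i := e) (p := \0 : {linear D' -> trivmod A})) gD
  (Gdim_zero n (@trivmod_zero A)).
split=> //; last by move=> z; exists 0; rewrite [z]trivmod_zero.
Qed.

(** Simple modules are summands of A/J. Their complements are carried along, so that extensions can
    be formed by adding up the complements. *)
Definition Gdim_summand (A : pzRingType) n (M : lmodType A) : Prop :=
  exists M' : lmodType A, Gdim_le n (M * M')%type.

Lemma Gdim_summand_ext (A : pzRingType) n (K L M : lmodType A)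
    (i : {linear K -> L}) (p : {linear L -> M}) :
  ses i p -> Gdim_summand n K -> Gdim_summand n M -> Gdim_summand n L.
Proof.
move=> sp [K' gK] [M' gM]; exists (K' * M')%type.
have li : linear (fun z : (K * K')%type => (i z.1, (z.2, 0)) : (L * (K' * M'))%type).
  move=> a [x x'] [y y'] /=; rewrite linearP.
  by congr (_, (_, _)); rewrite /= scaler0 addr0.
have lp : linear (fun z : (L * (K' * M'))%type => (p z.1, z.2.2) : (M * M')%type).
  by move=> a [x [x' x'']] [y [y' y'']] /=; rewrite linearP.
apply: (Gdim_ext (i := mkLinear li) (p := mkLinear lp)) gK gM.
split=> [[x x'] [y y'] /= [/(ses_inj sp)-> ->] //|[x [x' x'']]|[y y']] /=.
  split=> [[px ->]|[[k k'] [<- _ <-]]]; last by rewrite (ses_comp0 sp).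
  by have /(ses_exact sp)[k <-] := px; exists (k, x').
by have [x <-] := ses_surj sp y; exists (x, (0, y')).
Qed.

Lemma Gdim_summand_retract (A : pzRingType) n (M Q : lmodType A)
    (s : {linear M -> Q}) (r : {linear Q -> M}) :
  (forall x, r (s x) = x) -> Gdim_le n Q -> Gdim_summand n M.
Proof.
move=> sK gQ; have sr : surjective r by move=> x; exists (s x).
have [K [k sk]] := ker_ses sr; exists K.
have [t tE] : exists t : {linear Q -> K}, forall q, k (t q) = q - s (r q).
  apply: (ses_lift (f := idfun \- (s \o r)) sk) => q /=.
  by rewrite linearB sK subrr.
have [e eE] := linear_pair r t.
apply: (Gdim_iso (e := e)) gQ.
  apply: linear_inj0 => q; rewrite eE => -[rq tq].
  by rewrite -[q](subrK (s (r q))) -tE tq rq !linear0 addr0.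
move=> [x y]; exists (s x + k y); rewrite eE linearD sK (ses_comp0 sk) addr0.
congr (_, _); apply: (ses_inj sk).
by rewrite tE linearD sK (ses_comp0 sk) addr0 addrC addKr.
Qed.

(* Iterated along a projective resolution, this shows that [r] kills [Ext^m(M, -)]
   for all [m] as soon as it kills [M]. *)
Lemma factor_projective_syzygy (R A : pzRingType) (f : {rmorphism R -> A})
    (K P M : lmodType A) (i : {linear K -> P}) (p : {linear P -> M}) r :
  (forall x, f r * x = x * f r) -> projective P -> ses i p ->
  (exists (P' : lmodType A) (t : {linear M -> P'}) (q : {linear P' -> M}),
    projective P' /\ forall x, q (t x) = f r *: x) ->
  exists h : {linear P -> K}, forall k, h (i k) = f r *: k.
Proof.
move=> fr pP sp [P' [t [q [pP' qt]]]].
have [q' q'E] := pP' _ _ p q (ses_surj sp).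
have lr : linear (fun x : P => f r *: x).
  by move=> a x y; rewrite scalerDr !scalerA fr.
have [h hE] : exists h : {linear P -> K}, forall x, i (h x) = f r *: x - q' (t (p x)).
  apply: (ses_lift (f := mkLinear lr \- (q' \o (t \o p))) sp) => x /=.
  by rewrite linearB q'E qt linearZ_LR subrr.
exists h => k; apply: (ses_inj sp).
by rewrite hE (ses_comp0 sp) (linear0 t) (linear0 q') subr0 linearZ_LR.
Qed.

Section Main.
Variables (R : comPzRingType) (A B : pzRingType).
Variables (f : {rmorphism R -> A}) (g : {rmorphism R -> B}).
Hypothesis f_central : forall r x, f r * x = x * f r.
Hypothesis g_central : forall r x, g r * x = x * g r.
Hypothesis accR : chain_cond true R^o.
Hypothesis semiR : semilocal R.
Hypothesis fgenA : fgen (restr f A^o : lmodType R).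
Hypothesis fgenB : fgen (restr g B^o : lmodType R).
Variables (o : A -> B) (o' : B -> A).
Hypotheses (oK : cancel o o') (o'K : cancel o' o).
Hypotheses (oD : {morph o : x y / x + y}) (o'D : {morph o' : x y / x + y}).
Hypotheses (oM : forall x y, o (x * y) = o y * o x)
  (o'M : forall x y, o' (x * y) = o' y * o' x).
Hypothesis of_g : forall r, o (f r) = g r.

Variables (Q : lmodType A) (p : {linear A^o -> Q}) (d : nat).
Hypothesis p_surj : surjective p.
Hypothesis p_ker : forall x : A, p x = 0 <-> x \in @jacobson A.
Hypothesis GQ : Gprojdim_le Q d.

Lemma Gprojdim_injdim : injdim_le (A^o : lmodType A) d.
Proof.
have [D] := coresolution_exists (A^o : lmodType A).
apply: (Ext_injdim (D := D)) => M gM.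
apply: (Ext_devissage f_central accR semiR fgenA (D := D) (d := d)) gM _ => //.
  exact: fgen_acc.
move=> S k gS sS dk.
have [s [r sK]] := simple_summand f_central accR semiR fgenA p_surj p_ker sS.
apply: (Ext_zero_retract sK); apply: Ext_zero_Gprojdim GQ dk; exact: projective_reg.
Qed.

Definition rad_nilpotent (M : lmodType A) : Prop :=
  forall x, x \in @jacobson R -> exists n, forall m : M, f x ^+ n *: m = 0.

(** Devissage to simple modules. In the radical step [x] is both injective and nilpotent on [M], so
    [M = 0]. *)
Lemma rad_nilpotent_Gdim (M : lmodType A) :
  fgen M -> rad_nilpotent M -> Gdim_summand d M.
Proof.
apply: (devissage f_central accR semiR fgenA
  (C := fun M => rad_nilpotent M -> Gdim_summand d M)).
- move=> K L {}M i q sp dK dM nL; apply: (Gdim_summand_ext sp).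
    apply: dK => x /nL[n nx]; exists n => k; apply: (ses_inj sp).
    by rewrite linearZ_LR nx linear0.
  apply: dM => x /nL[n nx]; exists n => m; have [l <-] := ses_surj sp m.
  by rewrite -linearZ_LR nx linear0.
- move=> {}M M0 _; exists M; apply: Gdim_zero => -[x y].
  by rewrite (M0 x) (M0 y).
- move=> {}M gM sM _.
  have [s [r sK]] := simple_summand f_central accR semiR fgenA p_surj p_ker sM.
  exact: Gdim_summand_retract sK (Gprojdim_Gdim GQ).
- move=> {}M M' x q gM Jx injx _ _ _ /(_ x Jx)[n nx].
  have M0 (m : M) : m = 0.
    elim: n nx => [|n IH] nx; first by rewrite -[m]scale1r -(expr0 (f x)) nx.
    by apply: IH => m'; apply: injx; rewrite scalerA -exprS nx.
  by exists M; apply: Gdim_zero => -[u v]; rewrite (M0 u) (M0 v).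
Qed.

(* Divide by a submodule [U] maximal among those meeting [E] trivially: by
   Fitting's lemma, every [x] in the radical acts nilpotently modulo [U]. *)
Lemma rad_nilpotent_quotient (M : lmodType A) (E : M -> Prop) : fgen M -> submodule E ->
  (forall x, x \in @jacobson R -> forall e, E e -> f x *: e = 0) ->
  exists (M' : lmodType A) (q : {linear M -> M'}),
    [/\ surjective q, forall e, E e -> q e = 0 -> e = 0 & rad_nilpotent M'].
Proof.
move=> gM sE kE; have accM := acc_fgenA accR fgenA gM.
have [|U [sU UE Umax]] := accM (fun U => forall e, E e -> U e -> e = 0).
  by exists (fun x => x = 0); first by split=> // a x y -> ->; rewrite scaler0 addr0.
have [M' [q [sq qU]]] := quotmod_quot sU.
exists M', q; split=> // [e Ee /qU|x Jx]; first exact: UE.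
have gM' := fgen_quot sq gM; have accM' := acc_fgenA accR fgenA gM'.
pose T n (m : M') := f x ^+ n *: m = 0.
have fxC n a : f x ^+ n * a = a * f x ^+ n by rewrite -rmorphXn f_central.
have sT n : submodule (T n).
  split=> [|a u v Tu Tv]; rewrite /T ?scaler0 // scalerDr scalerA.
  by rewrite fxC -scalerA Tu Tv scaler0 addr0.
(* The exponent [n.+1] is kept positive so that [f x ^+ n.+1] kills the image of [E]. *)
have [|V [sV [n VE] Vmax]] := accM' (fun V => exists n, forall m, V m <-> T n.+1 m).
  by exists (T 1%N); [exact: sT | exists 0%N].
have T2 m : T (n.+1 + n.+1)%N m -> T n.+1 m.
  move=> Tm; apply/VE; apply: (Vmax (T (n.+1 + n.+1)%N)) => //.
    by exists (n + n.+1)%N.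
  by move=> y /VE Ty; rewrite /T exprD -scalerA Ty scaler0.
exists n.+1 => m.
pose I (y : M) := exists m, q y = f x ^+ n.+1 *: m.
have sI : submodule I.
  split=> [|a y z [u yu] [v zv]]; first by exists 0; rewrite linear0 scaler0.
  by exists (a *: u + v); rewrite linearP yu zv scalerDr !scalerA fxC.
have IU y : I y -> U y.
  apply: Umax => // [e Ee [u qe]|y' /qU qy]; last by exists 0; rewrite qy scaler0.
  apply: UE => //; apply/qU; rewrite qe; apply: T2.
  rewrite /T exprD -scalerA -qe exprSr -scalerA -linearZ_LR kE // linear0 scaler0 //.
have [y yE] := sq (f x ^+ n.+1 *: m).
by rewrite -yE; apply/qU/IU; exists m.
Qed.

(** Multiplication by [r] is zero on [S], and by [factor_projective_syzygy] it factors on every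
    further syzygy through the free module containing it. A cocycle is a form on a syzygy; [r] times
    it therefore extends to the free module and is a coboundary. *)
Lemma rad_kills_Ext (S : lmodType B) (F : free_resolution S) r :
  (forall x : S, g r *: x = 0) ->
  forall m (c : 'cV[B]_(fr_rank F m.+1)), fr_mx F m.+1 *m c = 0 ->
  exists e, g r *: c = fr_mx F m *m e.
Proof.
move=> rS m c Nc.
have [h hE] : exists h : {linear 'rV[B]_(fr_rank F m) -> fr_syz F m},
    forall y, h (fr_i F m y) = g r *: y.
  elim: m {c Nc} => [|m [h hE]]; apply: (factor_projective_syzygy _ _ (fr_ses F _));
    try exact: projective_row; try exact: g_central.
    exists (trivmod B), \0, \0; split=> [|x]; last by rewrite rS.
    exact: projective_row.
  by exists _, (fr_i F m), h; split=> //; exact: projective_row.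
have [u uE] := column_linear c.
have [v vE] : exists v : {linear fr_syz F m -> B^o}, forall x, v (fr_q F m.+1 x) = u x.
  apply: (ses_factor (fr_ses F m.+1)) => y.
  have [x <-] := ses_surj (fr_ses F m.+2) y.
  by rewrite uE -fr_mxE -mulmxA Nc mulmx0 mxE.
have [e eE] := linear_row_column (v \o h); exists e; apply: row_mulmx_inj => x.
apply/matrixP=> i j; rewrite !ord1 mulmxA fr_mxE -eE /= hE -linearZ_LR vE uE.
rewrite !mxE; apply: eq_bigr => k _.
by rewrite !mxE mulrA -g_central.
Qed.

Lemma dual_column_exact a b c (D : 'M[B]_(a, b)) (E : 'M[B]_(b, c)) :
  row_exact D E -> column_exact (dual_mx o' E) (dual_mx o' D).
Proof.
move=> ex v Ev; have /ex[w wE] : dual_mx o v *m E = 0.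
  by rewrite -(dual_mxK o'K E) -dual_mxM // Ev dual_mx0.
by exists (dual_mx o' w); rewrite -dual_mxM // -wE dual_mxK.
Qed.

Lemma Gprojdim_op_injdim : injdim_le (B^o : lmodType B) d.
Proof.
have [D] := coresolution_exists (B^o : lmodType B).
apply: (Ext_injdim (D := D)) => M gM.
apply: (Ext_devissage g_central accR semiR fgenB (D := D) (d := d)) gM _ => //.
  exact: fgen_acc.
move=> S m gS sS dm.
have rS r : r \in @jacobson R -> forall x : S, g r *: x = 0.
  by move=> Jr; apply: (simple_rad g_central accR fgenB Jr gS); case: sS.
have [F] := free_resolution_exists (fgen_sub accR fgenB) gS.
apply: (column_exact_Ext_zero (F := F)) => c Nc.
(* [E] is the dual of the resolution of [S], now acting on rows over [A]; [Bd] and [Z] below are its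
   coboundaries and cocycles. *)
pose N k := fr_mx F k; pose E k := dual_mx o' (N k).
have EX k : column_exact (E k) (E k.+1) by apply/dual_column_exact/fr_mx_exact.
have EE k : E k *m E k.+1 = 0.
  rewrite -dual_mxM // (_ : N k.+1 *m N k = 0) ?dual_mx0 //.
  apply: row_mulmx_inj => u; rewrite mulmxA mulmx0; apply/fr_mx_exact.
  by exists u.
pose Bd (u : 'rV[A]_(fr_rank F m.+1)) := exists v, v *m E m = u.
have sBd : submodule Bd by exact: (submodule_im (mulmxr (E m))).
have [Q' [pi [spi kpi]]] := quotmod_quot sBd.
pose Z (u : 'rV[A]_(fr_rank F m.+1)) := u *m E m.+1 = 0.
have sZ : submodule Z by exact: (submodule_ker (mulmxr (E m.+1))).
have radZ x u : x \in @jacobson R -> Z u -> Bd (f x *: u).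
  move=> Jx Zu.
  have [|e eE] := rad_kills_Ext (F := F) (rS _ Jx) (m := m) (c := dual_mx o u).
    by rewrite -[fr_mx _ _](dual_mxK o'K) -dual_mxM // [_ *m _]Zu dual_mx0.
  exists (dual_mx o' e); rewrite -dual_mxM // -eE.
  apply/matrixP=> i j; rewrite !mxE -of_g -oM oK.
  by rewrite f_central.
have [|M' [q [sq qE nM']]] := rad_nilpotent_quotient (fgen_quot spi (fgen_row A _))
    (submodule_image pi sZ).
  by move=> x Jx _ [u Zu <-]; rewrite -linearZ_LR; apply/kpi/radZ.
have [M'' /Gdim_hull[L [G [s [t [st pL _]]]]]] :=
  rad_nilpotent_Gdim (fgen_quot sq (fgen_quot spi (fgen_row A _))) nM'.
have [inl inlE] := linear_pair (idfun : {linear M' -> M'}) (\0 : {linear M' -> M''}).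
pose phi : {linear 'rV[A]_(fr_rank F m.+1) -> L} := s \o (inl \o (q \o pi)).
(* This is Tor_(m+1)(S, L) = 0: [phi] kills the coboundaries, hence factors through [E m.+1] and
   vanishes on the cocycles. *)
have [|h hE] := projdim_column_exact (D := E) EX EE (g := phi) pL dm.
  move=> u; rewrite /phi /= (kpi _).2; last by exists u.
  by rewrite !linear0.
have [v vE] : Bd (dual_mx o' c).
  have Zc : Z (dual_mx o' c) by rewrite /Z -dual_mxM // Nc dual_mx0.
  apply/kpi/qE; first by exists (dual_mx o' c).
  have := hE (dual_mx o' c); rewrite Zc linear0 => /esym; rewrite /phi /=.
  rewrite -(linear0 s) => /(ses_inj st); rewrite inlE => -[->] //.
exists (dual_mx o v); rewrite -[c](dual_mxK o'K) -vE dual_mxM //.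
by rewrite dual_mxK.
Qed.

End Main.

(** * Gorenstein resolutions over Iwanaga-Gorenstein algebras *)

Section GorensteinResolutions.
Variable A : pzRingType.
Implicit Types G K M : lmodType A.

Lemma Gproj_resolution0 G : Gorenstein_projective G -> Gproj_resolution G 0.
Proof.
move=> GG; exists (fun k => if k is 0%N then G else trivmod A), (fun=> \0), idfun.
split=> //.
- by case=> [_|//]; exact: GG.
- by case=> // k _; exact: trivmod_zero.
- by move=> x; exists x.
- by move=> x; split=> /= [->|[y <-]] //; exists 0.
- by move=> k x; split=> // _; exists 0; rewrite [x]trivmod_zero.
Qed.

Lemma Gproj_resolutionS K G M (i : {linear K -> G}) (p : {linear G -> M}) n :
  Gorenstein_projective G -> ses i p -> Gproj_resolution K n -> Gproj_resolution M n.+1.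
Proof.
move=> GG sp [J [d [e [GJ J0 se ee ed]]]].
pose JG k := if k is k'.+1 then J k' else G.
pose dJ k : {linear JG k.+1 -> JG k} :=
  match k with 0%N => i \o e | k'.+1 => d k' end.
exists JG, dJ, p; split.
- by case.
- by case.
- exact: ses_surj sp.
- move=> x; rewrite (ses_exact sp x); split=> [[y <-]|[y <-]]; last by exists (e y).
  by have [z <-] := se y; exists z.
- case=> [|k] x; last exact: ed.
  rewrite -(ee x); split=> [/= ex|/= ->]; last exact: linear0.
  by apply: (ses_inj sp); rewrite ex linear0.
Qed.

Definition bi_exact a b c (D : 'M[A]_(a, b)) (E : 'M[A]_(b, c)) : Prop :=
  row_exact D E /\ column_exact D E.

(** Exactness after dualizing into [A] gives it for every projective target. [D] has two free
    indices tied by equations, which avoids casts along [i + 1]. *)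
Lemma bi_exact_Gproj (n : int -> nat) (D : forall i j, 'M[A]_(n i, n j)) G i
    (p : {linear 'rV[A]_(n (i + 1)) -> G}) :
  (forall i j k, j = i + 1 -> k = j + 1 -> bi_exact (D i j) (D j k)) ->
  surjective p -> (forall u, p u = 0 <-> exists w, u = w *m D i (i + 1)) ->
  Gorenstein_projective G.
Proof.
move=> exD sp pE.
exists (fun i => 'rV[A]_(n i) : lmodType A), (fun i => mulmxr (D i (i + 1))).
split; last first.
  exists i, p; split=> // u; rewrite pE; split=> -[w wE]; exists w; exact/esym.
split=> [k|k u|P pP k g]; first exact: projective_row.
  have [rex _] := exD k _ _ erefl erefl; apply: (iff_trans (rex u)).
  by split=> -[w wE]; exists w; exact/esym.
have [rex cex] := exD k _ _ erefl erefl; split=> [gD|[h hE] x].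
  exact: projective_column_exact cex pP gD.
rewrite -hE /= (rex (x *m D k (k + 1))).2 ?linear0 //.
by exists x.
Qed.

(** * Splicing a resolution and a dualized resolution into one complex *)

Section Splice.
Variables (p q : nat -> nat).
Variables (N : forall k, 'M[A]_(p k.+1, p k)) (T : 'M[A]_(p 0%N, q 0%N)).
Variable (E : forall k, 'M[A]_(q k, q k.+1)).

(** [Negz k] is [-(k + 1)], so [p k] sits in degree [-(k + 1)] and [q k] in degree [k]. *)
Definition splice_rank (i : int) : nat := match i with Posz k => q k | Negz k => p k end.

(* the differential [... -> p_1 -> p_0 -> q_0 -> q_1 -> ...]; it is meaningful
   for [j = i + 1] only *)
Definition splice_mx (i j : int) : 'M[A]_(splice_rank i, splice_rank j) :=
  match i, j return 'M[A]_(splice_rank i, splice_rank j) with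
  | Posz k, Posz l =>
      if k.+1 =P l is ReflectT e then castmx (erefl, congr1 q e) (E k) else 0
  | Negz 0, Posz 0 => T
  | Negz k.+1, Negz l =>
      if k =P l is ReflectT e then castmx (erefl, congr1 p e) (N k) else 0
  | _, _ => 0
  end.

Lemma splice_mx_pos k : splice_mx (Posz k) (Posz k.+1) = E k.
Proof.
rewrite /splice_mx; case: eqP => // e.
by rewrite (eq_irrelevance e erefl) castmx_id.
Qed.

Lemma splice_mx_neg k : splice_mx (Negz k.+1) (Negz k) = N k.
Proof.
rewrite /splice_mx; case: eqP => // e.
by rewrite (eq_irrelevance e erefl) castmx_id.
Qed.

Lemma splice_bi_exact : (forall k, bi_exact (N k.+1) (N k)) -> bi_exact (N 0%N) T ->
  bi_exact T (E 0%N) -> (forall k, bi_exact (E k) (E k.+1)) ->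
  forall i j k, j = i + 1 -> k = j + 1 -> bi_exact (splice_mx i j) (splice_mx j k).
Proof.
move=> NN NT TE EE.
have pos k : Posz k + 1 = Posz k.+1 by rewrite -PoszD addn1.
have neg k : Negz k.+1 + 1 = Negz k by rewrite !NegzE intS opprD addrAC addNr add0r.
have neg0 : Negz 0 + 1 = Posz 0 by [].
move=> [k|[|[|k]]] j l -> ->; rewrite ?(neg, neg0, pos).
- by rewrite !splice_mx_pos; apply: EE.
- by rewrite splice_mx_pos.
- by rewrite splice_mx_neg.
- by rewrite !splice_mx_neg; apply: NN.
Qed.

End Splice.

(* [Ext^(j+1)] from the cokernel of the row map [u |-> u *m D] vanishes *)
Definition coker_Ext_zero (R : coresolution (A^o : lmodType A)) j b c
    (D : 'M[A]_(b, c)) : Prop :=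
  forall (Q : lmodType A) (p : {linear 'rV[A]_c -> Q}), surjective p ->
  (forall u, p u = 0 <-> exists w, u = w *m D) -> Ext_zero R j Q.

Lemma row_image_ses b c (D : 'M[A]_(b, c)) :
  exists (I Q : lmodType A) (i : {linear I -> 'rV[A]_c}) (p : {linear 'rV[A]_c -> Q})
    (q : {linear 'rV[A]_b -> I}),
    [/\ ses i p, surjective q, forall u, i (q u) = u *m D &
      forall u, p u = 0 <-> exists w, u = w *m D].
Proof.
have [I [Q [i [p [sp pE]]]]] :=
  submod_ses (submodule_im (mulmxr D : {linear 'rV[A]_b -> 'rV[A]_c})).
have [q qE] : exists q : {linear 'rV[A]_b -> I}, forall u, i (q u) = u *m D.
  by apply: (ses_lift (f := mulmxr D) sp) => u; apply/pE; exists u.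
exists I, Q, i, p, q; split=> // [y|u].
  have /pE[u uE] := ses_comp0 sp y; exists u; apply: (ses_inj sp).
  by rewrite qE.
by rewrite pE; split=> -[w wE]; exists w; exact/esym.
Qed.

(** By row exactness the cokernel of [D] is isomorphic to the image of [E], the first syzygy of the
    cokernel of [E]. *)
Lemma coker_Ext_zero_step R j a b c (D : 'M[A]_(a, b)) (E : 'M[A]_(b, c)) :
  row_exact D E -> coker_Ext_zero R j.+1 E -> coker_Ext_zero R j D.
Proof.
move=> ex eE Q p sp pE; have [I [Q' [i [p' [q [ss sq iq p'E]]]]]] := row_image_ses E.
have [s sE] : exists s : {linear Q -> I}, forall u, s (p u) = q u.
  apply: surj_factor => // u /pE/ex uE; apply: (ses_inj ss).
  by rewrite iq uE linear0.
have [r rE] : exists r : {linear I -> Q}, forall u, r (q u) = p u.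
  apply: surj_factor => // u qu; apply/pE/ex.
  by rewrite -iq qu linear0.
have rs x : r (s x) = x by have [u <-] := sp x; rewrite sE rE.
apply: (Ext_zero_retract rs); apply: (Ext_zero_syzygy (@projective_row A c) ss).
by apply: eE p'E; exact: ses_surj ss.
Qed.

(** A column killed by [D] is a form on the image of [E]; it extends to the free module since Ext^1
    of the cokernel of [E] vanishes. *)
Lemma coker_Ext_zero_column R a b c (D : 'M[A]_(a, b)) (E : 'M[A]_(b, c)) :
  row_exact D E -> coker_Ext_zero R 0 E -> column_exact D E.
Proof.
move=> ex eE v Dv; have [I [Q [i [p [q [ss sq iq pE]]]]]] := row_image_ses E.
have [g gE] := column_linear v.
have [h hE] : exists h : {linear I -> A^o}, forall u, h (q u) = g u.
  apply: surj_factor => // u qu; have /ex[w ->] : u *m E = 0 by rewrite -iq qu linear0.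
  by rewrite gE -mulmxA Dv mulmx0 mxE.
have [l lE] := Ext_zero_extend ss (eE _ _ (ses_surj ss) pE) h.
have [w wE] := linear_row_column l; exists w; apply: row_mulmx_inj => u.
apply/matrixP=> k j; rewrite !ord1 -gE -hE -lE.
by rewrite mulmxA iq -wE.
Qed.

End GorensteinResolutions.

(** * Finitely generated modules over an Iwanaga-Gorenstein algebra *)

Section IwanagaGorenstein.
Variables (R : comPzRingType) (A B : pzRingType).
Variables (f : {rmorphism R -> A}) (g : {rmorphism R -> B}).
Hypothesis accR : chain_cond true R^o.
Hypothesis fgenA : fgen (restr f A^o : lmodType R).
Hypothesis fgenB : fgen (restr g B^o : lmodType R).
Variables (o : A -> B) (o' : B -> A).
Hypotheses (oK : cancel o o') (o'K : cancel o' o).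
Hypotheses (oD : {morph o : x y / x + y}) (o'D : {morph o' : x y / x + y}).
Hypotheses (oM : forall x y, o (x * y) = o y * o x)
  (o'M : forall x y, o' (x * y) = o' y * o' x).
Variables (d d' : nat).
Hypotheses (injA : injdim_le (A^o : lmodType A) d)
  (injB : injdim_le (B^o : lmodType B) d').

Lemma dual_row_exact a b c (D : 'M[A]_(a, b)) (E : 'M[A]_(b, c)) :
  D *m E = 0 -> column_exact D E -> row_exact (dual_mx o E) (dual_mx o D).
Proof.
move=> DE ex u; split=> [uD|[w ->]]; last first.
  by rewrite -mulmxA -dual_mxM // DE dual_mx0 // mulmx0.
have [w wE] : exists w, dual_mx o' u = E *m w.
  by apply: ex; rewrite -[D](dual_mxK oK) -dual_mxM // uD dual_mx0.
by exists (dual_mx o w); rewrite -dual_mxM // -wE dual_mxK.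
Qed.

Lemma Ext_zero_Gorenstein_projective (DA : coresolution (A^o : lmodType A))
    (G : lmodType A) :
  fgen G -> (forall k, Ext_zero DA k G) -> Gorenstein_projective G.
Proof.
move=> gG eG; have [DB eB] := injdim_Ext_zero injB.
have [F] := free_resolution_exists (fgen_sub accR fgenA) gG.
pose N k := fr_mx F k; pose E k := dual_mx o (N k).
have rN k : row_exact (N k.+1) (N k) by exact: fr_mx_exact.
have cN k : column_exact (N k.+1) (N k) by apply: Ext_zero_column_exact; exact: eG.
have row_exact0 (S : pzRingType) a b c (D : 'M[S]_(a, b)) (D' : 'M[S]_(b, c)) :
    row_exact D D' -> D *m D' = 0.
  move=> ex; apply: row_mulmx_inj => u; rewrite mulmxA mulmx0.
  by apply/ex; exists u.
have rE k : row_exact (E k) (E k.+1) by apply: dual_row_exact => //; exact: row_exact0.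
(* Moving [d'] places to the right exhibits the cokernel as a [d']-th syzygy, so its Ext groups are
   ones of degree above [d']. *)
have eE k j : coker_Ext_zero DB j (E k).
  suff H n : coker_Ext_zero DB (n + j) (E (n + k)%N) -> coker_Ext_zero DB j (E k).
    by apply: (H d') => Q p _ _; apply: eB; exact: leq_addr.
  elim: n => [//|n IH] eS; apply: IH.
  exact: coker_Ext_zero_step (rE _) eS.
(* [W] is Hom(G, A): the forms on the first free module that vanish on the first syzygy of [G]. *)
have [W [i [ii WE]]] := submod_sub (submodule_ker
  (mulmxr (E 0%N) : {linear 'rV[B]_(fr_rank F 0) -> _})).
have [F'] := free_resolution_exists (fgen_sub accR fgenB)
  (fgen_sub accR fgenB ii (fgen_row B _)).
pose T k := fr_mx F' k; pose T0 := lin1_mx (i \o fr_q F' 0%N).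
have T0E u : u *m T0 = i (fr_q F' 0%N u) by exact: mul_rV_lin1.
have rT k : row_exact (T k.+1) (T k) by exact: fr_mx_exact.
have rT0 : row_exact (T 0%N) T0.
  move=> u; rewrite T0E; have s0 := fr_ses F' 0%N.
  split=> [iu|[w ->]]; last by rewrite fr_mxE (ses_comp0 s0) linear0.
  have /(ses_exact s0)[y <-] : fr_q F' 0%N u = 0 by apply: ii; rewrite iu linear0.
  have [w <-] := ses_surj (fr_ses F' 1%N) y.
  by exists w; rewrite fr_mxE.
have rE0 : row_exact T0 (E 0%N).
  move=> u; rewrite [_ = 0](WE u); split=> [[y <-]|[w ->]].
    have [w <-] := ses_surj (fr_ses F' 0%N) y.
    by exists w; rewrite T0E.
  by rewrite T0E; exists (fr_q F' 0%N w).
have eT0 j : coker_Ext_zero DB j T0 by apply: coker_Ext_zero_step rE0 (eE _ _).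
have eT k j : coker_Ext_zero DB j (T k).
  elim: k j => [|k IH] j; first exact: coker_Ext_zero_step rT0 (eT0 _).
  exact: coker_Ext_zero_step (rT k) (IH _).
pose T0' := dual_mx o' T0; pose T' k := dual_mx o' (T k).
have dual_bi a b c (D : 'M[B]_(a, b)) (D' : 'M[B]_(b, c)) :
    row_exact D D' -> coker_Ext_zero DB 0 D' -> bi_exact (dual_mx o' D') (dual_mx o' D).
  move=> ex eD; split; last exact: dual_column_exact.
  move=> u; split=> [uD|[w ->]]; last first.
    by rewrite -mulmxA -dual_mxM // (row_exact0 _ _ _ _ _ _ ex) dual_mx0 // mulmx0.
  have [w wE] : exists w, dual_mx o u = D' *m w.
    apply: (coker_Ext_zero_column ex eD).
    by rewrite -[D](dual_mxK o'K) -dual_mxM // uD dual_mx0.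
  by exists (dual_mx o' w); rewrite -dual_mxM // -wE dual_mxK.
have NT0 : bi_exact (N 0%N) T0'.
  by rewrite -[N 0%N](dual_mxK oK); apply: dual_bi.
have := @splice_bi_exact A _ _ N T0' T' (fun k => conj (rN k) (cN k)) NT0
  (dual_bi _ _ _ _ _ rT0 (eT0 _)) (fun k => dual_bi _ _ _ _ _ (rT k) (eT _ _)).
(* [Negz 1] is degree -2, the source of [N 0], whose cokernel is [G]. *)
move=> /(bi_exact_Gproj (i := Negz 1) (p := fr_q F 0%N)); apply.
  exact: ses_surj (fr_ses F 0%N).
move=> u; rewrite [splice_mx _ _ _ _ _]splice_mx_neg.
rewrite (ses_exact (fr_ses F 0%N) u); split=> [[y <-]|[w ->]].
  have [w <-] := ses_surj (fr_ses F 1%N) y.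
  by exists w; rewrite fr_mxE.
by rewrite fr_mxE; exists (fr_q F 1%N w).
Qed.

(** The [d]-th syzygy has vanishing Ext into [A] in all positive degrees, so it is Gorenstein
    projective; the earlier terms are free, and the same criterion applies to them. *)
Lemma fgen_Gprojdim (M : lmodType A) : fgen M -> Gprojdim_le M d.
Proof.
move=> gM; exists d => //; have [DA eA] := injdim_Ext_zero injA.
have [F] := free_resolution_exists (fgen_sub accR fgenA) gM.
pose Y := cosyzygy M (fr_syz F).
have gY k : fgen (Y k).
  case: k => [//|k]; apply: (fgen_sub accR fgenA (ses_inj (fr_ses F k))).
  exact: fgen_row.
suff H n k : (n + k)%N = d -> Gproj_resolution (Y k) n by apply: (H d 0%N); rewrite addn0.
elim: n k => [|n IH] k nk.
  apply: Gproj_resolution0; apply: (Ext_zero_Gorenstein_projective (DA := DA)) => // j.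
  suff HE l i : Ext_zero DA (l + i) (Y 0%N) -> Ext_zero DA i (Y l).
    by apply: HE; apply: eA; rewrite -nk add0n leq_addr.
  elim: l i => [//|l IHl] i; rewrite addSnnS => /IHl.
  exact: Ext_zero_syzygy (@projective_row A _) (fr_ses F l).
have rK : Gproj_resolution (Y k.+1) n by apply: IH; rewrite -addSnnS.
apply: Gproj_resolutionS (fr_ses F k) rK.
apply: (Ext_zero_Gorenstein_projective (DA := DA)) => [|j]; first exact: fgen_row.
exact/Ext_zero_projective/projective_row.
Qed.

End IwanagaGorenstein.

(** Left-right symmetry of the radical. If a maximal [m] misses [o x], then 1 is [b + c * o x] with
    [b] in [m], and [b = o (1 - t)] with [t] in the radical of [A]; as [1 - t] is a two-sided unit,
    so is [b]. *)
Lemma jacobson_op (A B : pzRingType) (o : A -> B) (o' : B -> A) x :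
  cancel o o' -> cancel o' o -> {morph o : x y / x + y} ->
  (forall x y, o (x * y) = o y * o x) -> chain_cond true A^o ->
  x \in @jacobson A -> o x \in @jacobson B.
Proof.
move=> oK o'K oD oM accA Jx; apply/jacobsonP => m [[m0 mlin] [z nz] mmax].
apply: contrapT => nox.
pose U (y : B^o) := exists2 b, b \in m & exists c : B, y = b + c * o x.
have sU : submodule U.
  split=> [|a _ _ [b mb [c ->]] [b' mb' [c' ->]]].
    by exists 0 => //; exists 0; rewrite mul0r addr0.
  exists (a *: b + b'); first exact: mlin.
  by exists (a * c + c'); rewrite scalerDr mulrDl addrACA -mulrA.
have [|Um|UT] := mmax _ (submod_pd_closed sU).
- by move=> b mb; apply/(submod_pdP U); exists b => //; exists 0; rewrite mul0r addr0.
- apply: nox; rewrite -Um; apply/(submod_pdP U).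
  by exists 0 => //; exists 1; rewrite mul1r add0r.
have [b mb [c cE]] : U 1 by apply/(submod_pdP U); rewrite UT.
have o1 : o 1 = 1.
  by rewrite -[RHS](o'K 1) -[o' 1]mulr1 oM o'K mulr1.
have o0 : o 0 = 0 by apply: (addrI (o 0)); rewrite -oD !addr0.
have oN a : o (- a) = - o a by apply: (addrI (o a)); rewrite -oD !subrr.
pose t := x * o' c; have Jt : t \in @jacobson A by exact: jacobsonMr.
have bE : b = o (1 - t).
  by rewrite oD oN o1 oM o'K; apply: (addIr (c * o x)); rewrite subrK -cE.
(* The left inverse [u] of [1 - t] is itself [1 + u * t], so it has a left inverse [w] too, and then
   [w = 1 - t]. *)
have [u uE] := jacobson_linv accA Jt.
have Jut : - (u * t) \in @jacobson A.
  have [_ lin] := jacobson_submodl A; have := lin (- u) t 0 Jt (jacobson_submodl A).1.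
  by rewrite addr0 [_ *: _]mulNr.
have [w wE] := jacobson_linv accA Jut.
have uE' : u = 1 - - (u * t) by rewrite opprK -{1}uE mulrBr mulr1 subrK.
have wu : w * u = 1 by rewrite {1}uE'.
have wt : w = 1 - t by rewrite -[w]mulr1 -{1}uE mulrA wu mul1r.
have zE : (z : B) * o u * b = z by rewrite bE -mulrA -oM -wt wu o1 mulr1.
by case/negP: nz; have := mlin ((z : B) * o u) b 0 mb m0; rewrite addr0 [_ *: _]zE.
Qed.

(** * The opposite algebra is again a Noether algebra *)

Section OppositeAlgebra.
Variables (R : comPzRingType) (A : pzRingType) (f : {rmorphism R -> A}).
Hypothesis f_central : forall r x, f r * x = x * f r.

Definition op_structure : R -> A^c := f.

Fact op_structure_zmod : zmod_morphism op_structure.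
Proof. by move=> x y; rewrite /op_structure rmorphB. Qed.

Fact op_structure_monoid : monoid_morphism op_structure.
Proof. by split=> [|x y]; rewrite /op_structure ?rmorph1 // rmorphM f_central. Qed.

Definition op_rmorphism : {rmorphism R -> A^c} :=
  HB.pack op_structure (GRing.isZmodMorphism.Build _ _ op_structure op_structure_zmod)
    (GRing.isMonoidMorphism.Build _ _ op_structure op_structure_monoid).

Lemma op_rmorphism_central r (x : A^c) : op_rmorphism r * x = x * op_rmorphism r.
Proof. exact/esym/f_central. Qed.

Lemma op_fgen : fgen (restr f A^o : lmodType R) ->
  fgen (restr op_rmorphism (A^c)^o : lmodType R).
Proof.
move=> [n [s gen]]; exists n, s => x; have [c ->] := gen x; exists c.
by apply: eq_bigr => i _; exact: f_central.
Qed.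

End OppositeAlgebra.

Theorem theorem3p2 (A : pzRingType) (hA : semilocal_noether_algebra A)
    (d : nat) :
  [<-> Gorenstein d A;
       Gprojdim_le (residuel A) d;
       Gprojdim_le (residuer A) d].
Proof.
have [R [f [/noetherian_acc accR semiR f_central [s gen]]]] := hA.
have fgenA : fgen (restr f A^o : lmodType R).
  exists (size s), (fun i => s`_i) => x; have [c cE] := gen x.
  by exists (fun i => c i); rewrite {1}cE.
pose g := op_rmorphism f_central; have g_central := op_rmorphism_central f_central.
have fgenB := op_fgen f_central fgenA.
have accA := acc_fgenA accR fgenA (fgen_reg A).
have accB := acc_fgenA accR fgenB (fgen_reg A^c).
(* The opposite ring has the same carrier, so the identity is the anti-isomorphism in both
   directions. *)
pose o : A -> A^c := idfun; pose o' : A^c -> A := idfun.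
have oK : cancel o o' by []. have o'K : cancel o' o by [].
have oD : {morph o : x y / x + y} by []. have o'D : {morph o' : x y / x + y} by [].
have oM x y : o (x * y) = o y * o x by [].
have o'M x y : o' (x * y) = o' y * o' x by [].
have [p [sp pE]] := quotmod_pi (jacobson_submodl A).
have [q [sq qE]] := quotmod_pi (jacobson_submodr A).
have gl : fgen (residuel A) := fgen_quot sp (fgen_reg A).
have gr : fgen (residuer A) := fgen_quot sq (fgen_reg A^c).
(* [residuer] is a quotient by the radical of [A], whereas the general results for [A^c] want the
   radical defined by its own left ideals. *)
have qJ (x : A^c) : q x = 0 <-> x \in @jacobson A^c.
  rewrite qE; split=> Jx; first exact: (jacobson_op oK o'K oD oM accA Jx).
  exact: (jacobson_op o'K oK o'D o'M accB Jx).
tfae.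
- move=> [[_ _ _ [n injB]] injA].
  exact: (fgen_Gprojdim accR fgenA fgenB oK o'K oD o'D oM o'M injA injB).
- move=> Gl.
  have injA := Gprojdim_injdim f_central accR semiR fgenA sp pE Gl.
  have injB := Gprojdim_op_injdim f_central g_central accR semiR fgenA fgenB oK o'K
    oD o'D oM o'M (fun=> erefl) sp pE Gl.
  exact: (fgen_Gprojdim accR fgenB fgenA o'K oK o'D oD o'M oM injB injA).
- move=> Gr.
  have injB := Gprojdim_injdim g_central accR semiR fgenB sq qJ Gr.
  have injA := Gprojdim_op_injdim g_central f_central accR semiR fgenB fgenA o'K oK
    o'D oD o'M oM (fun=> erefl) sq qJ Gr.
  split=> //; split; [exact: acc_noetherian | exact: acc_noetherian | |]; by exists d.
Qed.
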